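(* Let $t\ge 3$ be an odd integer. If $G$ is a planar graph of maximum degree $d\ge 4$ and girth at least $6(t^2+2t-1)$, then $\chi'_t(G)\le \tau'_t(d)$, where $\tau'_t(d)=\frac{1}{d-2}\big(d(d-1)^{(t+1)/2}-d\big)$.
   Context: Graphs are simple. The line graph $L(G)$ has vertex set $E(G)$, two distinct edges being adjacent iff they share an endpoint; the distance between two edges is their distance in $L(G)$. The distance-$t$ chromatic index $\chi'_t(G)$ is the least number of colours in a colouring of $E(G)$ in which any two distinct edges at distance at most $t$ receive different colours. The girth is the length of a shortest cycle (infinite for forests). *)

(* Defs.v *)
From mathcomp Require Import all_boot all_order all_algebra.
From mathcomp Require Import all_classical all_reals all_analysis.

Set Implicit Arguments.
Unset Strict Implicit.
Unset Printing Implicit Defensive.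

Import Order.TTheory GRing.Theory Num.Theory.
Import numFieldNormedType.Exports.

Record sgraph := SGraph {
  svertex :> finType;
  adj : rel svertex;
  adj_sym : symmetric adj;
  adj_irr : irreflexive adj
}.

Section Graph.
Variable G : sgraph.
Local Open Scope nat_scope.

Definition max_degree : nat := \max_(x : G) #|[pred y | adj x y]|.

(* The girth being infinite for forests, it is only used through lower bounds. *)
Definition girth_at_least (g : nat) : Prop :=
  forall c : seq G, 3 <= size c -> ucycle (@adj G) c -> g <= size c.

(* [dist_le n x y]: there is a walk with at most [n] steps from [x] to [y]. *)
Definition dist_le (n : nat) (x y : G) : bool :=
  [exists p : n.-bseq G, path (@adj G) x p && (last x p == y)].

Definition is_edge (a : {set G}) : bool :=
  [exists x, exists y, adj x y && (a == [set x; y]%SET)].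

Definition edge := {a : {set G} | is_edge a}.

Definition line_adj (a b : edge) : bool :=
  (a != b) && (val a :&: val b != finset.set0)%SET.

Lemma line_adj_sym : symmetric line_adj.
Proof. by move=> a b; rewrite /line_adj eq_sym finset.setIC. Qed.

Lemma line_adj_irr : irreflexive line_adj.
Proof. by move=> a; rewrite /line_adj eqxx. Qed.

Definition line_graph : sgraph := SGraph line_adj_sym line_adj_irr.

End Graph.

Section DistanceChromaticIndex.
Variables (t : nat) (G : sgraph).

Definition dist_edge_colourable (k : nat) : bool :=
  [exists c : {ffun line_graph G -> 'I_k},
    [forall a, forall b, (a != b) && dist_le t a b ==> (c a != c b)]].

Lemma dist_edge_colourable_ex : exists k, dist_edge_colourable k.
Proof.
exists #|line_graph G|; apply/existsP.
exists [ffun a => enum_rank a].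
apply/forallP => a; apply/forallP => b; apply/implyP => /andP[neq_ab _].
by rewrite !ffunE (inj_eq enum_rank_inj).
Qed.

Definition dist_chromatic_index : nat := ex_minn dist_edge_colourable_ex.

End DistanceChromaticIndex.

Section Planar.
Variables (R : realType) (G : sgraph).
Local Open Scope classical_set_scope.
Local Open Scope ring_scope.

(* [G] can be drawn in the plane: vertices are distinct points, edges are
   simple arcs joining their end vertices, and the interior of an arc contains
   no vertex and no point of another arc.                                     *)
Definition planar : Prop :=
  exists (pos : G -> R * R) (arc : edge G -> R -> R * R),
  [/\ injective pos,
      forall e, {within `[0, 1], continuous (arc e)} /\
                {in `[0, 1] &, injective (arc e)},
      forall e, [set arc e 0; arc e 1] = pos @` [set x | x \in val e],
      forall e (s : R) x, s \in `]0, 1[ -> arc e s <> pos x &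
      forall e f (s u : R), e <> f -> s \in `]0, 1[ -> u \in `]0, 1[ ->
        arc e s <> arc f u].

End Planar.

Definition tau' (t d : nat) : rat :=
  ((d%:R - 2)^-1 * (d%:R * (d%:R - 1) ^+ ((t + 1) %/ 2) - d%:R))%R.

(* Main.v *)
(* Write t = 2k + 1 and K = d (1 + (d - 1) + ... + (d - 1)^k) = tau'_t(d).  Two
   edges are at distance at most t in the line graph exactly when both have an
   end within distance k of a common vertex, so one needs K colours such that
   the ball of edges around each vertex, which has at most K elements, is
   rainbow.

   This is done by induction on the vertex set U of an induced subgraph.  Let W
   be its 2-core.  If a tree hanging off W has depth more than k, its deepest
   leaf can be coloured last, since all conflicts of its edge lie in one ball.
   If W is empty and all trees are shallow, each component lies in a ball.
   Otherwise, by planarity and girth, W contains a thread of 8k + 8 edges.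
   Deleting its middle, colouring the rest and sweeping along the thread reduces
   the problem to a sequence of sets of edges (the balls around the vertices of
   the thread) to be made rainbow, the first and the last ones being already
   coloured.  As hanging trees have depth at most k, each of these sets has at
   most K - (d - 2)(d - 1)^k elements; for d >= 4 at least a third of the colours
   is therefore free at any time, which is enough to permute the colours into
   the prescribed ones while moving along four times the lifetime of an edge.

   The thread comes from Euler's inequality in the following form: there are
   more than |E(W)| - |V(W)| nonempty even sets of edges (the faces) covering
   each edge at most twice, hence one of them contains a cycle with at most five
   branch vertices.  To get these faces from a drawing by arbitrary arcs, each
   arc is cut into three pieces, and the pieces are replaced by the sets of
   pixels of a fine grid that they meet.  This exhibits the graph as a minor of
   the grid, where even sets of edges are boundaries of sets of squares. *)

Require Import Defs.
From mathcomp Require Import all_boot zify.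

Set Implicit Arguments.
Unset Strict Implicit.
Unset Printing Implicit Defensive.

(** [lia] for large contexts: hypotheses that are not of a recognised arithmetic form are cleared
    first. *)
Ltac nat_lia :=
  repeat match goal with H : ?P |- _ =>
    lazymatch type of P with Prop =>
      lazymatch P with
      | @eq nat _ _ => fail
      | is_true (leq _ _) => fail
      | is_true (andb (leq _ _) _) => fail
      | is_true (negb (andb (leq _ _) _)) => fail
      | @eq bool (andb (leq _ _) _) _ => fail
      | not (@eq nat _ _) => fail
      | or (@eq nat _ _) _ => fail
      | _ => clear H
      end
    end
  end; lia.

(** * Recolouring along a sequence of sets *)

Section Conveyor.
Variables (T : finType).
Implicit Types (A : nat -> {set T}) (i : nat).

(** One-step extensions are chained; an element alive at two consecutive times keeps its value. *)
Lemma run_exists (C : finType) A (Inv : nat -> (T -> C) -> Prop) c0 N :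
  Inv 0 c0 ->
  (forall i c, i < N -> Inv i c ->
     exists c', Inv i.+1 c' /\ {in A i :&: A i.+1, c' =1 c}) ->
  exists c : nat -> T -> C,
    [/\ forall i, i <= N -> Inv i (c i),
        forall i, i < N -> {in A i :&: A i.+1, c i.+1 =1 c i} & c 0 = c0].
Proof.
move=> I0 step.
have: forall n, n <= N -> exists c : nat -> T -> C,
    [/\ forall i, i <= n -> Inv i (c i),
        forall i, i < n -> {in A i :&: A i.+1, c i.+1 =1 c i} & c 0 = c0].
  elim=> [_|n IHn ltnN].
    by exists (fun=> c0); split=> // i; rewrite leqn0 => /eqP->.
  have [c [cI cE c00]] := IHn (ltnW ltnN).
  have [c' [c'I c'E]] := step n (c n) ltnN (cI n (leqnn n)).
  exists (fun i => if i <= n then c i else c'); split => // i.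
    rewrite leq_eqVlt => /predU1P[->|]; first by rewrite ltnn.
    by rewrite ltnS => lein; rewrite lein; apply: cI.
  rewrite ltnS => lein x; rewrite /= lein; case: ltnP => [ltin|leni]; first exact: cE.
  have -> : i = n by apply/eqP; rewrite eqn_leq lein.
  exact: c'E.
by apply.
Qed.

Lemma greedy_extension (C : finType) (Y X : {set T}) (B : {set C}) (c : T -> C) :
  [disjoint X & Y] -> {in Y &, injective c} ->
  #|X| + #|B :&: c @: Y| <= #|B| ->
  exists c', [/\ {in Y, c' =1 c}, {in X :|: Y &, injective c'} &
                 {in X, forall x, c' x \in B}].
Proof.
move=> dXY injc leB.
have {}leB : #|X| <= #|B :\: c @: Y| by rewrite cardsD; lia.
have [X0|[x0 x0X]] := set_0Vmem X.
  exists c; split=> // [|x]; last by rewrite X0 inE.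
  by rewrite X0 set0U.
have [b0 _] : exists b, b \in B :\: c @: Y.
  by apply/set0Pn; rewrite -card_gt0 (leq_trans _ leB) // card_gt0; apply/set0Pn; exists x0.
pose g x := nth b0 (enum (B :\: c @: Y)) (index x (enum X)).
have idx x : x \in X -> index x (enum X) < size (enum (B :\: c @: Y)).
  by move=> xX; rewrite -cardE (leq_trans _ leB) // cardE index_mem mem_enum.
have gB x : x \in X -> g x \in B :\: c @: Y.
  by move=> xX; rewrite -mem_enum mem_nth // idx.
have ginj : {in X &, injective g}.
  move=> x y xX yX /eqP; rewrite nth_uniq ?idx ?enum_uniq // => /eqP.
  by have := @index_inj _ x (enum X) x y; rewrite !mem_enum => /(_ xX yX).
have YX x : x \in Y -> x \in X = false.
  by move=> xY; apply/negbTE; apply: contraTN xY => xX; rewrite (disjointFr dXY).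
exists (fun x => if x \in X then g x else c x); split.
- by move=> x xY; rewrite YX.
- move=> x y; rewrite !inE.
  case xX: (x \in X); case yX: (y \in X) => //= xY yY.
  + exact: ginj.
  + by move=> E; have := gB x xX; rewrite E inE imset_f.
  + by move=> E; have := gB y yX; rewrite -E inE imset_f.
  + exact: injc.
- by move=> x xX; rewrite xX; have := gB x xX; rewrite inE => /andP[].
Qed.

Lemma injection_extension (C D : finType) (Y : {set D}) (g : D -> C) :
  {in Y &, injective g} -> #|D| <= #|C| ->
  exists h : D -> C, injective h /\ {in Y, h =1 g}.
Proof.
move=> injg leDC.
have [n leYn] := ubnP (#|D| - #|Y|).
elim: n Y g injg leYn => // n IHn Y g injg leYn.
have [YT|[x xY]] := set_0Vmem (~: Y).
  have {}YT : Y = setT by rewrite -(setCK Y) YT setC0.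
  by exists g; split => // a b; apply: injg; rewrite YT inE.
have Ylt : #|Y| < #|D|.
  by rewrite -cardsT proper_card // properT; apply: contraTneq xY => ->; rewrite !inE.
have [c cY] : exists c, c \notin g @: Y.
  apply/existsP; rewrite -negb_forall; apply/negP => /forallP all.
  have: #|C| <= #|g @: Y| by rewrite -cardsT subset_leq_card //; apply/subsetP => z _.
  by rewrite (card_in_imset injg) leqNgt (leq_trans Ylt leDC).
have xY' : x \notin Y by rewrite inE in xY.
pose g' z := if z == x then c else g z.
have gE : {in Y, g' =1 g} by move=> z zY; rewrite /g'; case: eqP => // E; rewrite -E zY in xY'.
have [||h [hi hE]] := IHn (x |: Y) g'.
- move=> a b; rewrite /g' !inE.
  case: (a =P x) => [->|_]; case: (b =P x) => [->|_] //= aY bY.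
  + by move=> E; rewrite E imset_f in cY.
  + by move=> E; rewrite -E imset_f in cY.
  + exact: injg.
- rewrite cardsU1 xY'; lia.
exists h; split=> // z zY; rewrite hE ?gE //.
by rewrite inE zY orbT.
Qed.

(* The first index of the current life of [x], which is alive at time [i]. *)
Fixpoint birth A i (x : T) : nat :=
  if i is j.+1 then if x \in A j then birth A j x else i else 0.

Lemma birth_mem A i x j : x \in A i -> birth A i x <= j <= i -> x \in A j.
Proof.
elim: i => [|i IHi] /= xA; first by rewrite leqn0 => /eqP->.
case: ifP => [xAi|_]; last by rewrite -eqn_leq => /eqP<-.
move=> /andP[bj]; rewrite leq_eqVlt => /predU1P[->//|].
by rewrite ltnS => ji; apply: IHi => //; rewrite bj.
Qed.

(* The [A i] are first decomposed into tracks: injections [tau i] into ['I_Lm],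
   constant along the life of an element.  Through them the colouring [beta] of
   the last set becomes an injection [bt] of the tracks into the colours, their
   targets.  At most [F] tracks form [T1], at most [F] are left; [D1] and [D2]
   are the respective sets of targets.  During four periods of length [s] one
   empties [D1], moves [T1] to its targets, empties [D2], and moves the other
   tracks to their targets.  A period suffices since nobody outlives it. *)
Lemma conveyor_bounded (C : finType) (s Lm F : nat) A (alpha beta : T -> C) :
  #|C| = Lm + F -> Lm <= F.*2 -> 0 < Lm -> 0 < s ->
  (forall i, #|A i| <= Lm) ->
  (forall i x, ~ (forall j, i <= j <= i + s -> x \in A j)) ->
  {in A 0 &, injective alpha} -> {in A (4 * s) &, injective beta} ->
  exists c : nat -> T -> C,
    [/\ forall i, i <= 4 * s -> {in A i &, injective (c i)},
        forall i, i < 4 * s -> {in A i :&: A i.+1, c i.+1 =1 c i},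
        c 0 = alpha & {in A (4 * s), c (4 * s) =1 beta}].
Proof.
move=> cardC leLF Lm0 s0 cardA shortA inja injb.
(* Whatever is alive was born within the last period. *)
have young i x : x \in A i -> i < birth A i x + s.
  move=> xA; rewrite ltnNge; apply/negP => le_bi; apply: (shortA (birth A i x) x) => j /andP[bj js].
  by apply: birth_mem xA _; rewrite bj (leq_trans js).
have splitA i : A i.+1 = (A i.+1 :\: A i) :|: (A i :&: A i.+1).
  by rewrite setIC setUC setID.
have disjA i : [disjoint A i.+1 :\: A i & A i :&: A i.+1].
  by rewrite -setI_eq0; apply/eqP/setP => x; rewrite !inE; case: (x \in A i); rewrite ?andbF.
have tau0 : 'I_Lm := Ordinal Lm0.
have [tau [tauI tauE _]] : exists tau : nat -> T -> 'I_Lm,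
    [/\ forall i, i <= 4 * s -> {in A i &, injective (tau i)},
        forall i, i < 4 * s -> {in A i :&: A i.+1, tau i.+1 =1 tau i} & tau 0 = tau 0].
  have [t0 [_ t0I _]] : exists t0 : T -> 'I_Lm, [/\ {in set0, t0 =1 fun=> tau0},
     {in A 0 :|: set0 &, injective t0} & {in A 0, forall x, t0 x \in setT}].
    apply: greedy_extension; rewrite ?imset0 ?setI0 ?cards0 ?cardsT ?card_ord ?addn0 //.
      by rewrite -setI_eq0 setI0.
    by move=> x y; rewrite inE.
  (* Newborn elements take tracks left free by the living ones; at most [Lm] elements are alive
     together. *)
  have [||c [cI cE _]] := @run_exists _ A (fun i c => {in A i &, injective c}) t0 (4 * s).
  - by move=> x y xA yA; apply: t0I; rewrite inE (xA, yA).
  - move=> i c _ cinj.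
    have [||c' [c'E c'I _]] := @greedy_extension _ (A i :&: A i.+1) (A i.+1 :\: A i) setT c (disjA i).
    + by move=> x y; rewrite !inE => /andP[xA _] /andP[yA _]; apply: cinj.
    + rewrite setTI card_in_imset; last first.
        by move=> x y; rewrite !inE => /andP[xA _] /andP[yA _]; apply: cinj.
      by rewrite cardsT card_ord setIC addnC cardsID.
    by exists c'; split=> //; rewrite splitA.
  by exists c; split.
pose tauL := tau (4 * s).
have tauLI : {in A (4 * s) &, injective tauL} by apply: tauI.
have [bt [btI btE]] : exists bt : 'I_Lm -> C, injective bt /\ {in A (4 * s), forall x, bt (tauL x) = beta x}.
  have C0 : 0 < #|C| by rewrite cardC; lia.
  have [c0 _] : exists c0 : C, c0 \in C by apply/card_gt0P.
  pose g y := if [pick x in A (4 * s) | tauL x == y] is Some x then beta x else c0.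
  have gE : {in A (4 * s), forall x, g (tauL x) = beta x}.
    move=> x xA; rewrite /g; case: pickP => [y /andP[yA /eqP /tauLI->]//|/(_ x)].
    by rewrite xA eqxx.
  have [||h [hI hE]] := @injection_extension C 'I_Lm (tauL @: A (4 * s)) g.
  - move=> _ _ /imsetP[x xA ->] /imsetP[y yA ->]; rewrite !gE //.
    by move/injb => ->.
  - by rewrite card_ord cardC leq_addr.
  exists h; split=> // x xA; rewrite hE ?gE //; exact: imset_f.
pose T1 := [set y : 'I_Lm | y < F].
pose D1 := bt @: T1.
pose D2 := bt @: ~: T1.
have eT1 : #|T1| = size (take F (enum 'I_Lm)).
  rewrite cardsE -(card_uniqP _) ?take_uniq ?enum_uniq //.
  by apply: eq_card => y; rewrite in_take ?mem_enum // index_enum_ord.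
have szT1 : #|T1| = minn F Lm by rewrite eT1 size_take size_enum_ord; case: ltnP; lia.
have cardT1 : #|T1| <= F by rewrite szT1 geq_minl.
have cardT2 : #|~: T1| <= F.
  by have := cardsC T1; rewrite card_ord szT1; lia.
(* [pre b y] tells whether an element born at time [b] on track [y] takes its target at once: after
   the first period for [T1], after the third for every track. The other newborns use the palette
   [B b], which avoids [D1] from the start and [D2] after the second period. *)
pose pre b y := (s < b) && (y \in T1) || (3 * s < b).
pose B b := if b <= 2 * s then ~: D1 else ~: (D1 :|: D2).
have cardB b : b <= 2 * s -> Lm <= #|B b|.
  move=> bs; rewrite /B bs; have := cardsC D1; rewrite cardC.
  by have := card_imset T1 btI; rewrite -/D1; lia.
have cardJ b : 2 * s < b -> F <= #|B b|.
  rewrite ltnNge => /negbTE bs; rewrite /B bs; have := cardsC (D1 :|: D2); rewrite cardC.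
  rewrite /D1 /D2 -imsetU setUCr card_imset // cardsT card_ord; lia.
have BD1 b y : y \in T1 -> bt y \notin B b.
  by move=> yT; rewrite /B; case: ifP; rewrite !inE imset_f //.
have BD2 b y : 2 * s < b -> bt y \notin B b.
  rewrite ltnNge => /negbTE bs; rewrite /B bs !inE negbK.
  have [yT|yT] := boolP (y \in T1); first by rewrite /D1 imset_f.
  by rewrite orbC /D2 imset_f // inE yT.
(* The elements with birth [0] carry colours of [alpha] that may be anything; they are gone before
   targets are handed out. *)
pose Inv i c := [/\ {in A i &, injective c},
  i = 0 -> c = alpha &
  {in A i, forall x, 0 < birth A i x -> i <= 4 * s ->
     if pre (birth A i x) (tau i x) then c x = bt (tau i x) else c x \in B (birth A i x)}].
have step i c : i < 4 * s -> Inv i c ->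
    exists c', Inv i.+1 c' /\ {in A i :&: A i.+1, c' =1 c}.
  move=> ltis [cI _ cB].
  set Y := A i :&: A i.+1.
  set X := A i.+1 :\: A i.
  have bX x : x \in X -> birth A i.+1 x = i.+1.
    by rewrite !inE /= => /andP[/negbTE->].
  have bY x : x \in Y -> birth A i.+1 x = birth A i x.
    by rewrite !inE /= => /andP[->].
  have yY x : x \in Y -> i.+1 < birth A i x + s.
    by move=> xY; rewrite -bY //; apply: young; move: xY; rewrite inE => /andP[].
  pose X1 := [set x in X | pre i.+1 (tau i.+1 x)].
  pose X2 := X :\: X1.
  pose c1 x := if x \in X1 then bt (tau i.+1 x) else c x.
  have X1X x : x \in X1 -> x \in X by rewrite inE => /andP[].
  have XA x : x \in X -> x \in A i.+1 by rewrite inE => /andP[].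
  have YA x : x \in Y -> x \in A i.+1 by rewrite inE => /andP[].
  have X1pre x : x \in X1 -> pre i.+1 (tau i.+1 x) by rewrite inE => /andP[].
  have YX x : x \in Y -> x \in X = false.
    by rewrite !inE => /andP[-> _].
  have c1Y : {in Y, c1 =1 c}.
    move=> x xY; rewrite /c1; case: ifP => // /X1X; by rewrite YX.
  have cY x : x \in Y -> s < i.+1 ->
     if pre (birth A i x) (tau i.+1 x) then c x = bt (tau i.+1 x) else c x \in B (birth A i x).
    move=> xY si; have := cB x; rewrite -tauE //; apply; last 2 first.
    - by have := yY _ xY; lia.
    - exact: ltnW.
    by move: xY; rewrite inE => /andP[].
  (* A target being handed out is free: an older element either has its own target, on another
     track, or was born when this target was already excluded from the palette. *)
  have clash x y : x \in X1 -> y \in Y -> bt (tau i.+1 x) <> c y.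
    move=> xX1 yY' E; have := X1pre _ xX1; rewrite /pre => pre_x.
    have si : s < i.+1 by case/orP: pre_x; lia.
    have := cY y yY' si; case: ifP => [_|].
      rewrite -E => /btI /tauI E'; move: (X1X _ xX1); rewrite E' ?YX //.
      - by apply: XA; apply: X1X.
      - exact: YA.
    rewrite -E => _; apply/negP.
    case/orP: pre_x => [/andP[_ xT]|is3]; first exact: BD1.
    by apply: BD2; have := yY _ yY'; lia.
  have c1I : {in Y :|: X1 &, injective c1}.
    move=> x y; rewrite /c1 ![_ \in Y :|: X1]inE.
    case xX: (x \in X1); case yX: (y \in X1); rewrite ?orbT ?orbF //.
    - by move=> _ _ /btI; apply: tauI => //; apply/XA/X1X.
    - by move=> _ yY' /clash; case.
    - by move=> xY _ /esym/clash; case.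
    - by rewrite !inE => /andP[xA _] /andP[yA _]; apply: cI.
  have [||c' [c'E c'I c'B]] := @greedy_extension _ (Y :|: X1) X2 (B i.+1) c1 _ c1I.
  - rewrite -setI_eq0; apply/eqP/setP => x; rewrite [LHS]inE [_ \in Y :|: _]inE [_ \in X2]inE [RHS]inE.
    case xX1: (x \in X1) => //=; case xY: (x \in Y); rewrite ?andbF //=.
    by rewrite YX.
  - have sub : X2 :|: (Y :|: X1) \subset A i.+1.
      by apply/subsetP => x; rewrite !inE => /or3P[/andP[_ /andP[]]|/andP[]|/andP[/andP[]]].
    have dis : [disjoint X2 & Y :|: X1].
      rewrite -setI_eq0; apply/eqP/setP => x; rewrite [LHS]inE [_ \in Y :|: _]inE [_ \in X2]inE [RHS]inE.
      case xX1: (x \in X1) => //=; case xY: (x \in Y); rewrite ?andbF //=.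
      by rewrite YX.
    (* During the first two periods the palette has room for all living elements. *)
    have [le2s|lt2s] := leqP i.+1 (2 * s).
      apply: leq_trans (cardB _ le2s); apply: leq_trans (cardA i.+1).
      rewrite (leq_trans _ (subset_leq_card sub)) // cardsU.
      move: dis; rewrite -setI_eq0 => /eqP->; rewrite cards0 subn0 leq_add2l.
      by rewrite (leq_trans (subset_leq_card (subsetIr _ _))) // leq_imset_card.
    (* In the third period the living elements on tracks of [T1] have their targets, so those using
       the palette sit on the at most [F] other tracks, and [F] colours are nobody's target. In the
       fourth period [X2] is empty. *)
    have [X20|[x0]] := set_0Vmem X2.
      by rewrite X20 cards0 add0n subset_leq_card // subsetIl.
    rewrite !inE => /andP[+ /andP[x0A x0A']]; rewrite x0A x0A' /= /pre negb_or.
    rewrite -leqNgt (leq_ltn_trans _ lt2s) ?leq_pmull // => /andP[_ le3s].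
    apply: leq_trans (cardJ _ lt2s); apply: leq_trans cardT2.
    pose Z := [set x in Y :|: X1 | c1 x \in B i.+1].
    have -> : B i.+1 :&: c1 @: (Y :|: X1) = c1 @: Z.
      apply/setP => y; rewrite inE; apply/andP/imsetP.
        by move=> [yB /imsetP[x xYX Ey]]; exists x; rewrite // inE xYX -Ey.
      move=> [x xZ ->]; move: xZ; rewrite inE => /andP[xYX ->].
      by rewrite imset_f.
    have ZYX : Z \subset Y :|: X1 by apply/subsetP => x; rewrite inE => /andP[].
    rewrite (card_in_imset (sub_in2 (subsetP ZYX) c1I)).
    have -> : #|X2| + #|Z| = #|X2 :|: Z|.
      rewrite cardsU; suff -> : X2 :&: Z = set0 by rewrite cards0 subn0.
      apply/eqP; rewrite -subset0; apply: subset_trans (setIS _ ZYX) _.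
      by move: dis; rewrite -setI_eq0 subset0.
    have subZ : X2 :|: Z \subset A i.+1.
      by apply: subset_trans sub; apply: setUS.
    rewrite -(card_in_imset (sub_in2 (subsetP subZ) (tauI _ ltis))).
    apply/subset_leq_card/subsetP => _ /imsetP[x xXZ ->]; rewrite inE.
    move: xXZ; rewrite inE => /orP[].
      rewrite inE => /andP[xX1 xX]; apply: contraNN xX1 => xT.
      by rewrite inE xX /pre xT (leq_ltn_trans _ lt2s) ?leq_pmull.
    rewrite inE => /andP[xYX xB]; apply/negP => xT.
    case xX1: (x \in X1).
      by move: xB; rewrite /c1 xX1; apply/negP/BD1.
    move: xYX; rewrite inE xX1 orbF => xY; move: xB; rewrite c1Y //.
    have := cY x xY; rewrite /pre xT andbT.
    have -> : s < birth A i x by have := yY x xY; lia.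
    by move=> /(_ _)->; [apply/negP/BD1 | lia].
  exists c'; split; last first.
    by move=> x xY; rewrite c'E ?c1Y // inE xY.
  have splitXY : A i.+1 = X2 :|: (Y :|: X1).
    rewrite splitA -/Y -/X; apply/setP => x; rewrite ![_ \in _ :|: _]inE [_ \in X2]inE.
    case xX1: (x \in X1); rewrite ?orbT ?orbF //=; by rewrite X1X.
  split=> //; first by rewrite splitXY.
  move=> x xA b0 _; case xX: (x \in X).
    rewrite bX //; case: ifP => xpre.
      have xX1 : x \in X1 by rewrite inE xX.
      by rewrite c'E /c1 ?xX1 // [_ \in _ :|: _]inE xX1 orbT.
    by apply: c'B; rewrite [_ \in X2]inE [_ \in X1]inE xX xpre.
  have xY : x \in Y by move: xX; rewrite !inE xA andbT => /negbFE->.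
  have xYX : x \in Y :|: X1 by rewrite inE xY.
  rewrite bY // c'E // c1Y // (tauE i ltis x xY).
  apply: cB; [by move: xY; rewrite inE => /andP[] | by rewrite -bY | exact: ltnW].
have [|c [cInv cE c0E]] := @run_exists _ A Inv alpha (4 * s) _ step.
  by split.
exists c; split=> //.
- by move=> i /cInv[].
move=> x xA; have [_ _ /(_ x xA)] := cInv (4 * s) (leqnn _).
have := young _ _ xA => yx; rewrite /pre.
have -> : 3 * s < birth A (4 * s) x by lia.
rewrite orbT => /(_ _ (leqnn _))->; last lia.
exact: btE.
Qed.

(** At either end only the elements shared with the neighbouring set matter. Replacing the end sets
    by these intersections, and the sets beyond [4 * s] by the empty set, removes the size bound at
    both ends. *)
Lemma conveyor (C : finType) (s Lm F : nat) A (alpha beta : T -> C) :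
  #|C| = Lm + F -> Lm <= F.*2 -> 0 < Lm -> 0 < s ->
  (forall i, 0 < i < 4 * s -> #|A i| <= Lm) ->
  (forall i x, i + s <= 4 * s -> ~ (forall j, i <= j <= i + s -> x \in A j)) ->
  {in A 0 &, injective alpha} -> {in A (4 * s) &, injective beta} ->
  exists c : nat -> T -> C,
    [/\ forall i, i <= 4 * s -> {in A i &, injective (c i)},
        forall i, i < 4 * s -> {in A i :&: A i.+1, c i.+1 =1 c i},
        c 0 = alpha & c (4 * s) = beta].
Proof.
move=> cardC leLF Lm0 s0 cardA shortA inja injb.
pose A' i := if i == 0 then A 0 :&: A 1
  else if i < 4 * s then A i
  else if i == 4 * s then A (4 * s).-1 :&: A (4 * s) else set0.
have s4 : 1 < 4 * s by lia.
have A'0 : A' 0 = A 0 :&: A 1 by [].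
have A'N : A' (4 * s) = A (4 * s).-1 :&: A (4 * s).
  by rewrite /A' ltnn eqxx; case: eqP => // ; lia.
have A'i i : 0 < i < 4 * s -> A' i = A i.
  by case/andP=> i0 is4; rewrite /A' is4 eqn0Ngt i0.
have A'sub i : A' i \subset A i.
  rewrite /A'; case: eqP => [->|_]; first exact: subsetIl.
  case: ifP => // _; case: eqP => [->|_]; [exact: subsetIr | exact: sub0set].
have A'big i : 4 * s < i -> A' i = set0.
  by move=> h; rewrite /A'; case: eqP => [|_]; [lia|]; rewrite ltnNge ltnW //=; case: eqP => //; lia.
have [||||c [cI cE c0 cN]] := @conveyor_bounded C s Lm F A' alpha beta cardC leLF Lm0 s0.
- move=> i; have [i0|i0] := posnP i.
    by rewrite i0 A'0 (leq_trans (subset_leq_card (subsetIr _ _))) // cardA.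
  have [is4|] := ltnP i (4 * s); first by rewrite A'i ?cardA ?i0.
  rewrite leq_eqVlt => /predU1P[<-|is4]; last by rewrite A'big ?cards0.
  by rewrite A'N (leq_trans (subset_leq_card (subsetIl _ _))) // cardA //; lia.
- move=> i x; have [is4|is4] := leqP (i + s) (4 * s).
    move=> h; apply: (shortA i x is4) => j /h; exact/subsetP.
  by move=> /(_ (i + s)); rewrite leq_addr leqnn A'big // inE => /(_ isT).
- by move=> x y /(subsetP (A'sub _)) xA /(subsetP (A'sub _)) yA; apply: inja.
- by move=> x y /(subsetP (A'sub _)) xA /(subsetP (A'sub _)) yA; apply: injb.
exists (fun i => if i == 0 then alpha else if i == 4 * s then beta else c i); split => //.
- move=> i is4; case: eqP => [->//|i0]; case: eqP => [->//|i4].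
  by rewrite -A'i; [apply: cI | lia].
- move=> i is4 x xA /=; rewrite (ltn_eqF is4); case: eqP => [i1|i1].
    have Ei : i = (4 * s).-1 by lia.
    case: eqP => i0; first by lia.
    have xA' : x \in A' (4 * s).
      by rewrite A'N -Ei -i1; move: xA; rewrite inE.
    rewrite -cN // -i1; apply: cE => //; rewrite inE A'i; last by lia.
    by rewrite i1 xA' andbT; move: xA; rewrite inE => /andP[].
  case: eqP => [i0|i0].
    rewrite i0 -c0; apply: cE; first lia.
    by move: xA; rewrite i0 A'0 (A'i 1) ?s4 // !inE => /andP[-> ->].
  apply: cE => //; rewrite !A'i //; lia.
by rewrite eqxx; case: eqP => //; lia.
Qed.
End Conveyor.

(** * Balls of edges *)

Lemma card_bigcup_le (I T : finType) (P : pred I) (H : I -> {set T}) (h : I -> nat) :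
  (forall i, P i -> #|H i| <= h i) -> #|\bigcup_(i | P i) H i| <= \sum_(i | P i) h i.
Proof.
move=> le; apply: (big_ind2 (fun (A : {set T}) m => #|A| <= m)) => [|A m B n Am Bn|//].
  by rewrite cards0.
by rewrite (leq_trans (leq_card_setU _ _)) // leq_add.
Qed.

Section Balls.
Variables (G : finType) (adj : rel G).
Hypotheses (adjC : symmetric adj) (adjI : irreflexive adj).
Implicit Types (U W : {set G}) (u x y z : G) (n k : nat).

Definition nbr U x := [set y in U | adj x y].

Fixpoint reach U n u : {set G} :=
  if n is m.+1 then reach U m u :|: [set z in U | [exists y in reach U m u, adj y z]]
  else [set u].

Definition edges U : {set {set G}} :=
  [set e | [exists x in U, exists y in U, adj x y && (e == [set x; y])]].

Definition edge_ball U k u : {set {set G}} :=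
  [set e | [exists x in reach U k u, exists y in U, adj x y && (e == [set x; y])]].

Lemma edgesP U e :
  reflect (exists x y, [/\ x \in U, y \in U, adj x y & e = [set x; y]]) (e \in edges U).
Proof.
rewrite inE; apply: (iffP existsP) => [[x /andP[xU /existsP[y /and3P[yU xy /eqP->]]]]|[x [y [xU yU xy ->]]]].
  by exists x, y.
by exists x; rewrite xU; apply/existsP; exists y; rewrite yU xy eqxx.
Qed.

Lemma edge_ballP U k u e :
  reflect (exists x y, [/\ x \in reach U k u, y \in U, adj x y & e = [set x; y]]) (e \in edge_ball U k u).
Proof.
rewrite inE; apply: (iffP existsP) => [[x /andP[xU /existsP[y /and3P[yU xy /eqP->]]]]|[x [y [xU yU xy ->]]]].
  by exists x, y.
by exists x; rewrite xU; apply/existsP; exists y; rewrite yU xy eqxx.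
Qed.

Lemma reachSP U n u z :
  reflect (z \in reach U n u \/ exists2 y, y \in reach U n u & z \in U /\ adj y z)
          (z \in reach U n.+1 u).
Proof.
rewrite /= !inE; apply: (iffP orP) => -[?|h]; try by left.
  by case/andP: h => zU /existsP[y /andP[yR yz]]; right; exists y.
by case: h => y yR [zU yz]; right; rewrite zU; apply/existsP; exists y; rewrite yR.
Qed.

Lemma reach_refl U n u : u \in reach U n u.
Proof. by elim: n => [|n IHn]; rewrite ?inE ?IHn //= inE. Qed.

Lemma reach_step U n u y z : y \in reach U n u -> z \in U -> adj y z -> z \in reach U n.+1 u.
Proof. by move=> yR zU yz; apply/reachSP; right; exists y. Qed.

Lemma reach_sub U n u : u \in U -> reach U n u \subset U.
Proof.
move=> uU; elim: n => [|n IHn]; first by rewrite sub1set.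
by apply/subsetP => z /reachSP[/(subsetP IHn)//|[y _ []]].
Qed.

Lemma reach_leq U m n u z : m <= n -> z \in reach U m u -> z \in reach U n u.
Proof.
elim: n => [|n IHn]; first by rewrite leqn0 => /eqP->.
rewrite leq_eqVlt ltnS => /predU1P[->//|mn zR].
by apply/reachSP; left; apply: IHn.
Qed.

Lemma reach_trans U m n u y z :
  y \in reach U m u -> z \in reach U n y -> z \in reach U (m + n) u.
Proof.
move=> yR; elim: n z => [|n IHn] z; first by rewrite inE addn0 => /eqP->.
rewrite addnS => /reachSP[/IHn h|[x /IHn xR [zU xz]]]; first by apply/reachSP; left.
exact: reach_step xz.
Qed.

Lemma reach_sym U n u z : u \in U -> z \in reach U n u -> u \in reach U n z.
Proof.
move=> uU; elim: n z => [|n IHn] z; first by rewrite !inE eq_sym.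
move=> /reachSP[/IHn h|[y yR [zU yz]]]; first by apply/reachSP; left.
rewrite -add1n; apply: reach_trans (IHn _ yR).
by apply: reach_step (reach_refl _ _ _) _ _; rewrite ?(subsetP (reach_sub n uU)) // adjC.
Qed.

Lemma reachS U1 U n u : U1 \subset U -> reach U1 n u \subset reach U n u.
Proof.
move=> sub; elim: n => // n IHn; apply/subsetP => z.
move=> /reachSP[/(subsetP IHn) h|[y yR [zU yz]]]; first by apply/reachSP; left.
by apply: reach_step yz; apply: (subsetP sub) || apply: (subsetP IHn).
Qed.

Lemma edge_ball_sub_edges U n u : u \in U -> edge_ball U n u \subset edges U.
Proof.
move=> uU; apply/subsetP => _ /edge_ballP[x [y [xR yU xy ->]]].
by apply/edgesP; exists x, y; split=> //; apply: (subsetP (reach_sub n uU)).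
Qed.

Lemma edge_ball_end U n u x y :
  u \in U -> adj x y -> [set x; y] \in edge_ball U n u ->
  [/\ x \in U, y \in U & x \in reach U n u \/ y \in reach U n u].
Proof.
move=> uU xy /edge_ballP[a [b [aR bU ab E]]].
have aU := subsetP (reach_sub n uU) _ aR.
have Ei : [set x; y] =i [set a; b] by rewrite E.
have := Ei x; have := Ei y; rewrite !inE !eqxx orbT /=.
case/esym/orP=> /eqP yE; case/esym/orP=> /eqP xE; rewrite xE yE; split; auto.
by move: xy; rewrite xE yE adjI.
Qed.

Lemma edge_ball_intro U n u x y :
  x \in reach U n u -> y \in U -> adj x y -> [set x; y] \in edge_ball U n u.
Proof. by move=> xR yU xy; apply/edge_ballP; exists x, y. Qed.

(* The last directed edges of the non-backtracking walks of [j.+1] steps whose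
   first step is [(a, w)]. *)
Fixpoint dlev U j a w : {set G * G} :=
  if j is i.+1 then
    \bigcup_(p in dlev U i a w) [set (p.2, z) | z in nbr U p.2 :\ p.1]
  else [set (a, w)].

Lemma dlevSP U j a w y z :
  reflect (exists2 x, (x, y) \in dlev U j a w & [/\ z \in U, adj y z & z != x])
          ((y, z) \in dlev U j.+1 a w).
Proof.
apply: (iffP bigcupP) => [[[x y'] /= xyD /imsetP[z' + [-> ->]]]|[x xyD [zU yz zx]]].
  by rewrite !inE => /and3P[zx zU yz]; exists x.
by exists (x, y) => //; apply/imsetP; exists z; rewrite // !inE zx zU.
Qed.

Lemma dlev_adj U j a w y z :
  a \in U -> w \in U -> adj a w -> (y, z) \in dlev U j a w -> [/\ y \in U, z \in U & adj y z].
Proof.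
move=> aU wU aw; elim: j y z => [|j IHj] y z; first by rewrite inE => /eqP[-> ->].
by move=> /dlevSP[x /IHj[xU yU xy] [zU yz _]].
Qed.

Lemma card_dlev U q j a w :
  a \in U -> w \in U -> adj a w -> {in U, forall x, #|nbr U x| <= q.+1} ->
  #|dlev U j a w| <= q ^ j.
Proof.
move=> aU wU aw deg; elim: j => [|j IHj]; first by rewrite cards1.
have : \sum_(p in dlev U j a w) q <= q ^ j.+1.
  by rewrite sum_nat_const expnS mulnC leq_mul2l IHj orbT.
apply: leq_trans; rewrite /=.
apply: leq_trans (_ : \sum_(p in dlev U j a w) #|[set (p.2, z) | z in nbr U p.2 :\ p.1]| <= _).
  exact: card_bigcup_le.
apply: leq_sum => -[x y] /(dlev_adj aU wU aw)[xU yU xy] /=.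
rewrite (leq_trans (leq_imset_card _ _)) //.
have := deg y yU; rewrite (cardsD1 x (nbr U y)) inE xU adjC xy; lia.
Qed.

Definition geom q n := \sum_(j < n) q ^ j.

Lemma geomS q n : geom q n.+1 = geom q n + q ^ n.
Proof. by rewrite /geom big_ord_recr. Qed.

(** A step that turns back leads to a vertex already reached by a shorter walk, so non-backtracking
    walks suffice. *)
Lemma reach_dlev U n a z : z \in reach U n a ->
  z = a \/ exists w j y, [/\ w \in nbr U a, j < n & (y, z) \in dlev U j a w].
Proof.
elim: n z => [|n IHn] z; first by rewrite inE => /eqP; left.
move=> /reachSP[/IHn[->|[w [j [y [wN jn yz]]]]]|]; first by left.
  by right; exists w, j, y; split=> //; apply: ltnW.
move=> [x /IHn[->|[w [j [y [wN jn yxD]]]]] [zU xz]].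
  by right; exists z, 0, a; split; rewrite ?inE ?zU ?eqxx.
have [->|zy] := eqVneq z y; last first.
  right; exists w, j.+1, x; split=> //; apply/dlevSP; exists y => //.
case: j jn yxD => [|j] jn; first by rewrite inE => /eqP[->]; left.
move=> /dlevSP[x' xyD _]; right; exists w, j, x'; split=> //; lia.
Qed.

Lemma card_ball_sum U k a : a \in U ->
  #|edge_ball U k a| <= \sum_(w in nbr U a) \sum_(j < k.+1) #|dlev U j a w|.
Proof.
move=> aU.
pose F w := \bigcup_(j < k.+1) [set [set p.1; p.2] | p in dlev U j a w].
apply: leq_trans (_ : #|\bigcup_(w in nbr U a) F w| <= _).
  apply/subset_leq_card/subsetP => e /edge_ballP[x [y [xR yU xy ->]]].
  apply/bigcupP; have [E|[w [j [x' [wN jk xD]]]]] := reach_dlev xR.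
    exists y; first by rewrite inE yU -E.
    by apply/bigcupP; exists ord0 => //; apply/imsetP; exists (a, y); rewrite ?inE ?E.
  (* Stepping back to [x'] retraces the last edge, already present at level [j]; otherwise the walk
     grows by one step, which stays within [k.+1] levels. *)
  exists w => //; apply/bigcupP; have [->|yx] := eqVneq y x'.
    by exists (inord j) => //; apply/imsetP; exists (x', x); [rewrite inordK // leqW | rewrite setUC].
  exists (inord j.+1) => //; apply/imsetP; exists (x, y); rewrite ?inordK //.
  by apply/dlevSP; exists x'.
apply: card_bigcup_le => w _; apply: card_bigcup_le => j _; exact: leq_imset_card.
Qed.

Lemma card_ball U k q a :
  a \in U -> {in U, forall x, #|nbr U x| <= q.+1} -> #|edge_ball U k a| <= q.+1 * geom q k.+1.
Proof.
move=> aU deg; apply: leq_trans (card_ball_sum k aU) _.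
apply: leq_trans (_ : \sum_(w in nbr U a) geom q k.+1 <= _).
  apply: leq_sum => w; rewrite inE => /andP[wU aw].
  by apply: leq_sum => j _; apply: card_dlev.
by rewrite sum_nat_const leq_mul2r deg ?orbT.
Qed.

End Balls.

(** * Rooted trees attached to a core *)

Section Rooted.
Variables (G : finType) (adj : rel G).
Hypotheses (adjC : symmetric adj) (adjI : irreflexive adj).
Implicit Types (U W : {set G}) (u x y z : G) (n k : nat) (dep : G -> nat) (par : G -> G).

Local Notation nbr := (nbr adj).
Local Notation reach := (reach adj).
Local Notation edge_ball := (edge_ball adj).

(* [U] consists of the core [W] and of trees, hanging off [W] or isolated; the
   depth of a vertex is its distance to [W] or to the root of its tree. *)
Record rooted U W dep par : Prop := Rooted {
  rooted_sub : W \subset U;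
  rooted_core : {in W, forall x, dep x = 0};
  rooted_par : forall x j, x \in U -> dep x = j.+1 ->
    [/\ par x \in U, adj x (par x) & dep (par x) = j];
  rooted_edge : forall x y, x \in U -> y \in U -> adj x y ->
    [\/ x \in W /\ y \in W, par x = y /\ dep x = (dep y).+1
      | par y = x /\ dep y = (dep x).+1]
}.

(** A vertex of degree at most one is removed, the rest is treated by induction, and the vertex is
    put back: as the child of its only neighbour, or as the root of a new tree if it is isolated.
    What cannot be peeled is the 2-core. *)
Lemma peel U : exists W dep par,
  rooted U W dep par /\ {in W, forall x, 1 < #|nbr W x|}.
Proof.
have [n] := ubnP #|U|; elim: n U => // n IHn U leUn.
have [/forallP all2|] := boolP [forall x in U, 1 < #|nbr U x|].
  exists U, (fun=> 0), id; split; last by move=> x xU; have /implyP := all2 x; apply.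
  by split=> // x y xU yU _; constructor 1.
rewrite negb_forall => /existsP[x]; rewrite negb_imply -leqNgt => /andP[xU xdeg].
have U1U : U :\ x \subset U by apply: subD1set.
have [|W [dep [par [[WU W0 Wpar Wedge] Wdeg]]]] := IHn (U :\ x).
  by rewrite (cardsD1 x) xU in leUn.
have WU' := subset_trans WU U1U.
have Wx z : z \in W -> z != x by move/(subsetP WU); rewrite !inE => /andP[].
have [nx0|[y]] := set_0Vmem (nbr U x).
  have nox z : z \in U -> adj x z = false.
    by move=> zU; move/setP: nx0 => /(_ z); rewrite !inE zU.
  exists W, (fun z => if z == x then 0 else dep z), par; split=> //; split=> //.
  - by move=> z zW; rewrite (negbTE (Wx z zW)) W0.
  - move=> z j zU; case: eqP => // /eqP zx dz.
    have [|pU zp dp] := Wpar z j _ dz; first by rewrite !inE zx.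
    move: pU; rewrite !inE => /andP[px pU]; by rewrite (negbTE px).
  - move=> z z' zU zU' zz.
    case: eqP => [E|/eqP zx]; first by rewrite E nox in zz.
    case: eqP => [E|/eqP zx']; first by rewrite adjC E nox in zz.
    by apply: Wedge; rewrite ?inE ?zx ?zx'.
rewrite inE => /andP[yU xy].
have xN z : z \in U -> adj x z -> z = y.
  move=> zU xz; apply/eqP; apply: contraTT xdeg => zy; rewrite -ltnNge.
  have <- : #|[set z; y]| = 2 by rewrite cards2 zy.
  by apply/subset_leq_card/subsetP => w; rewrite !inE => /orP[]/eqP->; rewrite ?zU ?yU ?xz ?xy.
have yx : y != x by apply: contraTneq xy => ->; rewrite adjI.
exists W, (fun z => if z == x then (dep y).+1 else dep z), (fun z => if z == x then y else par z).
split=> //; split=> //.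
- by move=> z zW; rewrite (negbTE (Wx z zW)) W0.
- move=> z j zU; case: (z =P x) => [->|/eqP zx] dz.
    by rewrite (negbTE yx); case: dz.
  have [|pU zp dp] := Wpar z j _ dz; first by rewrite !inE zx.
  move: pU; rewrite !inE => /andP[px pU]; by rewrite (negbTE px).
- move=> z z' zU zU' zz.
  case: (z =P x) => [E|/eqP zx].
    by rewrite E in zz; rewrite (xN _ zU' zz) (negbTE yx); constructor 2.
  case: (z' =P x) => [E|/eqP zx'].
    by rewrite adjC E in zz; rewrite (xN _ zU zz); constructor 3.
  by apply: Wedge; rewrite ?inE ?zx ?zx'.
Qed.

Section Structure.
Variables (U W : {set G}) (dep : G -> nat) (par : G -> G).
Hypothesis rU : rooted U W dep par.

Lemma rooted_iter x j : x \in U -> j <= dep x ->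
  [/\ iter j par x \in U, dep (iter j par x) = dep x - j & iter j par x \in reach U j x].
Proof.
move=> xU; elim: j => [|j IHj] jx; first by rewrite subn0 inE.
have [pU dp pR] := IHj (ltnW jx).
have [|p'U ap dp'] := rooted_par rU (j := dep x - j.+1) pU; first nat_lia.
by split=> //; apply: reach_step pR _ _.
Qed.

(** The vertex of the core from which [x] hangs, or the root of its isolated tree. *)
Definition rroot x := iter (dep x) par x.

Lemma rroot_in x : x \in U -> rroot x \in U.
Proof. by move=> xU; have [] := rooted_iter xU (leqnn _). Qed.

Lemma rroot_dep x : x \in U -> dep (rroot x) = 0.
Proof. by move=> xU; have [_ -> _] := rooted_iter xU (leqnn _); rewrite subnn. Qed.

Lemma rroot0 x : dep x = 0 -> rroot x = x.
Proof. by rewrite /rroot => ->. Qed.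

Lemma rroot_reach x : x \in U -> x \in reach U (dep x) (rroot x).
Proof. by move=> xU; have [_ _] := rooted_iter xU (leqnn _); apply: reach_sym. Qed.

Lemma rroot_par x y : par x = y -> dep x = (dep y).+1 -> rroot x = rroot y.
Proof. by rewrite /rroot => <- ->; rewrite iterSr. Qed.

Lemma rroot_edge x y : x \in U -> y \in U -> adj x y ->
  rroot x = rroot y \/ [/\ x \in W, y \in W, dep x = 0 & dep y = 0].
Proof.
move=> xU yU xy; case: (rooted_edge rU xU yU xy) => -[].
- by move=> xW yW; right; rewrite !(rooted_core rU).
- by move=> p d; left; apply: rroot_par.
- by move=> p d; left; symmetry; apply: rroot_par.
Qed.

(** A walk from [u] either stays in the tree of [u], where all vertices are within [k] of the root,
    or passes through the root, which is then closer to the end of the walk than [u]. So only balls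
    around vertices of depth [0] matter. *)
Lemma shallow_ball k u : {in U, forall z, dep z <= k} -> u \in U ->
  edge_ball U k u \subset edge_ball U k (rroot u).
Proof.
move=> depk uU.
have reachk n z : z \in reach U n u -> rroot z = rroot u \/ z \in reach U n (rroot u).
  elim: n z => [|n IHn] z; first by rewrite inE => /eqP->; left.
  move=> /reachSP[/IHn[]|[y yR [zU yz]]]; first by left.
    by move=> h; right; apply: reach_leq h.
  have yU := subsetP (reach_sub adj n uU) _ yR.
  case: (IHn y yR) => [E|h]; last by right; apply: reach_step yz.
  have [<-|[yW zW y0 _]] := rroot_edge yU zU yz; first by left.
  right; rewrite -E rroot0 //; apply: reach_step yz => //; exact: reach_refl.
apply/subsetP => _ /edge_ballP[x [y [xR yU xy ->]]].
have xU := subsetP (reach_sub adj k uU) _ xR.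
apply: edge_ball_intro => //; case: (reachk _ _ xR) => // <-.
by apply: reach_leq (depk x xU) _; apply: rroot_reach.
Qed.

End Structure.

(* For [t = 2k + 1] this is the distance-[t] condition: the middle vertex of a
   walk of length [t] in the line graph is within [k] of both edges. *)
Definition good (C : finType) k U (c : {set G} -> C) :=
  {in U, forall u, {in edge_ball U k u &, injective c}}.

(** Each component lies in the ball around its root; an edge is coloured by its rank in that ball.
    Both ends of an edge have the same root, so either may be picked. *)
Lemma shallow_forest_good (C : finType) k q U dep par :
  {in U, forall x, #|nbr U x| <= q.+1} -> 0 < #|C| -> q.+1 * geom q k.+1 <= #|C| ->
  rooted U set0 dep par -> {in U, forall z, dep z <= k} ->
  exists c : {set G} -> C, good k U c.
Proof.
move=> deg C0 cardC rU depk.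
have [c0 _] : exists c0 : C, c0 \in C by apply/card_gt0P.
pose root := rroot dep par.
pose idx (f : {set G}) z := index f (enum (edge_ball U k (root z))).
exists (fun f : {set G} => if [pick z in f] is Some z then nth c0 (enum C) (idx f z) else c0) => u uU.
have rootR n z : z \in reach U n u -> root z = root u.
  elim: n z => [|n IHn] z; first by rewrite inE => /eqP->.
  move=> /reachSP[/IHn//|[y yR [zU yz]]]; rewrite -(IHn _ yR).
  have yU := subsetP (reach_sub adj n uU) _ yR.
  by have [E|[]] := rroot_edge rU yU zU yz; [rewrite /root E | rewrite inE].
have cE (f : {set G}) : f \in edge_ball U k u ->
    f \in edge_ball U k (root u) /\
    (if [pick z in f] is Some z then nth c0 (enum C) (idx f z) else c0) = nth c0 (enum C) (idx f u).
  move=> /[dup] fB /(subsetP (shallow_ball rU depk uU)) ->; split=> //.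
  case: pickP => [z|].
    move: fB => /edge_ballP[x [y [xR yU xy ->]]] zxy; rewrite /idx (rootR k.+1 z) //.
    case/set2P: zxy => ->; first by apply: reach_leq xR.
    exact: reach_step xy.
  by move: fB => /edge_ballP[x [y [_ _ _ ->]]] /(_ x); rewrite !inE eqxx.
move=> f g /cE[fB ->] /cE[gB ->] /eqP.
have idxlt h : h \in edge_ball U k (root u) -> idx h u < size (enum C).
  move=> hB; rewrite -cardE (leq_trans _ cardC) //.
  rewrite (leq_trans _ (card_ball adjC k (rroot_in rU uU) deg)) //.
  by rewrite cardE index_mem mem_enum.
rewrite nth_uniq ?enum_uniq ?idxlt // => /eqP.
by have := @index_inj _ f (enum (edge_ball U k (root u))) f g; rewrite !mem_enum; apply.
Qed.

(** The edge [e] from a deepest leaf [x] to its parent [y] is coloured last. The edges in conflict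
    with it have an end within [2k] of [y], and lie in the ball around [a], the ancestor [k] levels
    above [y], since nothing is deeper than [x]. That ball has at most [#|C|] edges, [e] included,
    so a colour is left. *)
Lemma leaf_good (C : finType) k q U W dep par x :
  {in U, forall z, #|nbr U z| <= q.+1} -> q.+1 * geom q k.+1 <= #|C| ->
  rooted U W dep par -> x \in U -> k < dep x -> {in U, forall z, dep z <= dep x} ->
  (exists c : {set G} -> C, good k (U :\ x) c) -> exists c : {set G} -> C, good k U c.
Proof.
move=> deg cardC rU xU kx maxx [c1 c1good].
have [j0 Ej0] : exists j, dep x = j.+1 by exists (dep x).-1; nat_lia.
have [yU xy dy] := rooted_par rU xU Ej0; set y := par x in yU xy dy.
have yx : y != x by apply: contraTneq xy => ->; rewrite adjI.
pose a := iter k par y.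
have ky : k <= dep y by nat_lia.
have [aU da _] := rooted_iter rU yU ky; rewrite -/a in aU da.
have cardB : #|edge_ball U k a| <= #|C| := leq_trans (card_ball adjC k aU deg) cardC.
clear deg cardC.
have leaf z : z \in U -> adj x z -> z = y.
  move=> zU xz; case: (rooted_edge rU xU zU xz) => -[//].
    by move/(rooted_core rU); rewrite Ej0.
  by move=> _ dz; have := maxx z zU; nat_lia.
(* A walk of [n] steps from [y] either ends below [a], at most [n] levels higher than [y], or has
   passed through [a], which cost at least [k] steps. *)
have claim n z : z \in reach U n y ->
    (exists j, [/\ iter j par z = a, dep z = dep a + j & dep y <= dep z + n])
    \/ k <= n /\ z \in reach U (n - k) a.
  elim: n z => [|n IHn] z.
    by rewrite inE => /eqP->; left; exists k; split=> //; nat_lia.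
  move=> /reachSP[/IHn[[j [h1 h2 h3]]|[kn h]]|].
  - by left; exists j; split=> //; nat_lia.
  - by right; split; [nat_lia | apply: reach_leq h; nat_lia].
  move=> [z0 z0R [zU zz]]; have z0U := subsetP (reach_sub adj n yU) _ z0R.
  have afar : z0 = a -> dep y <= dep z0 + n -> k <= n.+1 /\ z \in reach U (n.+1 - k) a.
    move=> E; rewrite E => h; split; first nat_lia.
    have -> : n.+1 - k = (n - k).+1 by nat_lia.
    by rewrite E in zz; apply: reach_step zz; rewrite ?reach_refl.
  case: (IHn _ z0R) => [[j [h1 h2 h3]]|[kn h]]; last first.
    by right; split; [nat_lia | rewrite subSn //; apply: reach_step zz].
  case: (rooted_edge rU z0U zU zz) => -[p d].
  - right; apply: afar => //.
    have jE : j = 0 by have := rooted_core rU p; clear -h2; nat_lia.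
    by rewrite jE in h1.
  - case: j h1 h2 => [|j] h1 h2; first by right; apply: afar.
    by left; exists j; split; [rewrite -h1 iterSr p | nat_lia | nat_lia].
  - by left; exists j.+1; split; [rewrite iterSr p | nat_lia | nat_lia].
have inball n z z' : n <= k + k -> z \in reach U n y -> z' \in U -> adj z z' ->
    [set z; z'] \in edge_ball U k a.
  move=> n2k zR zU' zz; have zU := subsetP (reach_sub adj n yU) _ zR.
  have up w j : w \in U -> iter j par w = a -> dep w = dep a + j -> w \in reach U j a.
    move=> wU Ea dw; rewrite -Ea; apply: reach_sym => //.
    by have [|_ _] := rooted_iter rU wU (j := j) _; first by nat_lia.
  case: (claim _ _ zR) => [[j [h1 h2 _]]|[kn h]]; last first.
    by apply: edge_ball_intro => //; apply: reach_leq h; nat_lia.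
  (* Here [z] is at most [k.+1] levels below [a]. In the extreme case [z] has maximal depth, so its
     neighbour is its parent, [k] levels below [a]. *)
  have [jk|kj] := leqP j k.
    by apply: edge_ball_intro => //; apply: reach_leq (up _ _ zU h1 h2).
  have zx := maxx z zU; have jk : j = k.+1 by nat_lia.
  rewrite jk in h1 h2.
  case: (rooted_edge rU zU zU' zz) => -[p d].
  - by have := rooted_core rU p; nat_lia.
  - rewrite setUC; apply: edge_ball_intro => //; last by rewrite adjC.
    by apply: up => //; [rewrite -h1 iterSr p | nat_lia].
  - by have := maxx z' zU'; nat_lia.
pose e := [set y; x].
have eB : e \in edge_ball U k a by apply: (inball 0); rewrite ?reach_refl // adjC.
have [col colN] : exists col, col \notin c1 @: (edge_ball U k a :\ e).
  apply/existsP; rewrite -negb_forall; apply/negP => /forallP all.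
  have : #|C| <= #|c1 @: (edge_ball U k a :\ e)|.
    by rewrite -cardsT subset_leq_card //; apply/subsetP => w _.
  move=> /leq_trans/(_ (leq_imset_card _ _)) leC.
  by move: cardB; rewrite (cardsD1 e (edge_ball U k a)) eB => /leq_trans/(_ leC); rewrite ltnn.
pose U1 := U :\ x.
have U1U : U1 \subset U by apply: subD1set.
(* A walk enters and leaves the leaf [x] through [y], so avoiding [x] costs no extra step. *)
have reach1 u n z : u != x -> u \in U -> z \in reach U n u ->
    if z == x then y \in reach U1 n u else z \in reach U1 n u.
  move=> ux uU; elim: n z => [|n IHn] z.
    by rewrite inE => /eqP->; rewrite (negbTE ux).
  move=> /reachSP[/IHn|[w wR [zU wz]]].
    by case: ifP => _; apply: reach_leq.
  have := IHn w wR; case: eqP => [Ew|_] h.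
    rewrite Ew in wz; rewrite (leaf z zU wz) (negbTE yx); exact: reach_leq h.
  case: eqP => [Ez|/eqP zx].
    have wU := subsetP (reach_sub adj n uU) _ wR.
    rewrite Ez adjC in wz; rewrite -(leaf w wU wz); exact: reach_leq h.
  by apply: reach_step wz => //; rewrite !inE zx.
have ball1 u f : u != x -> u \in U -> f \in edge_ball U k u -> f != e -> f \in edge_ball U1 k u.
  move=> ux uU /edge_ballP[z [z' [zR zU' zz Ef]]] fe.
  have zU := subsetP (reach_sub adj k uU) _ zR.
  have zx : z != x.
    apply: contraNneq fe => E; rewrite Ef E in zz *.
    by rewrite (leaf z' zU' zz) setUC.
  have zx' : z' != x.
    apply: contraNneq fe => E; rewrite Ef E in zz *.
    by rewrite adjC in zz; rewrite (leaf z zU zz).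
  rewrite Ef; apply: edge_ball_intro => //; last by rewrite !inE zx'.
  by have := reach1 _ _ _ ux uU zR; rewrite (negbTE zx).
exists (fun f => if f == e then col else c1 f) => u uU.
(* The ball around the leaf is contained in the ball around its parent. *)
wlog ux : u uU / u != x.
  move=> hw; have [->|] := eqVneq u x; last exact: hw.
  have sub : edge_ball U k x \subset edge_ball U k y.
    have rx n z : z \in reach U n x -> z = x \/ z \in reach U n y.
      elim: n z => [|n IHn] z; first by rewrite inE => /eqP->; left.
      move=> /reachSP[/IHn[]|[w /IHn wR [zU wz]]]; first by left.
        by move=> h; right; apply: reach_leq h.
      case: wR => [E|h]; last by right; apply: reach_step wz.
      by rewrite E in wz; right; rewrite (leaf z zU wz) reach_refl.
    apply/subsetP => _ /edge_ballP[z [z' [/rx[E|zR] zU' zz ->]]]; last exact: edge_ball_intro.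
    rewrite E in zz *; rewrite (leaf z' zU' zz) setUC.
    by apply: edge_ball_intro; rewrite ?reach_refl // adjC.
  by move=> f g /(subsetP sub) fB /(subsetP sub) gB; apply: (hw y).
have conflict f g : f \in edge_ball U k u -> g \in edge_ball U k u -> f = e -> g != e -> col <> c1 g.
  move=> fB gB fe ge E; case/negP: colN; rewrite E; apply: imset_f; rewrite in_setD1 ge /=.
  rewrite fe in fB.
  have yR : y \in reach U k u.
    have [|_ _ []//] := edge_ball_end adjI uU _ fB; first by rewrite adjC.
    by move/(reach1 _ _ _ ux uU); rewrite eqxx => /(subsetP (reachS _ _ _ U1U)).
  case/edge_ballP: gB => z [z' [zR zU' zz ->]].
  by apply: (inball (k + k)) => //; apply: reach_trans zR; apply: reach_sym.
move=> f g fB gB; case: (eqVneq f e) => [fe|fe]; case: (eqVneq g e) => [ge|ge] //.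
- by rewrite fe ge.
- by move/(conflict _ _ fB gB fe ge).
- by move/esym/(conflict _ _ gB fB ge fe).
- apply: (c1good u); [by rewrite !inE ux | exact: ball1 | exact: ball1].
Qed.

End Rooted.

(** * Cycles with few branch vertices *)

(** In a longest path, a second neighbour of the first vertex lies on the path by maximality, and
    closes a cycle. *)
Lemma mindeg2_cycle (T : finType) (r : rel T) x0 y0 :
  symmetric r -> irreflexive r -> r x0 y0 ->
  (forall x y, r x y -> exists2 z, z != y & r x z) ->
  exists2 C, ucycle r C & 2 < size C.
Proof.
move=> rC rI r0 r2.
pose P n := [exists s : n.-tuple T, if val s is x :: p then path r x p && uniq (x :: p) else false].
have P2 : P 2.
  apply/existsP; exists [tuple x0; y0] => /=.
  by rewrite r0 /= inE andbT; apply: contraTneq r0 => ->; rewrite rI.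
have Pb n : P n -> n <= #|T|.
  case/existsP => -[s /= /eqP <-]; case: s => // x p /andP[_ u].
  by have /card_uniqP <- : uniq (x :: p) by []; rewrite max_card.
case: (ex_maxnP (ex_intro _ 2 P2) Pb) => n /existsP[[s /= /eqP <-]].
case: s => // x p /andP[pp pu] maxn; have := maxn 2 P2.
case: p pp pu maxn => // y p pp pu maxn _.
have rxy : r x y by case/andP: pp.
have [z zy rxz] := r2 x y rxy.
have zp : z \in p.
  apply/negPn/negP => zp.
  have : P (size [:: z, x, y & p]).
    apply/existsP; exists (in_tuple [:: z, x, y & p]).
    rewrite /= (rC z) rxz; move: pp => /= -> /=; move: pu; rewrite /= !inE !negb_or (negbTE zp) zy.
    have -> : z != x by apply: contraTneq rxz => ->; rewrite rI.
    by [].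
  by move/maxn; rewrite ltnn.
case/splitPr: zp pp pu maxn => p1 p2 pp pu _.
exists [:: x, y & rcons p1 z]; last by rewrite /= size_rcons.
apply/andP; split.
  have [pp1 lz] : path r y p1 /\ r (last y p1) z.
    by move: pp; rewrite /= cat_path => /and3P[_ -> /andP[]].
  by rewrite /= rxy !rcons_path pp1 lz last_rcons rC rxz.
have : uniq ([:: x, y & rcons p1 z] ++ p2) by rewrite /= cat_rcons.
by rewrite cat_uniq => /and3P[].
Qed.

(** Pigeonhole: [m] marked entries leave [m.+1] unmarked runs. If a mark occurs among the first [r]
    entries, everything up to the first mark is dropped. *)
Lemma clean_run (T : Type) (b : pred T) m r (s : seq T) :
  count b s <= m -> m.+1 * r.+1 <= (size s).+1 ->
  exists u p w, [/\ s = u ++ p ++ w, size p = r & ~~ has b p].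
Proof.
elim: m s => [|m IHm] s cs ss.
  exists [::], (take r s), (drop r s); rewrite cat_take_drop size_takel //; last lia.
  split=> //; rewrite has_count -leqNgt.
  by move: cs; rewrite -{1}(cat_take_drop r s) count_cat; lia.
have [h|h] := boolP (has b (take r s)); last first.
  exists [::], (take r s), (drop r s); rewrite cat_take_drop size_takel //; nia.
have hs : has b s by move: h; rewrite -{2}(cat_take_drop r s) has_cat => ->.
have jr : find b s < r by rewrite -has_take.
have hd : has b (take (find b s).+1 s) by rewrite has_take.
have [||u [p [w [E szp np]]]] := IHm (drop (find b s).+1 s).
- move: cs; rewrite -{1}(cat_take_drop (find b s).+1 s) count_cat.
  by move: hd; rewrite has_count; lia.
- by rewrite size_drop; nia.
exists (take (find b s).+1 s ++ u), p, w; split=> //.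
by rewrite -catA -E cat_take_drop.
Qed.

(** The cycle is rotated to start at a marked vertex, if there is one; at most four marks remain,
    hence five runs. The ends [a] and [z] of the path may be marked, only its interior [p] is
    clean. *)
Lemma cycle_clean_path (T : eqType) (r : rel T) (b : pred T) n (C : seq T) :
  ucycle r C -> count b C <= 5 -> 0 < n -> 5 * n.+1 <= size C ->
  exists a p z, [/\ path r a (rcons p z), uniq (a :: rcons p z), size p = n,
    ~~ has b p & {subset a :: rcons p z <= C}].
Proof.
move=> Cu Cb n0 Cn.
have [x [s [xsu cs Ci Cs]]] : exists x s,
    [/\ ucycle r (x :: s), count b s <= 4, x :: s =i C & size C = (size s).+1].
  have [hb|hb] := boolP (has b C).
    have [x xC bx] := hasP hb; have [i s E] := rot_to xC.
    exists x, s; rewrite -E rot_ucycle; split=> //.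
    - by have := permP (permEl (perm_rot i C)) b; rewrite E /= bx; lia.
    - by move=> y; rewrite mem_rot.
    - by rewrite -(size_rot i) E.
  case: C Cu Cb Cn hb => [|x s] // Cu Cb Cn hb; exists x, s; split=> //.
  by move: hb; rewrite has_count /=; lia.
have [|u [p [w [E szp np]]]] := clean_run (r := n) cs; first lia.
have [u' [a E1]] : exists u' a, x :: u = rcons u' a by exists (belast x u), (last x u); rewrite lastI.
have {}E1 : x :: s = u' ++ a :: p ++ w by rewrite E -cat_cons E1 cat_rcons.
have [cyc unq] : cycle r (a :: p ++ (w ++ u')) /\ uniq (a :: p ++ (w ++ u')).
  by move: xsu; rewrite E1 -(rot_ucycle (size u')) rot_size_cat /= -catA => /andP[].
have sub : {subset a :: p ++ (w ++ u') <= C}.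
  move=> y; rewrite -Ci E1 !(inE, mem_cat).
  by case: (y \in u'); case: (y == a); case: (y \in p); case: (y \in w).
have szs : size s = n + size (w ++ u').
  have := congr1 size E1; rewrite /= !size_cat /= size_cat szp; lia.
case: (w ++ u') cyc unq sub szs => [|z q] cyc unq sub szs; first by move: szs; rewrite /=; nia.
exists a, p, z; split=> //.
- by move: cyc; rewrite /= -cat_rcons rcons_cat cat_path => /andP[].
- by move: unq; rewrite -cat_rcons -cat_cons cat_uniq => /andP[].
- by move=> y ys; apply: sub; rewrite -cat_rcons -cat_cons mem_cat ys.
Qed.

(** * Extending a colouring along a thread *)

Lemma geom_mul q n : 0 < q -> q.-1 * geom q n = q ^ n - 1.
Proof.
move=> q0; elim: n => [|n IHn]; first by rewrite /geom big_ord0 muln0.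
rewrite geomS mulnDr IHn expnS; have := expn_gt0 q n; rewrite q0 /=; nia.
Qed.

Section Thread.
Variables (G : finType) (adj : rel G).
Hypotheses (adjC : symmetric adj) (adjI : irreflexive adj).

Local Notation nbr := (nbr adj).
Local Notation reach := (reach adj).
Local Notation edge_ball := (edge_ball adj).
Local Notation rooted := (rooted adj).

Lemma reach_path U n u z : z \in reach U n u ->
  exists p, [/\ path adj u p, last u p = z, size p <= n, uniq (u :: p) & {subset p <= U}].
Proof.
move=> zR; have [p [pp pl ps pU]] : exists p,
    [/\ path adj u p, last u p = z, size p <= n & {subset p <= U}].
  elim: n z zR => [|n IHn] z; first by rewrite inE => /eqP->; exists [::].
  move=> /reachSP[/IHn[p [pp pl ps pU]]|[y /IHn[p [pp pl ps pU]] [zU yz]]].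
    by exists p; split=> //; apply: leqW.
  exists (rcons p z); rewrite rcons_path pp pl yz last_rcons size_rcons; split=> //.
  by move=> x; rewrite mem_rcons inE => /predU1P[->|/pU].
case: (shortenP pp) pl => p' pp' up' sub' pl'; exists p'; split=> //.
  by apply: leq_trans ps; apply: uniq_leq_size => //; case/andP: up'.
by move=> x /sub'/pU.
Qed.

Variables (k l : nat) (U W : {set G}) (dep : G -> nat) (par : G -> G) (v : nat -> G).
Hypothesis rU : rooted U W dep par.
Hypothesis depk : {in U, forall z, dep z <= k}.
Hypothesis l_k : l = 4 * (2 * k + 2).
Hypothesis vW : forall i, i <= l -> v i \in W.
Hypothesis vI : forall i j, i <= l -> j <= l -> v i = v j -> i = j.
Hypothesis vadj : forall i, i < l -> adj (v i) (v i.+1).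
Hypothesis vdeg : forall i y, 0 < i < l -> y \in W -> adj (v i) y -> y = v i.-1 \/ y = v i.+1.
Hypothesis girth : forall c, 2 < size c -> ucycle adj c -> l + k < size c.

Let vU i : i <= l -> v i \in U.
Proof. by move/vW/(subsetP (rooted_sub rU)). Qed.

Let dist a b := (a - b) + (b - a).
Local Notation rroot := (rroot dep par).

(** The index of the vertex of the thread from which [x] hangs; it is [l.+1] if there is none. *)
Definition pos_on x := index (rroot x) [seq v i | i <- iota 0 l.+1].
Local Notation ix := pos_on.

Let ix_le x : ix x <= l -> rroot x = v (ix x).
Proof.
move=> h; have hs : rroot x \in [seq v i | i <- iota 0 l.+1].
  by rewrite -index_mem size_map size_iota ltnS.
rewrite -[LHS](nth_index (v 0) hs) (nth_map 0) ?size_iota ?ltnS //.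
by rewrite nth_iota ?ltnS.
Qed.

Let ix_root x i : i <= l -> rroot x = v i -> ix x = i.
Proof.
move=> il E; have ixl : ix x <= l.
  have : rroot x \in [seq v j | j <- iota 0 l.+1].
    by rewrite E map_f // mem_iota.
  by rewrite -index_mem size_map size_iota ltnS.
by apply: vI => //; rewrite -ix_le // -E.
Qed.

Let ix_v i : i <= l -> ix (v i) = i.
Proof. by move=> il; apply: ix_root => //; rewrite rroot0 // (rooted_core rU) ?vW. Qed.

Definition zone x := (x \in U) && (0 < ix x < l).

Let dep_v i : i <= l -> dep (v i) = 0.
Proof. by move=> il; rewrite (rooted_core rU) ?vW. Qed.

Let zone_v i : i <= l -> zone (v i) = (0 < i < l).
Proof. by move=> il; rewrite /zone vU // ix_v. Qed.

Let zoneU x : zone x -> x \in U.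
Proof. by case/andP. Qed.

Let zone_dep0 x : zone x -> dep x = 0 -> x = v (ix x).
Proof. by move=> /andP[xU h] d; rewrite -ix_le ?rroot0 //; nat_lia. Qed.

Let adj_zone z z' : zone z -> z' \in U -> adj z z' ->
  ix z' = ix z /\ (dep z = (dep z').+1 \/ dep z' = (dep z).+1) \/
  [/\ dep z = 0, dep z' = 0, z' = v (ix z') & ix z' = (ix z).+1 \/ ix z = (ix z').+1].
Proof.
move=> zz z'U a; case: (rooted_edge rU (zoneU zz) z'U a) => -[h1 h2]; last first.
- by left; split; [rewrite /ix -(rroot_par h1 h2) | right].
- by left; split; [rewrite /ix -(rroot_par h1 h2) | left].
right; have d1 := rooted_core rU h1; have d2 := rooted_core rU h2.
have h : 0 < ix z < l by case/andP: zz.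
have E := zone_dep0 zz d1; rewrite E in a.
have [E'|E'] := vdeg h h2 a.
  have ixz' : ix z' = (ix z).-1 by rewrite E' ix_v //; nat_lia.
  by split=> //; [rewrite ixz' | right; rewrite ixz'; nat_lia].
have ixz' : ix z' = (ix z).+1 by rewrite E' ix_v //; nat_lia.
by split=> //; [rewrite ixz' | left; rewrite ixz'; nat_lia].
Qed.

Let zone_exit z z' : zone z -> z' \in U -> ~~ zone z' -> adj z z' ->
  dep z = 0 /\ (z' = v 0 /\ ix z = 1 \/ z' = v l /\ ix z = l.-1).
Proof.
move=> zz z'U; rewrite {1}/zone z'U /= => nz a.
have h : 0 < ix z < l by case/andP: zz.
case: (adj_zone zz z'U a) => [[E _]|[d1 d2 E1 h']]; first by rewrite E h in nz.
split=> //; have [h0|h0] : ix z' = 0 \/ ix z' = l by nat_lia.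
  by left; rewrite E1 h0; split=> //; nat_lia.
by right; rewrite E1 h0; split=> //; nat_lia.
Qed.

Let O := [set x in U | ~~ zone x].

Let Osub : O \subset U.
Proof. by apply/subsetP => x; rewrite inE => /andP[]. Qed.

Let v0O : v 0 \in O. Proof. by rewrite inE vU // zone_v. Qed.
Let vlO : v l \in O. Proof. by rewrite inE vU // zone_v // ltnn andbF. Qed.

(* Otherwise the thread could be closed into a cycle shorter than the girth. *)
Let no_wrap n : n <= k -> v 0 \in reach O n (v l) -> False.
Proof.
move=> nk /reach_path[p [pp pl ps pu pO]].
case/lastP: p pp pl ps pu pO => [|p' z] pp pl ps pu pO.
  by have := vI (leqnn l) (leq0n l) pl; rewrite l_k; nat_lia.
rewrite last_rcons in pl; rewrite {}pl in pp ps pu pO.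
have cyc : ucycle adj ([seq v i | i <- iota 0 l.+1] ++ p').
  apply/andP; split.
    rewrite /= rcons_cat cat_path.
    have pv n' i : i + n' <= l -> path adj (v i) [seq v j | j <- iota i.+1 n'] /\
        last (v i) [seq v j | j <- iota i.+1 n'] = v (i + n').
      elim: n' i => [|n' IHn] i h; first by rewrite addn0.
      by have [|p1 p2] := IHn i.+1; rewrite /= ?vadj ?p1 ?p2 ?addnS //; nat_lia.
    by have [p1 p2] := pv l 0 (leqnn l); rewrite p1 p2.
  have [vlp v0p up'] : [/\ v l \notin p', v 0 \notin p' & uniq p'].
    move: pu; rewrite /= rcons_uniq mem_rcons inE => /and3P[/norP[_ ->] -> ->].
    by [].
  rewrite cat_uniq map_inj_in_uniq ?iota_uniq ?up' ?andbT; last first.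
    by move=> i j; rewrite !mem_iota => /andP[_ hi] /andP[_ hj]; apply: vI; nat_lia.
  apply/hasPn => x xp; apply/negP; change (x \in [seq v i | i <- iota 0 l.+1] -> False) => /mapP[i].
  rewrite mem_iota => /andP[_ hi] Ei.
  have xO : x \in O by apply: pO; rewrite mem_rcons inE xp orbT.
  have il : i <= l by nat_lia.
  move: xO; rewrite inE Ei zone_v // => /andP[_ hz].
  have [i0|i0] : i = 0 \/ i = l by nat_lia.
    by rewrite -i0 -Ei xp in v0p.
  by rewrite -i0 -Ei xp in vlp.
have szc : size ([seq v i | i <- iota 0 l.+1] ++ p') = l.+1 + size p'.
  by rewrite size_cat size_map size_iota.
have /girth/(_ cyc) : 2 < size ([seq v i | i <- iota 0 l.+1] ++ p') by rewrite szc; nat_lia.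
by move: ps; rewrite size_rcons szc; nat_lia.
Qed.

Let no_wrap' n : n <= k -> v l \in reach O n (v 0) -> False.
Proof.
by move=> nk h; apply: (no_wrap nk); apply: reach_sym h.
Qed.

(** Inside the zone the distance to [v i] is explicit. A walk that leaves the zone does so at [v 0]
    or [v l], and by [no_wrap] it cannot come back through the other end within [k] steps. *)
Lemma reach_thread i n z : i <= l -> n <= k -> z \in reach U n (v i) ->
  zone z /\ dist (ix z) i + dep z <= n \/
  z \in O /\ (i <= n /\ z \in reach O (n - i) (v 0) \/
              l - i <= n /\ z \in reach O (n - (l - i)) (v l)).
Proof.
move=> il; elim: n z => [|n IHn] z nk.
  rewrite inE => /eqP->.
  case zi: (zone (v i)).
    by left; rewrite ix_v // dep_v // /dist subnn.
  right; split; first by rewrite inE vU // zi.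
  move: zi; rewrite zone_v // => zi.
  have [i0|i0] : i = 0 \/ i = l by nat_lia.
    by left; rewrite i0 reach_refl.
  by right; rewrite i0 subnn reach_refl.
move=> /reachSP[/(IHn _ (ltnW nk))[[h1 h2]|[h1 [[h2 h3]|[h2 h3]]]]|].
- by left; split=> //; apply: leqW.
- by right; split=> //; left; split; [exact: leqW | apply: reach_leq h3; nat_lia].
- by right; split=> //; right; split; [exact: leqW | apply: reach_leq h3; nat_lia].
move=> [y yR [zU yz]].
have yU := subsetP (reach_sub adj n (vU il)) _ yR.
case zz: (zone z); case: (IHn _ (ltnW nk) yR) => [[zy dy]|[yO h]].
- left; split=> //; case: (adj_zone zy zU yz) => [[E d]|[d1 d2 _ d]]; rewrite /dist in dy *; nat_lia.
- left; split=> //; rewrite adjC in yz; move: yO; rewrite inE => /andP[_ yO].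
  have [dz [[Ey iz]|[Ey iz]]] := zone_exit zz yU yO yz; rewrite Ey in h.
    case: h => -[h1 h2]; first by rewrite /dist; nat_lia.
    by case: (no_wrap _ h2); nat_lia.
  case: h => -[h1 h2]; last by rewrite /dist; nat_lia.
  by case: (no_wrap' _ h2); nat_lia.
- right; split; first by rewrite inE zU zz.
  have [dz [[Ey iz]|[Ey iz]]] := zone_exit zy zU (negbT zz) yz; rewrite Ey /dist in dy *.
    by left; split; [nat_lia | exact: reach_refl].
  by right; split; [nat_lia | exact: reach_refl].
- have zO : z \in O by rewrite inE zU zz.
  right; split=> //; case: h => -[h1 h2].
    by left; split; [exact: leqW | rewrite subSn //; apply: reach_step yz].
  by right; split; [exact: leqW | rewrite subSn //; apply: reach_step yz].
Qed.

Let near i x := dist (ix x) i + dep x <= k.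

(** The possible ends of an edge that meets the zone. *)
Let thread_end x := [\/ zone x, x = v 0 | x = v l].

Let near_of_reach i x : i <= l -> thread_end x -> x \in reach U k (v i) -> near i x.
Proof.
move=> il xt /(reach_thread il (leqnn k))[[_ //]|[]]; rewrite inE => /andP[_ nz] h.
case: xt => [xz|E|E]; first by rewrite xz in nz.
  rewrite E /near ix_v // dep_v // /dist in h *.
  case: h => -[h1 h2]; first by nat_lia.
  by case: (no_wrap _ h2); nat_lia.
rewrite E /near ix_v // dep_v // /dist in h *.
case: h => -[h1 h2]; last by nat_lia.
by case: (no_wrap' _ h2); nat_lia.
Qed.

Let reach_v i n : i + n <= l -> v (i + n) \in reach U n (v i).
Proof.
elim: n => [|n IHn] h; first by rewrite addn0 reach_refl.
rewrite addnS in h *; apply: (reach_step (IHn (ltnW h)) (vU h)); exact: vadj.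
Qed.

Let reach_vv i j : i <= l -> j <= l -> v i \in reach U (dist i j) (v j).
Proof.
move=> il jl; have [ij|/ltnW ji] := leqP i j.
  have -> : dist i j = j - i by rewrite /dist; nat_lia.
  by apply: reach_sym (vU il) _ => //; have := @reach_v i (j - i); rewrite subnKC //; apply.
have -> : dist i j = i - j by rewrite /dist; nat_lia.
by have := @reach_v j (i - j); rewrite subnKC //; apply.
Qed.

Let thread_ix x : thread_end x -> x \in U /\ ix x <= l.
Proof.
case=> [/andP[xU h]|->|->]; first by split=> //; nat_lia.
  by rewrite vU // ix_v.
by rewrite vU // ix_v.
Qed.

Let reach_of_near i x : i <= l -> thread_end x -> near i x -> x \in reach U k (v i).
Proof.
move=> il /thread_ix[xU xl] h; apply: reach_leq h _.
by apply: reach_trans (reach_vv xl il) _; rewrite -ix_le //; exact: (rroot_reach adjC rU).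
Qed.

(** This turns membership in balls into linear arithmetic on [ix] and [dep]. *)
Lemma edge_ball_thread i z z' : i <= l -> thread_end z -> thread_end z' -> adj z z' ->
  ([set z; z'] \in edge_ball U k (v i)) = near i z || near i z'.
Proof.
move=> il tz tz' zz; apply/idP/idP.
  case/(edge_ball_end adjI (vU il) zz) => _ _ [zR|zR]; rewrite (near_of_reach il _ zR) ?orbT //.
have [zU _] := thread_ix tz; have [zU' _] := thread_ix tz'.
case/orP=> h; first by apply: edge_ball_intro => //; apply: reach_of_near.
by rewrite setUC; apply: edge_ball_intro; rewrite 1?adjC //; apply: reach_of_near.
Qed.

(** Such an edge is reached through one end of the thread, hence also from every vertex of the
    thread closer to that end. *)
Let outer_ball i z z' : i <= l -> z \in O -> z' \in O -> adj z z' ->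
  [set z; z'] \in edge_ball U k (v i) ->
  i <= k /\ (forall j, j <= i -> [set z; z'] \in edge_ball U k (v j)) \/
  l - i <= k /\ (forall j, i <= j <= l -> [set z; z'] \in edge_ball U k (v j)).
Proof.
move=> il; wlog zR : z z' / z \in reach U k (v i).
  move=> hw zO zO' zz /[dup] fB /(edge_ball_end adjI (vU il) zz)[_ _ [zR|zR]]; first exact: hw.
  by rewrite setUC in fB *; apply: hw; rewrite 1?adjC.
move=> zO zO' zz _; have zU' := subsetP Osub _ zO'.
case: (reach_thread il (leqnn k) zR) => [[zz' _]|[_ [[ik h]|[ik h]]]].
- by move: zO; rewrite inE zz' andbF.
- left; split=> // j ji; apply: edge_ball_intro => //.
  have jl := leq_trans ji il.
  have h0 : v 0 \in reach U j (v j) by have := @reach_vv 0 j; rewrite /dist sub0n subn0; apply.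
  have := reach_trans h0 (subsetP (reachS adj _ _ Osub) _ h).
  by apply: reach_leq; nat_lia.
- right; split=> // j /andP[ij jl]; apply: edge_ball_intro => //.
  have h0 : v l \in reach U (l - j) (v j).
    have := @reach_vv l j; rewrite /dist.
    have -> : j - l = 0 by nat_lia.
    by rewrite addn0; apply.
  have := reach_trans h0 (subsetP (reachS adj _ _ Osub) _ h).
  by apply: reach_leq; nat_lia.
Qed.

(** A lower bound for the distance to the outside of the zone; all that is used is that it changes
    by at most one along an edge. *)
Definition depth_in_zone x := if zone x then minn (ix x) (l - ix x) + dep x else 0.
Local Notation phi := depth_in_zone.

Let phi_lip z z' : z \in U -> z' \in U -> adj z z' -> phi z' <= (phi z).+1.
Proof.
move=> zU zU' zz; rewrite /phi; case zz1: (zone z); case zz2: (zone z') => //.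
  case: (adj_zone zz1 zU' zz) => [[E d]|[d1 d2 _ d]].
    by rewrite E; case: d => d; rewrite d; nat_lia.
  by case: d => d; rewrite d1 d2; nat_lia.
rewrite adjC in zz; have [d [[_ E]|[_ E]]] := zone_exit zz2 zU (negbT zz1) zz.
  by rewrite E d; nat_lia.
by rewrite E d; nat_lia.
Qed.

(* The part coloured by induction; it contains the balls around both ends of the
   thread. *)
Definition off_zone := [set x in U | phi x <= k.+1].
Local Notation U' := off_zone.

Let U'U : U' \subset U. Proof. by apply/subsetP => x; rewrite inE => /andP[]. Qed.

(** An edge of the ball has one end within [k] of [w] and the other within [k.+1], whence the [k.+1]
    in the definition of [off_zone]. *)
Lemma edge_ball_off_zone w : w \in U -> phi w = 0 -> edge_ball U k w \subset edge_ball U' k w.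
Proof.
move=> wU w0.
have phiR n z : z \in reach U n w -> phi z <= n.
  elim: n z => [|n IHn] z; first by rewrite inE => /eqP->; rewrite w0.
  move=> /reachSP[/IHn|[y yR [zU yz]]]; first exact: leqW.
  by have := phi_lip (subsetP (reach_sub adj n wU) _ yR) zU yz; have := IHn _ yR; nat_lia.
have reachR n z : n <= k -> z \in reach U n w -> z \in reach U' n w.
  elim: n z => [|n IHn] z nk //; move=> /[dup] zR.
  move=> /reachSP[/(IHn _ (ltnW nk))|[y yR [zU yz]]]; first exact: reach_leq.
  apply: reach_step yz; first exact: (IHn _ (ltnW nk)).
  by rewrite inE zU; have := phiR _ _ zR; nat_lia.
apply/subsetP => _ /edge_ballP[z [z' [zR zU' zz ->]]]; apply: edge_ball_intro => //.
  exact: reachR.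
have := phi_lip (subsetP (reach_sub adj k wU) _ zR) zU' zz.
by rewrite inE zU'; have := phiR _ _ zR; nat_lia.
Qed.

Let off_zone_proper : #|U'| < #|U|.
Proof.
have kl : k.+2 <= l by nat_lia.
apply: proper_card; apply/properP; split=> //; exists (v k.+2); first exact: vU.
rewrite inE vU //= /phi zone_v //= ix_v //= dep_v //.
by case: ifP; nat_lia.
Qed.

(** Only two neighbours of [v i] are in the core and may start walks of all [k.+1] levels. The
    others start walks into trees of depth at most [k], whose last level is empty; this saves
    [q.-1 * q ^ k] edges. *)
Lemma card_thread_ball q i : 0 < i < l -> {in U, forall x, #|nbr U x| <= q.+1} -> 0 < q ->
  #|edge_ball U k (v i)| <= 2 * geom q k.+1 + q.-1 * geom q k.
Proof.
move=> il deg q0; have il' : i <= l by nat_lia.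
apply: leq_trans (card_ball_sum adj k (vU il')) _.
pose g w := geom q k + (w \in W) * q ^ k.
apply: leq_trans (_ : \sum_(w in nbr U (v i)) g w <= _).
  apply: leq_sum => w; rewrite inE => /andP[wU aw]; rewrite /g.
  have cd j : #|dlev adj U j (v i) w| <= q ^ j by apply: card_dlev => //; exact: vU.
  have [wW|wW] := boolP (w \in W).
    by rewrite mul1n -geomS; apply: leq_sum => j _.
  (* A non-backtracking walk that has entered a tree can only descend. *)
  have child j y z : (y, z) \in dlev adj U j (v i) w -> [/\ z \in U, par z = y & dep z = j.+1].
    elim: j y z => [|j IHj] y z.
      rewrite inE => /eqP[-> ->].
      case: (rooted_edge rU (vU il') wU aw) => -[h1 h2].
      - by rewrite h2 in wW.
      - by rewrite dep_v in h2.
      - by rewrite h2 dep_v.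
    move=> /dlevSP[x /IHj[yU py dy] [zU yz zx]].
    case: (rooted_edge rU yU zU yz) => -[h1 h2].
    - by rewrite (rooted_core rU h1) in dy.
    - by rewrite -h1 py eqxx in zx.
    - by rewrite h2 dy.
  rewrite big_ord_recr /= [X in _ + X](_ : _ = 0) ?addn0; last first.
    apply/eqP; rewrite cards_eq0 -subset0; apply/subsetP => -[y z] /child[zU _ dz].
    by have := depk zU; rewrite dz ltnn.
  by apply: leq_sum => j _.
have degW : #|[set w in nbr U (v i) | w \in W]| <= 2.
  apply: leq_trans (_ : #|[set v i.-1; v i.+1]| <= _); last by rewrite cards2; case: eqP.
  apply/subset_leq_card/subsetP => w; rewrite !inE => /andP[/andP[_ aw] wW].
  by case: (vdeg il wW aw) => ->; rewrite eqxx ?orbT.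
have -> : \sum_(w in nbr U (v i)) g w =
    #|nbr U (v i)| * geom q k + #|[set w in nbr U (v i) | w \in W]| * q ^ k.
  rewrite /g big_split /= sum_nat_const -big_distrl /=; congr (_ + _ * _).
  rewrite -sum1_card big_mkcond [RHS]big_mkcond; apply: eq_bigr => w _.
  by rewrite [in RHS]inE; case: (w \in nbr _ _); case: (w \in W).
have := leq_mul (deg _ (vU il')) (leqnn (geom q k)).
have := leq_mul degW (leqnn (q ^ k)).
rewrite geomS -(prednK q0) /=; nia.
Qed.

(* An uncoloured edge belongs to the balls around the vertices of the thread for
   an interval of indices, on which its colour given by [conveyor] is constant;
   for an edge coloured by induction, these indices extend to [0] or to [l]. *)
Lemma thread_good (C : finType) q :
  2 < q -> {in U, forall x, #|nbr U x| <= q.+1} -> #|C| = q.+1 * geom q k.+1 ->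
  (forall U1 : {set G}, #|U1| < #|U| -> exists c : {set G} -> C, good adj k U1 c) ->
  exists c : {set G} -> C, good adj k U c.
Proof.
move=> q2 deg cardC IH; have [c' c'good] := IH _ off_zone_proper.
(* An edge meeting the zone is in at most [2 * k + 2] consecutive balls, the extreme case being an
   edge of the thread; four such periods give [l]. *)
pose A i := edge_ball U k (v i); pose s := 2 * k + 2.
pose Lm := 2 * geom q k.+1 + q.-1 * geom q k; pose F := q.-1 * q ^ k.
have q0 : 0 < q by nat_lia.
have qk0 : 0 < q ^ k by rewrite expn_gt0 q0.
have cardLF : #|C| = Lm + F.
  rewrite cardC /Lm /F !geomS; case: q q2 {deg cardC qk0 Lm F q0} => // q _ /=; nia.
(* This is where [q > 2], that is [d >= 4], is needed: by [geom_mul], [2 * geom q k] is at most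
   [q ^ k - 1]. *)
have leLF : Lm <= F.*2.
  have := geom_mul k q0; rewrite /Lm /F geomS.
  have : 2 * geom q k <= q.-1 * geom q k by rewrite leq_mul2r; nat_lia.
  have : 2 * q ^ k <= q.-1 * q ^ k by rewrite leq_mul2r; nat_lia.
  by clear -qk0; nat_lia.
have Lm0 : 0 < Lm by rewrite /Lm geomS; nat_lia.
have s0 : 0 < s by rewrite /s; nat_lia.
have l4s : l = 4 * s by rewrite l_k.
have edge_cases i f : i <= l -> f \in A i -> exists z z',
    [/\ f = [set z; z'], adj z z', z \in U, z' \in U & 
        (zone z /\ thread_end z') \/ (z \in O /\ z' \in O)].
  move=> il /edge_ballP[z [z' [zR zU' zz ->]]].
  have zU := subsetP (reach_sub adj k (vU il)) _ zR.
  have ends x y : zone x -> y \in U -> adj x y -> thread_end y.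
    move=> zx yU xy; case zy: (zone y); first by constructor 1.
    by have [_ [[-> _]|[-> _]]] := zone_exit zx yU (negbT zy) xy; [constructor 2|constructor 3].
  case z1: (zone z).
    by exists z, z'; split=> //; left; split=> //; apply: ends zz.
  case z2: (zone z').
    rewrite adjC in zz; exists z', z; split=> //; first by rewrite setUC.
    by left; split=> //; apply: ends zz.
  by exists z, z'; split=> //; right; rewrite !inE zU zU' z1 z2.
have shortA i f : i + s <= 4 * s -> ~ (forall j, i <= j <= i + s -> f \in A j).
  rewrite -l4s => il all.
  have fi : f \in A i by apply: all; nat_lia.
  have [z [z' [Ef zz zU zU' [[z1 z2]|[z1 z2]]]]] := edge_cases i f (leq_trans (leq_addr _ _) il) fi.
    have t1 : thread_end z by constructor 1.
    have h1 : near i z || near i z' by rewrite -edge_ball_thread -?Ef //; nat_lia.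
    have h2 : near (i + s) z || near (i + s) z'.
      by rewrite -edge_ball_thread -?Ef //; apply: all; nat_lia.
    move: h1 h2; rewrite /near /dist /s.
    by case: (adj_zone z1 zU' zz) => [[E d]|[d1 d2 _ d]]; case/orP => h1; case/orP => h2; nat_lia.
  (* An edge outside the zone only meets balls around the first or the last [k.+1] vertices, and the
     index [i + k.+1] is too far from both ends. *)
  have fm : f \in A (i + k.+1) by apply: all; rewrite /s; nat_lia.
  rewrite Ef in fm; have [|[h _]|[h _]] := outer_ball _ z1 z2 zz fm; rewrite /s in il; nat_lia.
have c'A i : i = 0 \/ i = l -> {in A i &, injective c'}.
  move=> i0; have il : i <= l by nat_lia.
  have p0 : phi (v i) = 0 by rewrite /phi zone_v //; case: ifP; nat_lia.
  move=> f g /(subsetP (edge_ball_off_zone (vU il) p0)) fB /(subsetP (edge_ball_off_zone (vU il) p0)) gB.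
  by apply: (c'good (v i)) => //; rewrite inE vU // p0.
have [|||cc [ccI ccE cc0 ccl]] := @conveyor {set G} C s Lm F A c' c' cardLF leLF Lm0 s0 _ shortA.
- by move=> i; rewrite -l4s => il; apply: card_thread_ball.
- by apply: c'A; left.
- by apply: c'A; right; rewrite l4s.
rewrite -l4s in ccI ccE ccl.
clear cardC cardLF leLF Lm0 q0 qk0 Lm F.
have ccE' f i j : i <= j -> j <= l -> (forall m, i <= m <= j -> f \in A m) -> cc i f = cc j f.
  move=> ij; elim: j ij => [|j IHj]; first by rewrite leqn0 => /eqP->.
  rewrite leq_eqVlt => /predU1P[->//|]; rewrite ltnS => ij jl fA.
  rewrite IHj ?(ltnW jl) //; last by move=> m /andP[h1 h2]; apply: fA; rewrite h1 leqW.
  by rewrite ccE // inE !fA ?ij ?leqnn ?leqnSn // leqW.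
have old_cc f i : i <= l -> f \in A i -> f \in edges adj U' -> cc i f = c' f.
  move=> il fA fold.
  suff [h|h] : (forall j, j <= i -> f \in A j) \/ (forall j, i <= j <= l -> f \in A j).
  - by rewrite -cc0; symmetry; apply: ccE' => // m /andP[_ mi]; apply: h.
  - by rewrite -ccl; apply: ccE'.
  have [z [z' [Ef zz zU zU' [[z1 z2]|[z1 z2]]]]] := edge_cases i f il fA; last first.
    by rewrite Ef in fA *; case: (outer_ball il z1 z2 zz fA) => -[_ h]; [left|right].
  have t1 : thread_end z by constructor 1.
  have [oz oz'] : phi z <= k.+1 /\ phi z' <= k.+1.
    case/edgesP: fold => a [b [+ + _ Eab]]; rewrite !inE => /andP[_ pa] /andP[_ pb].
    have : z \in [set a; b] by rewrite -Eab Ef !inE eqxx.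
    have : z' \in [set a; b] by rewrite -Eab Ef !inE eqxx orbT.
    by move=> /set2P[] -> /set2P[] ->.
  have oe x : thread_end x -> phi x <= k.+1 -> minn (ix x) (l - ix x) + dep x <= k.+1.
    rewrite /phi; case=> [->//|->|->].
      by rewrite ix_v // dep_v // min0n.
    by rewrite ix_v // dep_v // subnn minn0.
  have {}oz := oe _ t1 oz; have {}oz' := oe _ z2 oz'.
  have [_ zl] := thread_ix t1; have [_ zl'] := thread_ix z2.
  have h1 : near i z || near i z' by rewrite -edge_ball_thread -?Ef.
  (* An edge already coloured has both ends at depth at most [k.+1] in the zone, on the same side;
     the balls that contain it extend up to that end of the thread. *)
  have key : (forall j, j <= i -> near j z || near j z') \/ (forall j, i <= j <= l -> near j z || near j z').
    have [side|side] : ix z + dep z <= k.+1 /\ ix z' + dep z' <= k.+1 \/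
        l - ix z + dep z <= k.+1 /\ l - ix z' + dep z' <= k.+1.
    + case: (adj_zone z1 zU' zz) => [[E d]|[d1 d2 _ d]]; move: oz oz'; nat_lia.
    + left=> j ji; move: h1 side; rewrite /near /dist => + [s1 s2].
      case: (adj_zone z1 zU' zz) => [[E d]|[d1 d2 _ d]]; case/orP=> h1; apply/orP; nat_lia.
    + right=> j /andP[ij jl]; move: h1 side; rewrite /near /dist => + [s1 s2].
      case: (adj_zone z1 zU' zz) => [[E d]|[d1 d2 _ d]]; case/orP=> h1; apply/orP; nat_lia.
  case: key => key; [left=> j ji | right=> j ij].
    by rewrite /A Ef edge_ball_thread ?key // (leq_trans ji).
  by rewrite /A Ef edge_ball_thread ?key //; case/andP: ij.
have new_cc f i j : i <= j -> j <= l -> f \in A i -> f \in A j -> f \notin edges adj U' -> cc i f = cc j f.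
  move=> ij jl fi fj fnew; apply: ccE' => // m /andP[im mj].
  have il := leq_trans ij jl; have ml := leq_trans mj jl.
  have [z [z' [Ef zz zU zU' [[z1 z2]|[z1 z2]]]]] := edge_cases i f il fi; last first.
    case/negP: fnew; apply/edgesP; exists z, z'; split=> //.
      by move: z1; rewrite !inE => /andP[-> /negbTE zz1]; rewrite /phi zz1.
    by move: z2; rewrite !inE => /andP[-> /negbTE zz1]; rewrite /phi zz1.
  have t1 : thread_end z by constructor 1.
  have : near j z || near j z' by rewrite -edge_ball_thread -?Ef.
  have : near i z || near i z' by rewrite -edge_ball_thread -?Ef.
  rewrite /A Ef edge_ball_thread // /near /dist.
  case: (adj_zone z1 zU' zz) => [[E d]|[d1 d2 _ d]]; case/orP=> h1; case/orP=> h2; apply/orP; nat_lia.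
(* By [new_cc] the index picked does not matter. *)
pose c f := if f \in edges adj U' then c' f else
  if [pick i : 'I_l.+1 | f \in A i] is Some i then cc i f else c' f.
have cE i f : i <= l -> f \in A i -> c f = cc i f.
  move=> il fA; rewrite /c; case: ifPn => fold; first by rewrite (old_cc f i).
  case: pickP => [j fj|/(_ (inord i))]; last by rewrite inordK ?fA.
  have jl : j <= l by rewrite -ltnS.
  have [ij|/ltnW ji] := leqP i j; last exact: new_cc.
  by symmetry; apply: new_cc.
exists c => u uU.
(* By [shallow_ball] the vertex [u] may be replaced by its root. A root in the zone is a vertex of
   the thread, served by the conveyor; the ball around any other root lies in the part already
   coloured. *)
have rUu : rroot u \in U := rroot_in rU uU.
have sub := subsetP (shallow_ball adjC rU depk uU).
have [z1|z1] := boolP (zone (rroot u)).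
  have d0 := rroot_dep rU uU.
  have ul : ix (rroot u) <= l by case/andP: z1; nat_lia.
  move=> f g /sub fB /sub gB; rewrite (zone_dep0 z1 d0) in fB gB.
  by rewrite (cE _ f ul fB) (cE _ g ul gB); apply: (ccI _ ul).
have p0 : phi (rroot u) = 0 by rewrite /phi (negbTE z1).
have rU' : rroot u \in U' by rewrite inE rUu p0.
have sub' := subsetP (edge_ball_off_zone rUu p0).
have sube := subsetP (edge_ball_sub_edges adj k rU').
move=> f g /sub/sub' fB /sub/sub' gB; rewrite /c !sube //.
exact: (c'good (rroot u)).
Qed.

End Thread.

(** * The induction *)

Section Main.
Variables (G : finType) (adj : rel G).
Hypotheses (adjC : symmetric adj) (adjI : irreflexive adj).

Local Notation nbr := (nbr adj).

Definition few_branch_cycle (W : {set G}) :=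
  exists c, [/\ ucycle adj c, 2 < size c, {subset c <= W} &
    count (fun x => 2 < #|nbr W x|) c <= 5].

(** The girth bound is [5 * l] for a thread of [l = 4 * (2 * k + 2)] edges: at most five branch
    vertices cut the cycle into at most five arcs. *)
Lemma good_exists (C : finType) k q :
  2 < q -> (forall x, #|[set y | adj x y]| <= q.+1) -> #|C| = q.+1 * geom q k.+1 ->
  (forall c, 2 < size c -> ucycle adj c -> 20 * (2 * k + 2) <= size c) ->
  (forall W : {set G}, W != set0 -> {in W, forall x, 1 < #|nbr W x|} -> few_branch_cycle W) ->
  forall U : {set G}, exists c : {set G} -> C, good adj k U c.
Proof.
move=> q2 degG cardC girth sparse U.
have [n] := ubnP #|U|; elim: n U => // n IHn U leUn.
have IH (U1 : {set G}) : #|U1| < #|U| -> exists c : {set G} -> C, good adj k U1 c.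
  by move=> ltU; apply: IHn; rewrite ltnS in leUn; apply: leq_trans leUn.
have deg : {in U, forall x, #|nbr U x| <= q.+1}.
  move=> x _; apply: leq_trans (degG x); apply/subset_leq_card/subsetP => y.
  by rewrite !inE => /andP[].
have leC : q.+1 * geom q k.+1 <= #|C| by rewrite cardC.
have C0 : 0 < #|C|.
  have qk : 0 < q ^ k by rewrite expn_gt0 (ltn_trans _ q2).
  by rewrite cardC geomS muln_gt0 addn_gt0 qk orbT.
have [W [dep [par [rU Wdeg]]]] := peel adjC adjI U.
have [/forall_inP depk|] := boolP [forall x in U, dep x <= k]; last first.
  rewrite negb_forall => /existsP[x0]; rewrite negb_imply -ltnNge => /andP[x0U kx0].
  case: (arg_maxnP dep x0U) => x xU' maxx; have {xU'} xU : x \in U by exact: xU'.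
  apply: (leaf_good adjC adjI deg leC rU xU) => //.
    by apply: leq_trans kx0 _; apply: maxx.
  by apply: IH; rewrite [ltnRHS](cardsD1 x) xU.
have [W0|Wn0] := eqVneq W set0.
  by rewrite W0 in rU; apply: (shallow_forest_good adjC deg C0 leC rU depk).
have [c [uc c2 cW cb]] := sparse W Wn0 Wdeg.
pose l := 4 * (2 * k + 2).
have l1 : l.-1.+1 = l by rewrite /l; clear; nat_lia.
have [||a [p [z [pp pu ps pb psub]]]] := @cycle_clean_path _ adj _ l.-1 c uc cb.
- by rewrite /l; clear; nat_lia.
- have := girth c c2 uc; rewrite l1 /l; clear; nat_lia.
pose v := nth a (a :: rcons p z).
have szv : size (a :: rcons p z) = l.+1 by rewrite /= size_rcons ps l1.
have vW i : i <= l -> v i \in W.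
  by move=> il; apply/cW/psub/mem_nth; rewrite szv ltnS.
have vI i j : i <= l -> j <= l -> v i = v j -> i = j.
  by move=> il jl /eqP; rewrite nth_uniq ?szv ?ltnS // => /eqP.
have vadj i : i < l -> adj (v i) (v i.+1).
  by move=> il; have := pathP a pp i; apply; rewrite size_rcons ps l1.
apply: (thread_good adjC adjI rU depk (erefl l) vW vI vadj _ _ q2 deg cardC IH).
(* An interior vertex of the path is not a branch vertex, so its neighbours in [W] are its two
   neighbours on the path. *)
- move=> i y il yW vy; have [il0 il1] : 0 < i /\ i < l by apply/andP.
  have vb : #|nbr W (v i)| <= 2.
    rewrite leqNgt; apply: contra pb => vb; apply/hasP; exists (v i) => //.
    rewrite /v; case: i il il0 il1 {vy vb} => // i _ _ il1 /=.
    by rewrite nth_rcons ps; rewrite ifT ?mem_nth ?ps; move: il1; rewrite -{1}l1 ltnS.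
  have sub : [set v i.-1; v i.+1] \subset nbr W (v i).
    apply/subsetP => x /set2P[]->; rewrite inE vW ?vadj //.
      by rewrite adjC -{2}(prednK il0) vadj // (leq_ltn_trans (leq_pred _)).
    by rewrite (leq_trans (leq_pred _)) // ltnW.
  have /eqP E : [set v i.-1; v i.+1] == nbr W (v i).
    rewrite eqEcard sub cards2 (leq_trans vb) // ltnS lt0b.
    apply/negP => /eqP/vI.
    by move=> /(_ (leq_trans (leq_pred _) (ltnW il1)) il1); nat_lia.
  have : y \in nbr W (v i) by rewrite inE yW.
  by rewrite -E => /set2P.
- move=> c' c'2 c'u; have := girth c' c'2 c'u; rewrite /l; clear; nat_lia.
Qed.

End Main.

(** * Distances in the line graph *)

Section LineGraph.
Variable G : sgraph.
Local Notation reach := (reach (@adj G) setT).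

Lemma edge_mem_adj (a : edge G) x y : x \in val a -> y \in val a -> x != y -> adj x y.
Proof.
case: a => a /= /existsP[u /existsP[w /andP[uw /eqP->]]] /set2P[]-> /set2P[]->.
- by rewrite eqxx.
- by [].
- by rewrite adj_sym.
- by rewrite eqxx.
Qed.

Lemma edge_in_ball (a : edge G) k v z :
  z \in val a -> z \in reach k v -> val a \in edge_ball (@adj G) setT k v.
Proof.
case: a => a /= /existsP[u /existsP[w /andP[uw /eqP->]]] /set2P[]-> h.
  exact: edge_ball_intro.
by rewrite finset.setUC; apply: edge_ball_intro; rewrite // adj_sym.
Qed.

(** Consecutive edges share a vertex and the ends of an edge are adjacent, so each step of the walk
    costs at most one step in [G]. *)
Lemma line_walk_fwd (p : seq (line_graph G)) (a : line_graph G) v :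
  path (@adj (line_graph G)) a p -> v \in val a ->
  exists2 z, z \in val (last a p) & z \in reach (size p) v.
Proof.
elim: p a v => [|b p IHp] a v /=; first by move=> _ va; exists v => //; rewrite inE.
move=> /andP[/andP[_ /finset.set0Pn[y]]]; rewrite inE => /andP[ya yb] pp va.
have [z zl zR] := IHp b y pp yb; exists z => //; change (z \in reach (1 + size p) v).
apply: reach_trans zR; have [->|vy] := eqVneq v y; first exact: reach_refl.
apply: reach_step (reach_refl _ _ _ _) _ _; rewrite ?inE //.
exact: edge_mem_adj va ya vy.
Qed.

Lemma line_walk_bwd (p : seq (line_graph G)) (a : line_graph G) v :
  path (@adj (line_graph G)) a p -> v \in val (last a p) ->
  exists2 z, z \in val a & z \in reach (size p) v.
Proof.
elim: p a v => [|b p IHp] a v /=; first by move=> _ va; exists v => //; rewrite inE.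
move=> /andP[/andP[_ /finset.set0Pn[y]]]; rewrite inE => /andP[ya yb] pp vl.
have [z zb zR] := IHp b v pp vl; exists y => //; change (y \in reach (size p).+1 v).
have [<-|zy] := eqVneq z y; first exact: reach_leq zR.
apply: reach_step zR _ _; rewrite ?inE //; exact: edge_mem_adj zb yb zy.
Qed.

(** The walk is cut after [k] steps. The next step passes through a vertex [v] common to two edges,
    and at most [k] steps remain, so both extreme edges have an end within [k] of [v]. For a walk of
    at most [k] steps, any end of the last edge serves as [v]. *)
Lemma good_colourable k K (c : {set G} -> 'I_K) :
  good (@adj G) k [set: G]%SET c -> dist_edge_colourable (2 * k + 1) G K.
Proof.
move=> cgood; apply/existsP; exists [ffun a => c (val a)].
apply/forallP => a; apply/forallP => b; apply/implyP => /andP[ab /existsP[p /andP[pp /eqP pl]]].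
rewrite !ffunE; apply: contra ab => /eqP E; apply/eqP/val_inj.
suff [v [aB bB]] : exists v, val a \in edge_ball (@adj G) setT k v /\ val b \in edge_ball (@adj G) setT k v.
  by apply: (cgood v) => //; rewrite finset.in_setT.
case: p pp pl => p /= ps pp pl.
have [pk|kp] := leqP (size p) k.
  have [v vb] : exists v, v \in val (last a p).
    case: (last a p) => s /= /existsP[u /existsP[w /andP[_ /eqP->]]].
    by exists u; rewrite !inE eqxx.
  have [z za zR] := line_walk_bwd pp vb; exists v; split.
    by apply: edge_in_ball za _; apply: reach_leq zR.
  by rewrite -pl; apply: edge_in_ball vb (reach_refl _ _ _ _).
move: pp pl; rewrite -(cat_take_drop k p) cat_path last_cat (drop_nth a kp) /=.
move=> /andP[p1 /andP[/andP[_ /finset.set0Pn[v vab]] p2]] pl.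
move: vab; rewrite inE => /andP[va vb].
have [z za zR] := line_walk_bwd p1 va.
have [z' zb zR'] := line_walk_fwd p2 vb.
exists v; split.
  apply: edge_in_ball za _; apply: reach_leq zR; rewrite size_take kp //.
rewrite pl in zb; apply: edge_in_ball zb _; apply: reach_leq zR'; rewrite size_drop leq_subLR.
by apply: leq_trans ps _; clear; lia.
Qed.

End LineGraph.

(** * Counting faces *)

Local Notation "\xsum_ ( i | P ) F" := (\big[addb/false]_(i | P) F)
  (at level 41, F at level 41, i, P at level 50).
Local Notation "\xsum_ i F" := (\big[addb/false]_i F)
  (at level 41, F at level 41, i at level 0).

Lemma odd_card (T : finType) (P : pred T) : odd #|[set x | P x]| = \xsum_(x | P x) true.
Proof.
rewrite -sum1_card (big_morph odd oddD (erefl _)).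
by apply: eq_bigl => x; rewrite inE.
Qed.

Lemma xsum_mkcond (T : finType) (P : pred T) (F : T -> bool) :
  \xsum_(x | P x) F x = \xsum_x (P x && F x).
Proof. by rewrite big_mkcond; apply: eq_bigr => x _; case: (P x). Qed.

Lemma odd_cardE (T : finType) (P : pred T) : odd #|[set x | P x]| = \xsum_x P x.
Proof. by rewrite odd_card xsum_mkcond; apply: eq_bigr => x _; rewrite andbT. Qed.

Lemma xsum_eq (T : finType) (P : pred T) (a : T) : \xsum_(x | P x) (a == x) = P a.
Proof.
rewrite xsum_mkcond (bigD1 a) //= eqxx andbT big1 ?addbF // => x xa.
by rewrite eq_sym (negbTE xa) andbF.
Qed.

Section EulerCount.
Variables (G : finType) (adj : rel G).
Hypotheses (adjC : symmetric adj) (adjI : irreflexive adj).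
Variable W : {set G}.
Local Notation E := (edges adj W).

Definition pdeg (Z : {set {set G}}) w := \xsum_(e | e \in Z) (w \in e).

Lemma pdegX (Z : {set {set G}}) w : pdeg Z w = \xsum_e ((e \in Z) && (w \in e)).
Proof. exact: xsum_mkcond. Qed.

Lemma handshake2 (Z : {set {set G}}) : Z \subset E -> \xsum_(w | w \in W) pdeg Z w = false.
Proof.
move=> ZE; rewrite /pdeg exchange_big /= big1 // => e /(subsetP ZE)/edgesP[x [y [xW yW xy ->]]].
have neq : x != y by apply: contraTneq xy => ->; rewrite adjI.
have -> : \xsum_(w | w \in W) (w \in [set x; y]) =
    \xsum_(w | w \in W) (x == w) (+) \xsum_(w | w \in W) (y == w).
  rewrite -big_split; apply: eq_bigr => w _; rewrite !inE !(eq_sym w) /=.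
  by case: (x =P w) => [<-|] //; rewrite eq_sym (negbTE neq).
by rewrite !xsum_eq xW yW.
Qed.

Definition symd (Y Z : {set {set G}}) := [set e | (e \in Y) (+) (e \in Z)].

Lemma pdeg_symd Y Z w : pdeg (symd Y Z) w = pdeg Y w (+) pdeg Z w.
Proof.
rewrite !pdegX -big_split; apply: eq_bigr => e _.
by rewrite inE andb_addl.
Qed.

(* The cycle space over the field with two elements. *)
Definition evens := [set Z in powerset E | [forall w in W, ~~ pdeg Z w]].

(** The cycle space has dimension at least [#|E| - #|W| + 1]. Sets of edges are sorted by their
    degree parities outside [w0]; adding a fixed member maps a class injectively into [evens], the
    parity at [w0] following from the handshake lemma. *)
Lemma card_evens : W != set0 -> 2 ^ #|E| <= 2 ^ #|W|.-1 * #|evens|.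
Proof.
case/set0Pn => w0 w0W.
pose T (Z : {set {set G}}) := [set w in W :\ w0 | pdeg Z w].
rewrite -card_powerset -sum1_card.
rewrite (partition_big T (fun R => R \in powerset (W :\ w0))) /=; last first.
  by move=> Z _; rewrite powersetE; apply/subsetP => w; rewrite inE => /andP[].
have -> : #|W|.-1 = #|W :\ w0| by rewrite (cardsD1 w0 W) w0W.
rewrite -card_powerset -sum_nat_const; apply: leq_sum => R _.
rewrite sum1_card.
have [Y0 /andP[Y0E /eqP TY0]|no] := pickP [pred Z | (Z \in powerset E) && (T Z == R)]; last first.
  by rewrite eq_card0 // => Z; have := no Z; rewrite !inE.
rewrite -(card_imset _ (_ : injective (symd Y0))); last first.
  move=> A B /setP h; apply/setP => e; have := h e; rewrite !inE.
  by case: (e \in Y0); case: (e \in A); case: (e \in B).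
apply/subset_leq_card/subsetP => _ /imsetP[Z ZP ->].
have /andP[ZE /eqP TZ] : (Z \in powerset E) && (T Z == R) by exact: ZP.
rewrite powersetE in Y0E; rewrite powersetE in ZE.
have sE : symd Y0 Z \subset E.
  apply/subsetP => e; rewrite inE.
  case eY: (e \in Y0); first by move=> _; apply: (subsetP Y0E).
  by rewrite addFb => /(subsetP ZE).
have pd w : w \in W :\ w0 -> pdeg (symd Y0 Z) w = false.
  move=> wW; rewrite pdeg_symd; have /setP/(_ w) : T Y0 = T Z by rewrite TY0 TZ.
  by rewrite !inE; move: wW; rewrite !inE => ->/= ->; rewrite addbb.
rewrite inE powersetE sE; apply/forall_inP => w wW.
have [->|ww0] := eqVneq w w0; last by rewrite pd // !inE ww0.
have := handshake2 sE; rewrite (bigD1 w0) //= big1 ?addbF; first by move=> ->.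
by move=> w' /andP[w'W w'0]; apply: pd; rewrite !inE w'0.
Qed.

(** What is kept of a plane embedding: [face_count] is Euler's inequality. Faces are indexed because
    two of them may have the same edges, as for a single cycle. *)
Record face_family (I : finType) (z : I -> {set {set G}}) : Prop := FaceFamily {
  face_sub : forall i, z i \subset E;
  face_n0 : forall i, z i != set0;
  face_even : forall i w, w \in W -> ~~ odd #|[set e in z i | w \in e]|;
  face_two : forall e, #|[set i | e \in z i]| <= 2;
  face_count : #|E| < #|I| + #|W|
}.

Lemma card_nbr x : x \in W -> #|[set e in E | x \in e]| = #|nbr adj W x|.
Proof.
move=> xW; have -> : [set e in E | x \in e] = [set [set x; y] | y in nbr adj W x].
  apply/setP => e; apply/idP/imsetP.
    rewrite inE => /andP[/edgesP[a [b [aW bW ab ->]]]] /set2P[]->.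
      by exists b; rewrite // inE bW.
    by exists a; rewrite 1?setUC // inE aW adjC.
  case=> y yN ->; move: yN; rewrite !inE eqxx andbT => /andP[yW xy].
  by apply/existsP; exists x; rewrite xW; apply/existsP; exists y; rewrite yW xy eqxx.
rewrite card_in_imset // => a b; rewrite !inE => /andP[_ xa] /andP[_ xb] /setP/(_ a).
rewrite !inE eqxx orbT => /esym/orP[]/eqP // ax.
by rewrite ax adjI in xa.
Qed.

Lemma sum_deg : \sum_(x in W) #|nbr adj W x| = 2 * #|E|.
Proof.
rewrite (eq_bigr (fun x => #|[set e in E | x \in e]|)); last by move=> x /card_nbr->.
rewrite (eq_bigr (fun x => \sum_(e in E) (x \in e))); last first.
  move=> x _; rewrite -sum1_card big_mkcond [RHS]big_mkcond; apply: eq_bigr => e _.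
  by rewrite inE; case: (e \in E); case: (x \in e).
rewrite exchange_big /= -sum1_card big_distrr /=; apply: eq_bigr => e /edgesP[a [b [aW bW ab ->]]].
have neq : a != b by apply: contraTneq ab => ->; rewrite adjI.
have <- : #|[set a; b]| = 2 * 1 by rewrite cards2 neq.
rewrite -sum1_card big_mkcond [RHS]big_mkcond; apply: eq_bigr => w _.
rewrite !inE; case: (w =P a) => [->|_]; first by rewrite aW.
by case: (w =P b) => [->|_]; rewrite ?bW //; case: ifP.
Qed.

(** By averaging, the degrees within some face add up to less than 12 over the branch vertices. All
    degrees in a face are even, so the face has minimum degree two on its support and contains a
    cycle; each branch vertex on it accounts for at least 2, so there are at most five. *)
Lemma faces_few_branch (I : finType) (z : I -> {set {set G}}) :
  face_family z -> W != set0 -> {in W, forall x, 1 < #|nbr adj W x|} ->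
  few_branch_cycle adj W.
Proof.
move=> [zE z0 zeven z2 zcount] Wn0 Wdeg.
pose B := [set w in W | 2 < #|nbr adj W w|].
pose dz i w := #|[set e in z i | w \in e]|.
have dzE i w : dz i w = \sum_(e in E) ((e \in z i) * (w \in e)).
  rewrite /dz -sum1_card big_mkcond [RHS]big_mkcond; apply: eq_bigr => e _.
  rewrite inE; case: (boolP (e \in z i)) => [/(subsetP (zE i))->|_]; first by case: (w \in e).
  by case: ifP.
have [i hi] : exists i, \sum_(w in B) dz i w < 12.
  apply/existsP; rewrite -[X in is_true X]negbK negb_exists; apply/negP => /forallP all.
  have le12 : 12 * #|I| <= \sum_i \sum_(w in B) dz i w.
    rewrite mulnC -sum_nat_const; apply: leq_sum => i _.
    by have := all i; rewrite -leqNgt.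
  have le2 : \sum_i \sum_(w in B) dz i w <= \sum_(w in B) 2 * #|nbr adj W w|.
    rewrite exchange_big /=; apply: leq_sum => w; rewrite inE => /andP[wW _].
    rewrite -card_nbr //.
    under eq_bigr do rewrite dzE.
    rewrite exchange_big /= -sum1_card big_distrr /= [leqRHS]big_mkcond [leqLHS]big_mkcond /=.
    apply: leq_sum => e _.
    have -> : (e \in [set f in E | w \in f]) = (e \in E) && (w \in e) by rewrite in_set.
    case eE: (e \in E) => //=.
    have h : \sum_i (e \in z i) <= 2.
      apply: leq_trans (z2 e); rewrite -sum1_card [leqRHS]big_mkcond; apply: leq_sum => i _.
      by rewrite inE; case: (e \in z i).
    rewrite -big_distrl /=; case: (w \in e); rewrite ?muln0 //; by rewrite !muln1.
  (* A degree [n >= 3] satisfies [2 * n <= 6 * (n - 2)]; vertices of degree two contribute nothing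
     to the right-hand side. *)
  have le6 : \sum_(w in B) 2 * #|nbr adj W w| <= \sum_(w in W) 6 * (#|nbr adj W w| - 2).
    rewrite big_mkcond [leqRHS]big_mkcond; apply: leq_sum => w _.
    rewrite inE; case: (w \in W) => //=; case: ifP => // h; nat_lia.
  have eqW : \sum_(w in W) 6 * (#|nbr adj W w| - 2) + 12 * #|W| = 12 * #|E|.
    rewrite -big_distrr /= -(mulnA 6 2 #|W|) -(mulnA 6 2 #|E|) -sum_deg -mulnDr; congr (6 * _).
    rewrite mulnC -sum_nat_const -big_split; apply: eq_bigr => w /Wdeg h /=; nat_lia.
  by clear -le12 le2 le6 eqW zcount; nat_lia.
have dz2 e w : e \in z i -> w \in e -> 1 < dz i w.
  move=> ez we; have [x [y [xW yW xy Ee]]] := edgesP _ _ _ (subsetP (zE i) _ ez).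
  have wW : w \in W by move: we; rewrite Ee => /set2P[]->.
  have := zeven i w wW; rewrite -/(dz i w).
  have : 0 < dz i w by rewrite card_gt0; apply/set0Pn; exists e; rewrite inE ez.
  by case: (dz i w) => [|[]].
pose r := [rel x y | adj x y && ([set x; y] \in z i)].
have rC : symmetric r by move=> x y; rewrite /= adjC setUC.
have rI : irreflexive r by move=> x; rewrite /= adjI.
have zedge e w : e \in z i -> w \in e -> exists2 y, r w y & e = [set w; y].
  move=> ez; have [x [y [xW yW xy Ee]]] := edgesP _ _ _ (subsetP (zE i) _ ez).
  rewrite Ee => /set2P[]->; first by exists y; rewrite //= xy -Ee.
  by exists x; rewrite /= 1?adjC 1?[in [set y; x]]setUC ?xy -?Ee //; rewrite setUC.
have [e ez] := set0Pn _ (z0 i).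
have [x [y [xW yW xy Ee]]] := edgesP _ _ _ (subsetP (zE i) _ ez).
have rxy : r x y by rewrite /= xy -Ee.
have [|c uc c2] := mindeg2_cycle rC rI rxy.
  move=> a b /= /andP[ab abz].
  have := dz2 _ a abz; rewrite !inE eqxx => /(_ isT).
  rewrite /dz (cardsD1 [set a; b]) inE abz !inE eqxx /= add1n ltnS card_gt0.
  case/set0Pn => f; rewrite !inE => /and3P[fab fz af].
  have [b' rab' Ef] := zedge _ _ fz af; exists b' => //.
  by apply: contraNneq fab => <-; rewrite Ef.
have cz w : w \in c -> exists2 e', e' \in z i & w \in e'.
  move=> wc; case/andP: uc => cc uc; have := next_cycle cc wc => /andP[_ h].
  by exists [set w; next c w]; rewrite // !inE eqxx.
have cW w : w \in c -> w \in W.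
  move=> /cz[e' e'z we']; have [a [b [aW bW _ E']]] := edgesP _ _ _ (subsetP (zE i) _ e'z).
  by move: we'; rewrite E' => /set2P[]->.
exists c; split=> //.
  case/andP: uc => cc uc; rewrite /ucycle uc andbT.
  by apply: sub_cycle cc => a b /andP[].
have uc' : uniq c by case/andP: uc.
have : \sum_(w <- c | 2 < #|nbr adj W w|) 2 <= \sum_(w in B) dz i w.
  rewrite -big_filter big_uniq ?filter_uniq //=.
  rewrite [leqLHS]big_mkcond [leqRHS]big_mkcond; apply: leq_sum => w _.
  rewrite mem_filter inE; case: ifP => // /andP[w2 wc]; rewrite w2 cW //=.
  by have [e' e'z we'] := cz w wc; apply: dz2 we'.
rewrite big_const_seq iter_addn_0 => /leq_ltn_trans/(_ hi).
have half m : 2 * m < 12 -> m <= 5 by nat_lia.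
exact: half.
Qed.

End EulerCount.

(** * Labelled complexes modulo 2 *)

Section Complex.
Variables (P D Q : finType) (src dst : D -> P) (lft rgt : D -> Q).

(* A cell complex modulo 2 with vertices [P], edges [D] and faces [Q]: [cobd] is
   the boundary of a set of faces, [bd] the boundary of a set of edges. *)
Definition cobd (S : Q -> bool) d := S (lft d) (+) S (rgt d).
Definition bd (Y : D -> bool) p := \xsum_d (Y d && ((src d == p) (+) (dst d == p))).
Definition darts_adj p q :=
  [exists d, (src d == p) && (dst d == q) || (src d == q) && (dst d == p)].
Definition restr (T : pred P) := [rel p q | [&& T p, T q & darts_adj p q]].

Lemma restr_sym T : symmetric (restr T).
Proof.
move=> p q; rewrite /= andbCA; congr [&& _, _ & _].
by apply: eq_existsb => d; rewrite orbC.
Qed.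

Lemma chain_exists (T : pred P) p q : connect (restr T) p q ->
  exists Y : D -> bool, (forall d, Y d -> T (src d) && T (dst d)) /\
    (forall r, bd Y r = (p == r) (+) (q == r)).
Proof.
case/connectP => s; elim: s p => [|p' s IHs] p /=.
  move=> _ ->; exists (fun=> false); split=> // r.
  by rewrite addbb /bd big1.
move=> /andP[/and3P[Tp Tp' /existsP[d hd]] ps] qs.
have [Y [YT Ybd]] := IHs p' ps qs.
exists (fun d' => (d == d') (+) Y d'); split=> [d'|r].
  case: (d =P d') => [<- _|_ /YT//].
  by case/orP: hd => /andP[/eqP-> /eqP->]; rewrite Tp Tp'.
rewrite /bd (eq_bigr (fun d' => ((d == d') && ((src d' == r) (+) (dst d' == r))) (+)
    (Y d' && ((src d' == r) (+) (dst d' == r))))); last by move=> d' _; rewrite andb_addl.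
rewrite big_split /= -/(bd Y r) Ybd.
have -> : \xsum_d' ((d == d') && ((src d' == r) (+) (dst d' == r))) = (src d == r) (+) (dst d == r).
  rewrite (bigD1 d) //= eqxx big1 ?addbF // => d' dd'.
  by rewrite eq_sym (negbTE dd').
by case/orP: hd => /andP[/eqP-> /eqP->]; case: (p == r); case: (p' == r); case: (q == r).
Qed.

Hypothesis cobd_cycle : forall S p, bd (cobd S) p = false.

Variables (G : finType) (adj : rel G).
Hypotheses (adjC : symmetric adj) (adjI : irreflexive adj).
Variable W : {set G}.
Local Notation E := (edges adj W).
Variables (lab : P -> option G) (xd : {set G} -> D) (base : G -> P).

(** Exactness is asked only for cycles among labelled vertices, as a torus has cycles that bound
    nothing. *)
Hypothesis cycle_cobd : forall Y : D -> bool,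
  (forall d, Y d -> lab (src d) && lab (dst d)) ->
  (forall p, bd Y p = false) -> exists S, Y =1 cobd S.

Hypothesis xd_lab : forall e, e \in E -> exists u w,
  [/\ e = [set u; w], u != w, u \in W, w \in W & lab (src (xd e)) = Some u /\ lab (dst (xd e)) = Some w].

Hypothesis base_conn : {in W, forall w p, lab p = Some w ->
  connect (restr [pred q | lab q == Some w]) (base w) p}.

(* The edges of the complex realizing the graph, once blobs are contracted; the
   faces of the graph are the classes of faces connected across the others. *)
Let X d := (lab (src d) == lab (dst d)) && (lab (src d) : bool) || (d \in xd @: E).

Let xd_inj : {in E &, injective xd}.
Proof.
move=> e f /xd_lab[u [w [-> _ _ _ [su sw]]]] /xd_lab[u' [w' [-> _ _ _ [su' sw']]]] E.
by move: su sw; rewrite E su' sw' => -[->] [->].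
Qed.

Let drel := [rel q q' | [exists d, ~~ X d && ((lft d == q) && (rgt d == q') || (lft d == q') && (rgt d == q))]].

Let drel_sym : connect_sym drel.
Proof.
apply: sym_connect_sym => q q' /=; apply: eq_existsb => d.
by congr (_ && _); rewrite orbC.
Qed.

Let reg q := fingraph.root drel q.

Let reg_X d : ~~ X d -> reg (lft d) = reg (rgt d).
Proof.
move=> nX; apply/eqP; rewrite /reg root_connect //; apply: connect1 => /=.
by apply/existsP; exists d; rewrite nX !eqxx.
Qed.

(** The edges of the graph with the region [f] on exactly one side. Regions are named by their
    representatives. *)
Let zf f := [set e in E | (reg (lft (xd e)) == f) (+) (reg (rgt (xd e)) == f)].

Let I := {f : Q | (reg f == f) && (zf f != set0)}.

(** The dart of [e] is completed, inside the blobs of its two ends, by chains to their base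
    points. *)
Let lift_edge e : e \in E -> exists Y : D -> bool,
  [/\ forall d, Y d -> lab (src d) && lab (dst d), forall d, Y d -> X d,
      {in E, forall e', Y (xd e') = (e' == e)} &
      forall p, bd Y p = \xsum_(w | w \in W) ((w \in e) && (base w == p))].
Proof.
move=> eE; have [u [w [Ee uw uW wW [su sw]]]] := xd_lab eE.
have [Y1 [Y1T Y1b]] := chain_exists (base_conn uW su).
have [Y2 [Y2T Y2b]] := chain_exists (base_conn wW sw).
have Yin v (vW : v \in W) (Y : D -> bool) : (forall d, Y d -> ([pred q | lab q == Some v] (src d)) && [pred q | lab q == Some v] (dst d)) ->
    [/\ forall d, Y d -> lab (src d) && lab (dst d), forall d, Y d -> X d & {in E, forall e', Y (xd e') = false}].
  move=> YT; split=> [d|d|e' /xd_lab[a [b [_ ab _ _ [sa sb]]]]].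
  - by case/YT/andP => /= /eqP-> /eqP->.
  - by case/YT/andP => /= /eqP s1 /eqP s2; rewrite /X s1 s2 eqxx.
  - apply: negbTE; apply/negP => /YT/andP[/= /eqP s1 /eqP s2]; move: ab.
    by move: s1 s2; rewrite sa sb => -[->] [->]; rewrite eqxx.
have [a1 b1 c1] := Yin u uW Y1 Y1T.
have [a2 b2 c2] := Yin w wW Y2 Y2T.
exists (fun d => (Y1 d (+) Y2 d) (+) (xd e == d)); split=> [d|d|e' e'E|p].
- case: (xd e =P d) => [<- _|_]; first by rewrite su sw.
  by rewrite addbF; case h1: (Y1 d) => h; [apply: a1 | apply: a2].
- case: (xd e =P d) => [<- _|_]; first by rewrite /X imset_f ?orbT.
  by rewrite addbF; case h1: (Y1 d) => h; [apply: b1 | apply: b2].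
- by rewrite c1 // c2 //= (inj_in_eq xd_inj) // eq_sym.
rewrite /bd (eq_bigr (fun d => (Y1 d && ((src d == p) (+) (dst d == p))) (+)
    (Y2 d && ((src d == p) (+) (dst d == p))) (+)
    ((xd e == d) && ((src d == p) (+) (dst d == p))))); last first.
  by move=> d _; rewrite !andb_addl.
rewrite !big_split /= -/(bd Y1 p) -/(bd Y2 p) Y1b Y2b.
have -> : \xsum_d' ((xd e == d') && ((src d' == p) (+) (dst d' == p))) =
    (src (xd e) == p) (+) (dst (xd e) == p).
  rewrite (bigD1 (xd e)) //= eqxx big1 ?addbF // => d' dd'.
  by rewrite eq_sym (negbTE dd').
rewrite (bigD1 u) //= (bigD1 w) /=; last by rewrite wW eq_sym.
rewrite big1 => [|v /andP[/andP[_ vu] vw]].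
  rewrite Ee !inE !eqxx orbT /= addbF.
  by case: (base u == p); case: (base w == p); case: (src _ == p); case: (dst _ == p).
by rewrite Ee !inE (negbTE vu) (negbTE vw).
Qed.

(** The boundary of the region, being a cycle, leaves the blob of [w] an even number of times. Darts
    within a blob cancel, so only those of the edges at [w] are counted. *)
Let zf_even f w : w \in W -> ~~ odd #|[set e in zf f | w \in e]|.
Proof.
move=> wW; pose S q := reg q == f.
have SX d : ~~ X d -> cobd S d = false.
  by move=> /reg_X; rewrite /cobd /S => ->; rewrite addbb.
have : \xsum_(p | lab p == Some w) bd (cobd S) p = false by rewrite big1.
rewrite /bd exchange_big /=.
have -> : \xsum_d \xsum_(p | lab p == Some w) (cobd S d && ((src d == p) (+) (dst d == p))) =
    \xsum_d (cobd S d && ((lab (src d) == Some w) (+) (lab (dst d) == Some w))).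
  apply: eq_bigr => d _; case: (cobd S d); last by rewrite big1.
  by rewrite big_split /= !xsum_eq.
have -> : \xsum_d (cobd S d && ((lab (src d) == Some w) (+) (lab (dst d) == Some w))) =
    \xsum_(d | d \in xd @: E) (cobd S d && ((lab (src d) == Some w) (+) (lab (dst d) == Some w))).
  rewrite [RHS]big_mkcond; apply: eq_bigr => d _; case: ifPn => // dE.
  have [Xd|/SX->//] := boolP (X d).
  move: Xd; rewrite /X (negbTE dE) orbF => /andP[/eqP-> _].
  by rewrite addbb andbF.
rewrite big_imset //= => h; rewrite odd_cardE.
suff -> : \xsum_x ((x \in zf f) && (w \in x)) = false by [].
rewrite -[RHS]h [RHS]big_mkcond /=; apply: eq_bigr => e _.
rewrite /zf in_set; case: ifPn => // /xd_lab[a [b [-> ab aW bW [-> ->]]]].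
rewrite /cobd /S andTb; congr (_ && _).
rewrite !inE; have -> : (Some a == Some w) = (a == w) by [].
have -> : (Some b == Some w) = (b == w) by [].
rewrite !(eq_sym w); case: (a =P w) => [<-|_] /=; last by [].
by rewrite eq_sym (negbTE ab).
Qed.

(** An even set lifts to a cycle, which bounds a set [S] of faces of the complex; [S] is a union of
    regions, so the even set is the sum of their boundaries. Hence there are at most [2 ^ #|I|] even
    sets, and [card_evens] yields the count. *)
Lemma complex_faces : W != set0 -> exists (I : finType) (z : I -> {set {set G}}), face_family adj W z.
Proof.
move=> Wn0; exists I, (fun i : I => zf (val i)); split.
- by move=> i; apply/subsetP => e; rewrite in_set => /andP[].
- by move=> i; case/andP: (valP i).
- by move=> i w; apply: zf_even.
- move=> e; rewrite -(card_imset _ val_inj).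
  apply: leq_trans (_ : #|[set reg (lft (xd e)); reg (rgt (xd e))]| <= _); last first.
    by rewrite cards2; case: eqP.
  apply/subset_leq_card/subsetP => _ /imsetP[i + ->]; rewrite inE in_set => /andP[_].
  by rewrite !inE !(eq_sym (val i)); do 2 case: eqP.
have [L LP] : exists L : {set G} -> D -> bool, forall e, e \in E ->
  [/\ forall d, L e d -> lab (src d) && lab (dst d), forall d, L e d -> X d,
      {in E, forall e', L e (xd e') = (e' == e)} &
      forall p, bd (L e) p = \xsum_(w | w \in W) ((w \in e) && (base w == p))].
  have := @fin_all_exists {set G} (fun=> {ffun D -> bool}) (fun e Y => e \in E ->
    [/\ forall d, Y d -> lab (src d) && lab (dst d), forall d, Y d -> X d,
      {in E, forall e', Y (xd e') = (e' == e)} &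
      forall p, bd Y p = \xsum_(w | w \in W) ((w \in e) && (base w == p))]).
  case=> [e|L LP]; last by exists (fun e d => L e d) => e /LP.
  have [eE|eE] := boolP (e \in E); last by exists [ffun=> false].
  have [Y [h1 h2 h3 h4]] := lift_edge eE; exists [ffun d => Y d] => _; split.
  - by move=> d; rewrite ffunE; apply: h1.
  - by move=> d; rewrite ffunE; apply: h2.
  - by move=> e' e'E; rewrite ffunE h3.
  - by move=> p; rewrite -h4; apply: eq_bigr => d _; rewrite ffunE.
pose Phi (F : {set I}) : {set {set G}} := [set e in E | \xsum_(i | i \in F) (e \in zf (val i))].
have sub : evens adj W \subset [set Phi F | F in setT].
  apply/subsetP => Z; rewrite inE powersetE => /andP[ZE /forall_inP Zeven].
  (* The lifts end at base points, each met an even number of times. *)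
  pose Y d := \xsum_(e | e \in Z) L e d.
  have Ylab d : Y d -> exists2 e, e \in Z & L e d.
    move=> Yd; apply/exists_inP; apply: contraLR Yd; rewrite negb_exists_in => /forall_inP no.
    by rewrite /Y big1 // => e /no/negbTE.
  have [S YS] : exists S, Y =1 cobd S.
    apply: cycle_cobd => [d /Ylab[e eZ]|p].
      by have [h _ _ _] := LP e (subsetP ZE e eZ); apply: h.
    have -> : bd Y p = \xsum_(e | e \in Z) bd (L e) p.
      rewrite /bd exchange_big /=; apply: eq_bigr => d _.
      by rewrite /Y big_distrl.
    rewrite (eq_bigr (fun e : {set G} => \xsum_(w | w \in W) ((w \in e) && (base w == p)))); last first.
      by move=> e eZ; have [_ _ _ ->] := LP e (subsetP ZE e eZ).
    rewrite exchange_big /= big1 // => w wW.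
    rewrite -(big_distrl (base w == p)) /= -/(pdeg Z w).
    by rewrite (negbTE (Zeven w wW)).
  (* The lifted cycle lies in [X], so crossing a dart outside [X] does not change membership in
     [S]. *)
  have Sconst q : S q = S (reg q).
    have: connect drel q (reg q) by apply: connect_root.
    move: (reg q) => r; case/connectP => s; elim: s q => [|q' s IHs] q /=; first by move=> _ ->.
    move=> /andP[/existsP[d /andP[nX hd]] ps] E'.
    have SS : S (lft d) = S (rgt d).
      have : ~~ cobd S d.
        rewrite -YS; apply: contraNN nX => /Ylab[e eZ].
        by have [_ h _ _] := LP e (subsetP ZE e eZ); exact: h.
      by rewrite /cobd; case: (S (lft d)); case: (S (rgt d)).
    have -> : S q = S q'.
      by case/orP: hd => /andP[/eqP<- /eqP<-].
    exact: IHs.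
  apply/imsetP; exists [set i : I | S (val i)]; rewrite ?inE //.
  apply/setP => e; rewrite [RHS]in_set; case eE: (e \in E); last first.
    by apply: contraFF eE => /(subsetP ZE).
  have -> : (e \in Z) = Y (xd e).
    rewrite /Y (eq_bigr (fun f => e == f)) ?xsum_eq // => f fZ.
    by have [_ _ -> //] := LP f (subsetP ZE f fZ).
  rewrite YS /cobd (Sconst (lft _)) (Sconst (rgt _)) /=.
  rewrite -(big_imset (h := val) (fun f => e \in zf f)) /=; last by move=> ? ? _ _; apply: val_inj.
  rewrite -[S (reg (lft _))](xsum_eq S) -[S (reg (rgt _))](xsum_eq S) -big_split /=.
  rewrite [LHS]big_mkcond [RHS]big_mkcond; apply: eq_bigr => f _.
  have zfE : (e \in zf f) = (reg (lft (xd e)) == f) (+) (reg (rgt (xd e)) == f).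
    by rewrite in_set eE.
  rewrite -zfE; case ef: (e \in zf f); last by rewrite !if_same.
  have rf : reg f == f.
    have rr q : reg (reg q) = reg q by apply: root_root.
    by move: ef; rewrite zfE; case: eqP => [<-|_]; [rewrite rr | case: eqP => [<-|//]; rewrite rr].
  have If : (reg f == f) && (zf f != set0) by rewrite rf; apply/set0Pn; exists e.
  case Sf: (S f); symmetry; case: ifPn => //.
    by case/imsetP; exists (Sub f If); rewrite ?inE ?SubK.
  by case/imsetP => i; rewrite inE => Si Ef; rewrite Ef Si in Sf.
have := card_evens adjI Wn0.
have := leq_trans (subset_leq_card sub) (leq_imset_card _ _).
rewrite -powersetT card_powerset cardsT => le1.
move=> /leq_trans/(_ (leq_mul (leqnn _) le1)).
have W0 : 0 < #|W| by rewrite card_gt0.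
by rewrite -expnD leq_exp2l // => le2; rewrite -(prednK W0); lia.
Qed.
End Complex.

(** * The toroidal grid *)

Section Grid.
(* Opposite sides are glued, so that neighbours are always defined; this is
   harmless since labelled pixels avoid the first row and the first column. *)
Variable m : nat.
Local Notation P := ('I_m.+1 * 'I_m.+1)%type.

(** The dart [(true, p)] increases the first coordinate of [p], [(false, p)] the second. A square is
    named after its corner preceding the others in both coordinates, so [gsrc] also names the square
    on one side of a dart, and [grgt] names the other. *)
Definition gsrc (d : bool * P) : P := d.2.
Definition gdst (d : bool * P) : P :=
  if d.1 then (ordS d.2.1, d.2.2) else (d.2.1, ordS d.2.2).
Definition grgt (d : bool * P) : P :=
  if d.1 then (d.2.1, ord_pred d.2.2) else (ord_pred d.2.1, d.2.2).

Local Notation gcobd := (cobd gsrc grgt).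
Local Notation gbd := (bd gsrc gdst).

Lemma gbdE Y p : gbd Y p =
  (Y (true, p) (+) Y (true, (ord_pred p.1, p.2))) (+)
  (Y (false, p) (+) Y (false, (p.1, ord_pred p.2))).
Proof.
rewrite /bd.
rewrite (eq_bigr (fun d => (Y (d.1, d.2) && ((gsrc (d.1, d.2) == p) (+) (gdst (d.1, d.2) == p))))); last by case.
rewrite -(pair_bigA _ (fun b q => Y (b, q) && ((gsrc (b, q) == p) (+) (gdst (b, q) == p)))) /=.
rewrite big_bool /=.
have one (Z : P -> bool) q : \xsum_p' (Z p' && (p' == q)) = Z q.
  by rewrite (bigD1 q) //= eqxx andbT big1 ?addbF // => p' /negbTE->; rewrite andbF.
congr (_ (+) _).
  rewrite -[Y (true, p)](one (fun q => Y (true, q))).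
  rewrite -[Y (true, (ord_pred p.1, p.2))](one (fun q => Y (true, q))) -big_split.
  apply: eq_bigr => q _; rewrite /gsrc /gdst /= -andb_addr; congr (_ && (_ (+) _)).
  by case: p q => [i j] [i' j']; rewrite !xpair_eqE /= (can2_eq (@ordSK _) (@ord_predK _)).
rewrite -[Y (false, p)](one (fun q => Y (false, q))).
rewrite -[Y (false, (p.1, ord_pred p.2))](one (fun q => Y (false, q))) -big_split.
apply: eq_bigr => q _; rewrite /gsrc /gdst /= -andb_addr; congr (_ && (_ (+) _)).
by case: p q => [i j] [i' j']; rewrite !xpair_eqE /= (can2_eq (@ordSK _) (@ord_predK _)).
Qed.

Lemma grid_cobd_cycle S p : gbd (gcobd S) p = false.
Proof.
case: p => i j; rewrite gbdE /cobd /gsrc /grgt /=.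
by case: (S (i, j)); case: (S (i, ord_pred j)); case: (S (ord_pred i, j)); case: (S (ord_pred i, ord_pred j)).
Qed.

(** The set [S] counts modulo 2 the darts of [Y] crossed on the way to a square from the row [0],
    with the first coordinate fixed; the cycle condition gives the rule for darts of the other
    direction. *)
Lemma grid_cycle_cobd (L : pred P) (Y : bool * P -> bool) :
  (forall p, L p -> (0 < p.1) && (0 < p.2)) ->
  (forall d, Y d -> L (gsrc d) && L (gdst d)) ->
  (forall p, gbd Y p = false) -> exists S, Y =1 gcobd S.
Proof.
move=> L0 YL Y0.
have Ysrc b (p : P) : (p.1 == 0 :> nat) || (p.2 == 0 :> nat) -> Y (b, p) = false.
  move=> p0; apply/negbTE/negP => /YL /andP[/L0 + _]; rewrite /gsrc /=.
  by case/orP: p0 => /eqP->; rewrite ?andbF.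
pose S c (p : P) := \big[addb/false]_(b < m.+1 | b <= c) Y (true, (p.1, b)).
have S0 i j : S 0 (i, j) = false.
  by rewrite /S big1 // => b; rewrite leqn0 => b0; apply: Ysrc; rewrite /= b0 orbT.
have SS c (hc : c.+1 < m.+1) i j : S c.+1 (i, j) = Y (true, (i, Ordinal hc)) (+) S c (i, j).
  rewrite /S (bigD1 (Ordinal hc)) //=; congr (_ (+) _); apply: eq_bigl => b.
  by rewrite -val_eqE /= andbC -ltn_neqAle.
have V c (hc : c < m.+1) i j : S c (i, j) (+) S c (ord_pred i, j) = Y (false, (i, Ordinal hc)).
  elim: c hc => [|c IHc] hc; first by rewrite !S0 Ysrc //= orbT.
  rewrite !(SS _ hc).
  have hc' : c < m.+1 by apply: ltnW.
  have := IHc hc'; have := Y0 (i, Ordinal hc); rewrite gbdE /=.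
  have -> : ord_pred (Ordinal hc) = Ordinal hc'.
    by apply: val_inj => /=; rewrite modnDr modn_small.
  by case: (Y (true, _)); case: (Y (true, _)); case: (Y (false, _)); case: (Y (false, _)); case: (S c _); case: (S c _).
(* Going once around the torus must give zero: this holds at first coordinate [0], which [Y] avoids,
   and propagates because no dart of [Y] ends in row [0]. *)
have Sm i j : S m (i, j) = false.
  have Rp i' : S m (i', j) = S m (ord_pred i', j).
    have := V m (ltnSn m) i' j; have -> : Y (false, (i', Ordinal (ltnSn m))) = false.
      apply/negbTE/negP => /YL /andP[_ /L0]; rewrite /gdst /=.
      by rewrite modnn andbF.
    by case: (S m _); case: (S m _).
  case: i => i hi; elim: i hi => [|i IHi] hi.
    by rewrite /S big1 // => b _; apply: Ysrc.
  rewrite Rp -(IHi (ltnW hi)); congr (S m (_, j)).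
  by apply: val_inj => /=; rewrite modnDr modn_small // ltnW.
exists (fun p : P => S p.2 p) => -[[] [i j]]; rewrite /cobd /gsrc /grgt /=; last first.
  by rewrite (V j (ltn_ord j)); congr (Y (_, (_, _))); apply: val_inj.
case: j => -[|c] hc /=.
  rewrite modn_small // [S m _]Sm S0; by apply: Ysrc; rewrite /= orbT.
have hc' : c < m.+1 by apply: ltnW.
rewrite SS modnDr modn_small //.
rewrite [X in _ = _ (+) X](_ : _ = S c (i, Ordinal hc)) //.
by rewrite -addbA addbb addbF.
Qed.

End Grid.

(** * Blobs of pixels *)

Section Blobs.
Variables (m : nat) (G : finType) (adj : rel G).
Hypotheses (adjC : symmetric adj) (adjI : irreflexive adj).
Variable W : {set G}.
Local Notation E := (edges adj W).
Local Notation P := ('I_m.+1 * 'I_m.+1)%type.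
Local Notation grestr := (restr (@gsrc m) (@gdst m)).
Variables (T : G -> pred P) (K : {set G} -> pred P) (u w : {set G} -> G).
Variables (base : G -> P) (c1 c2 : {set G} -> P).

Hypothesis ends : forall e, e \in E -> [/\ e = [set u e; w e], u e != w e, u e \in W & w e \in W].
Hypothesis T_disj : forall x y q, x \in W -> y \in W -> T x q -> T y q -> x = y.
Hypothesis K_disj : forall e f q, e \in E -> f \in E -> K e q -> K f q -> e = f.
Hypothesis KT_disj : forall e x q, e \in E -> x \in W -> K e q -> T x q -> x \in e.
Hypothesis T_base : forall x, x \in W -> T x (base x).
Hypothesis T_u : forall e, e \in E -> connect (grestr (T (u e))) (base (u e)) (c1 e).
Hypothesis T_w : forall e, e \in E -> connect (grestr (T (w e))) (base (w e)) (c2 e).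
Hypothesis K_c1 : forall e, e \in E -> K e (c1 e).
Hypothesis K_conn : forall e, e \in E -> connect (grestr (K e)) (c1 e) (c2 e).
Hypothesis T_pos : forall x (q : P), x \in W -> T x q -> (0 < q.1) && (0 < q.2).
Hypothesis K_pos : forall e (q : P), e \in E -> K e q -> (0 < q.1) && (0 < q.2).

Let connect_in (A : pred P) p q : connect (grestr A) p q -> A p -> A q.
Proof.
case/connectP => s; elim: s p => [|p' s IHs] p /=; first by move=> _ ->.
by move=> /andP[/and3P[_ Ap' _] ps] qE _; apply: (IHs p').
Qed.

Let connect_comp (A B : pred P) a p :
  (forall q, A q -> connect (grestr A) a q -> B q) -> A a ->
  connect (grestr A) a p -> connect (grestr B) a p.
Proof.
move=> AB Aa.
have gen s x : A x -> connect (grestr A) a x -> connect (grestr B) a x ->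
    path (grestr A) x s -> connect (grestr B) a (last x s).
  elim: s x => [|q s IHs] x Ax ax bx //= /andP[h qs]; have := h => /and3P[_ Aq xq].
  have aq : connect (grestr A) a q by apply: (connect_trans ax); apply: connect1; exact: h.
  apply: IHs qs => //; apply: connect_trans bx (connect1 _).
  by rewrite /= !AB.
by case/connectP => s ps ->; apply: gen.
Qed.

(** Blobs must be connected, so only the component of the base point is kept. *)
Let T' x q := T x q && connect (grestr (T x)) (base x) q.
(* The middle of an edge is absorbed in the blob of its first end, up to the
   point where it meets the blob of the second one. *)
Let K0 e q := K e q && ~~ T' (w e) q.
Let K' e q := K0 e q && connect (grestr (K0 e)) (c1 e) q.
Let L x q := T' x q || [exists e, [&& e \in E, u e == x & K' e q]].

Let T'T x q : T' x q -> T x q. Proof. by case/andP. Qed.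
Let K'K e q : K' e q -> K e q. Proof. by case/andP => /andP[]. Qed.

(** By [KT_disj], the middle of [e] only meets blobs of ends of [e], and the pixels of the blob of
    [w e] were removed from it. *)
Let L_inj x y q : x \in W -> y \in W -> L x q -> L y q -> x = y.
Proof.
have TK a e : a \in W -> e \in E -> T' a q -> K' e q -> a = u e.
  move=> aW eE Ta /[dup] /K'K Ke /andP[/andP[_ nT] _].
  have [Ee ne uW wW] := ends eE.
  have := KT_disj eE aW Ke (T'T Ta); rewrite {1}Ee => /set2P[//|Ea].
  by rewrite -Ea Ta in nT.
move=> xW yW /orP[Tx|/existsP[e /and3P[eE /eqP <- Ke]]] /orP[Ty|/existsP[f /and3P[fE /eqP <- Kf]]].
- exact: T_disj (T'T Tx) (T'T Ty).
- exact: TK.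
- by symmetry; apply: TK.
- by rewrite (K_disj eE fE (K'K Ke) (K'K Kf)).
Qed.

Let lab q := [pick x in W | L x q].

Let labE x q : (lab q == Some x) = (x \in W) && L x q.
Proof.
rewrite /lab; case: pickP => [y /andP[yW Ly]|no]; last by rewrite no.
apply/eqP/andP => [[<-]//|[xW Lx]]; congr Some; exact: L_inj Ly Lx.
Qed.

Let T'_c1 e : e \in E -> T' (u e) (c1 e).
Proof.
move=> eE; have [_ _ uW _] := ends eE.
by rewrite /T' T_u // (connect_in (T_u eE)) ?T_base.
Qed.

Let T'_c2 e : e \in E -> T' (w e) (c2 e).
Proof.
move=> eE; have [_ _ _ wW] := ends eE.
by rewrite /T' T_w // (connect_in (T_w eE)) ?T_base.
Qed.

Let K'_c1 e : e \in E -> K' e (c1 e).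
Proof.
move=> eE; have [_ uw uW wW] := ends eE.
rewrite /K' connect0 andbT /K0 K_c1 //=; apply: contra uw => /T'T Tw.
by apply/eqP; apply: T_disj Tw => //; apply: T'T; apply: T'_c1.
Qed.

Let lab_conn x p : x \in W -> lab p = Some x ->
  connect (grestr [pred q | lab q == Some x]) (base x) p.
Proof.
move=> xW /eqP; rewrite labE xW /=.
have toT q : T' x q -> connect (grestr [pred q | lab q == Some x]) (base x) q.
  case/andP => _; apply: connect_comp; last exact: T_base.
  by move=> r Tr rc; rewrite /= labE xW /L /T' Tr rc.
case/orP => [/toT//|/existsP[e /and3P[eE /eqP ue /andP[_ Kc]]]].
apply: connect_trans (toT (c1 e) _) _; first by rewrite -ue; apply: T'_c1.
apply: connect_comp Kc; last by have /andP[] := K'_c1 eE.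
move=> r Kr rc; rewrite /= labE xW /L; apply/orP; right.
by apply/existsP; exists e; rewrite eE ue eqxx /K' Kr rc.
Qed.

(** On the way from [c1 e] to [c2 e] inside [K e], consider the first pixel in the blob of [w e] and
    its predecessor. *)
Let leave e : e \in E -> exists x y, [/\ K' e x, T' (w e) y & darts_adj (@gsrc m) (@gdst m) x y].
Proof.
move=> eE; have /connectP[s] := K_conn eE.
have := K'_c1 eE; elim: s (c1 e) (T'_c2 eE) => [|q s IHs] p Tc2 Kp /=.
  by move=> _ E; rewrite E in Tc2; case/andP: Kp => /andP[_ /negP].
move=> /andP[/and3P[Kep Keq pq] qs] E.
have [Tq|nTq] := boolP (T' (w e) q); first by exists p, q.
apply: (IHs q) => //.
have K0q : K0 e q by rewrite /K0 Keq nTq.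
case/andP: Kp => K0p pc; rewrite /K' K0q; apply: connect_trans pc (connect1 _).
by rewrite /= K0p K0q.
Qed.

Let edart e : e \in E -> exists d a b,
  [/\ e = [set a; b], a != b, a \in W, b \in W & lab (@gsrc m d) = Some a /\ lab (@gdst m d) = Some b].
Proof.
move=> eE; have [Ee ne uW wW] := ends eE.
have [x [y [Kx Ty /existsP[d hd]]]] := leave eE.
have lx : lab x = Some (u e).
  by apply/eqP; rewrite labE uW /L; apply/orP; right; apply/existsP; exists e; rewrite eE eqxx Kx.
have ly : lab y = Some (w e) by apply/eqP; rewrite labE wW /L Ty.
case/orP: hd => /andP[/eqP ds /eqP dd].
  by exists d, (u e), (w e); rewrite ds dd.
by exists d, (w e), (u e); rewrite ds dd; split=> //; rewrite 1?setUC 1?eq_sym.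
Qed.

Lemma blob_faces : W != set0 -> exists (I : finType) (z : I -> {set {set G}}), face_family adj W z.
Proof.
move=> Wn0.
have d0 : bool * P := (true, (ord0, ord0)).
have [xd xdP] : exists xd : {set G} -> bool * P, forall e, e \in E -> exists a b,
    [/\ e = [set a; b], a != b, a \in W, b \in W & lab (gsrc (xd e)) = Some a /\ lab (gdst (xd e)) = Some b].
  apply: (@fin_all_exists _ (fun=> (bool * P)%type) (fun e d => e \in E -> exists a b,
    [/\ e = [set a; b], a != b, a \in W, b \in W & lab (gsrc d) = Some a /\ lab (gdst d) = Some b])) => e.
  have [eE|eE] := boolP (e \in E); last by exists d0.
  by have [d h] := edart eE; exists d.
apply: (complex_faces (@grid_cobd_cycle m) adjI (lab := lab) (xd := xd) (base := base)) => //.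
- move=> Y YL Y0; apply: (@grid_cycle_cobd m (fun q => lab q)) => // q.
  case lq: (lab q) => [x|] // _; have : lab q == Some x by rewrite lq.
  rewrite labE => /andP[xW /orP[/T'T|/existsP[e /and3P[eE _ /K'K]]]]; first exact: T_pos.
  exact: K_pos.
- by move=> x xW p; apply: lab_conn.
Qed.

End Blobs.

From mathcomp Require Import all_order all_algebra.
From mathcomp Require Import all_classical all_reals all_analysis.
From mathcomp Require Import lra.

Import Order.TTheory GRing.Theory Num.Theory.
Import numFieldNormedType.Exports.

(** * Compact sets in the plane *)

Section Plane.
Variable R : realType.
Local Open Scope classical_set_scope.
Local Open Scope ring_scope.

Lemma fin_uniform_pos (I : finType) (P : I -> R -> Prop) :
  (forall i, exists2 d, 0 < d & P i d) ->
  (forall i d d', 0 < d' -> d' <= d -> P i d -> P i d') ->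
  exists2 d, 0 < d & forall i, P i d.
Proof.
move=> Pex Pmono.
suff [d d0 Pd] : exists2 d, 0 < d & {in enum I, forall i, P i d}.
  by exists d => // i; apply: Pd; rewrite mem_enum.
elim: (enum I) => [|i s [d d0 Pd]]; first by exists 1.
have [d' d'0 Pd'] := Pex i; exists (Num.min d d'); first by rewrite lt_min d0.
have m0 : 0 < Num.min d d' by rewrite lt_min d0.
move=> j; rewrite inE => /predU1P[->|js].
  by apply: Pmono Pd'; rewrite // ge_min lexx orbT.
by apply: Pmono (Pd j js); rewrite // ge_min lexx.
Qed.

Lemma fin_uniform_bound (I : finType) (P : I -> R -> Prop) :
  (forall i, exists b, P i b) ->
  (forall i b b', b <= b' -> P i b -> P i b') ->
  exists b, forall i, P i b.
Proof.
move=> Pex Pmono.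
suff [d Pd] : exists d, {in enum I, forall i, P i d}.
  by exists d => i; apply: Pd; rewrite mem_enum.
elim: (enum I) => [|i s [d Pd]]; first by exists 1.
have [d' Pd'] := Pex i; exists (Num.max d d').
move=> j; rewrite inE => /predU1P[->|js].
  by apply: Pmono Pd'; rewrite le_max lexx orbT.
by apply: Pmono (Pd j js); rewrite le_max lexx.
Qed.

(** A locally constant property holds on a relatively open and closed subset of a segment, which is
    connected. *)
Lemma local_global (a b : R) (P : R -> Prop) : a <= b -> P a ->
  (forall s, s \in `[a, b] -> exists2 e, 0 < e &
     forall s', s' \in `[a, b] -> `|s - s'| < e -> P s <-> P s') ->
  forall s, s \in `[a, b] -> P s.
Proof.
move=> ab Pa loc.
pose B := [set s | s \in `[a, b] /\ P s].
have opn (Q : R -> Prop) : (forall s s', Q s -> P s <-> P s' -> Q s') ->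
    exists2 C, open C & forall s, s \in `[a, b] -> Q s <-> C s.
  move=> QP; exists (\bigcup_(s in [set s | s \in `[a, b] /\ Q s])
      \bigcup_(e in [set e | 0 < e /\ forall s', s' \in `[a, b] -> `|s - s'| < e -> P s <-> P s']) ball s e).
    by apply: bigcup_open => s _; apply: bigcup_open => e _; apply: ball_open.
  move=> s sab; split=> [Qs|[s0 [s0ab Qs0] [e [e0 he] /= /(he _ sab)]]].
    have [e e0 he] := loc s sab; exists s => //; exists e => //.
    exact: ballxx.
  exact: QP Qs0.
suff E : B = `[a, b]%classic.
  by move=> s sab; have : B s by [rewrite E]; case.
apply: segment_connected.
- by exists a; split; rewrite // in_itv /= lexx.
- have [C oC CP] := opn P (fun s s' Ps h => iffLR h Ps); exists C => //.
  by apply/seteqP; split=> s [sab h]; split=> //; apply/(CP s sab).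
- have [C oC CP] := opn (fun s => ~ P s) (fun s s' Ps h => contra_not (iffRL h) Ps).
  exists (~` C); first exact: open_closedC.
  apply/seteqP; split=> s [sab h]; split=> //; first by move=> /(CP s sab).
  by apply: contrapT => nP; apply: h; apply/(CP s sab).
Qed.

Lemma arc_local (A : set R) (f : R -> R * R) (s e : R) :
  {within A, continuous f} -> A s -> 0 < e -> exists2 d, 0 < d &
    forall s', A s' -> `|s - s'| < d -> `|(f s).1 - (f s').1| < e /\ `|(f s).2 - (f s').2| < e.
Proof.
move=> /subspace_continuousP fA As e0.
have /(_ (ball (f s) e) (nbhsx_ballx _ _ e0)) := fA s As.
rewrite /nbhs /= => -[d d0 hd]; exists d => // s' As' ss'.
have := hd s' ss' As' => -[]; by [].
Qed.

(** The taxicab distances between points of the two sets form a compact, hence closed, set that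
    misses [0]. *)
Lemma compact_sep (A B : set (R * R)) :
  compact A -> compact B -> (forall x, A x -> B x -> False) ->
  exists2 d, 0 < d & forall x y, A x -> B y -> d <= `|x.1 - y.1| + `|x.2 - y.2|.
Proof.
move=> cA cB AB.
pose g (p : (R * R) * (R * R)) : R := `|p.1.1 - p.2.1| + `|p.1.2 - p.2.2|.
have cg : continuous g.
  move=> p; apply: cvgD; apply: cvg_norm; apply: cvgB.
  - apply: (@cvg_comp _ _ _ fst fst _ (nbhs p.1)); exact: cvg_fst.
  - apply: (@cvg_comp _ _ _ snd fst _ (nbhs p.2)); [exact: cvg_snd | exact: cvg_fst].
  - apply: (@cvg_comp _ _ _ fst snd _ (nbhs p.1)); [exact: cvg_fst | exact: cvg_snd].
  - apply: (@cvg_comp _ _ _ snd snd _ (nbhs p.2)); exact: cvg_snd.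
have cC : compact (g @` (A `*` B)).
  apply: continuous_compact; last exact: compact_setX.
  exact: continuous_subspaceT.
have oC : open (~` (g @` (A `*` B))).
  by apply: closed_openC; apply: compact_closed => //; exact: Rhausdorff.
have C0 : (~` (g @` (A `*` B))) 0.
  move=> [[x y] [/= Ax By] /eqP]; rewrite /g /= paddr_eq0 // !normr_eq0 !subr_eq0 => /andP[/eqP h1 /eqP h2].
  by apply: (AB x) => //; case: x y h1 h2 Ax By => ? ? [? ?] /= -> ->.
have := open_nbhs_nbhs (conj oC C0); rewrite -nbhs_ballE => -[d /= d0 hd].
exists d => // x y Ax By; rewrite leNgt; apply/negP => lt.
have := hd (g (x, y)); rewrite /ball /= sub0r normrN ger0_norm; last by rewrite addr_ge0.
by move=> /(_ lt); apply; exists (x, y).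
Qed.

Lemma compact_coord_bounded (A : set (R * R)) : compact A ->
  exists b, forall x, A x -> `|x.1| <= b /\ `|x.2| <= b.
Proof.
move=> cA.
have cA1 : compact (fst @` A).
  by apply: continuous_compact cA; apply: continuous_subspaceT => p; exact: cvg_fst.
have cA2 : compact (snd @` A).
  by apply: continuous_compact cA; apply: continuous_subspaceT => p; exact: cvg_snd.
have [b1 [_ h1]] := compact_bounded cA1; have [b2 [_ h2]] := compact_bounded cA2.
exists (Num.max (b1 + 1) (b2 + 1)) => x Ax; rewrite !le_max; split.
  by rewrite (h1 (b1 + 1)) ?ltrDl //; exists x.
by rewrite (h2 (b2 + 1)) ?orbT ?ltrDl //; exists x.
Qed.

End Plane.

(** * Pixelating a drawing *)

Section Drawing.
Variables (R : realType) (G : sgraph) (W : {set G}).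
Local Notation E := (edges (@adj G) W).
Local Open Scope classical_set_scope.
Local Open Scope ring_scope.

(** Planarity restricted to the edges of [W], with arcs indexed by sets of vertices and oriented
    from [u e] to [w e]. *)
Record drawing (pos : G -> R * R) (arc : {set G} -> R -> R * R) (u w : {set G} -> G) : Prop := Drawing {
  pos_inj : injective pos;
  arc_cont : forall e, e \in E -> {within `[0, 1], continuous (arc e)};
  arc_inj : forall e, e \in E -> {in `[0, 1] &, injective (arc e)};
  arc_ends : forall e, e \in E ->
    [/\ e = [set u e; w e]%SET, u e != w e, u e \in W, w e \in W &
        arc e 0 = pos (u e) /\ arc e 1 = pos (w e)];
  arc_vertex : forall e s x, e \in E -> s \in `]0, 1[ -> arc e s <> pos x;
  arc_cross : forall e f s s', e \in E -> f \in E -> e <> f ->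
    s \in `]0, 1[ -> s' \in `]0, 1[ -> arc e s <> arc f s'
}.

Lemma planar_drawing : W != finset.set0 -> planar R G -> exists pos arc u w, drawing pos arc u w.
Proof.
move=> /finset.set0Pn[x0 _] [pos [arc [pi ac aend av acr]]].
have Eis e : e \in E -> is_edge e.
  case/edgesP => x [y [_ _ xy ->]]; apply/existsP; exists x; apply/existsP; exists y.
  by rewrite xy eqxx.
pose arc' (e : {set G}) : R -> R * R := if insub e is Some a then arc a else fun=> 0.
have arcE e (eE : e \in E) : exists2 a : edge G, val a = e & arc' e = arc a.
  by rewrite /arc' insubT; [exact: Eis | move=> h; exists (Sub e h)].
have I0 : (0 : R) \in `[0, 1] by rewrite in_itv /= lexx ler01.
have I1 : (1 : R) \in `[0, 1] by rewrite in_itv /= lexx ler01.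
have [uw uwP] : exists uw : {set G} -> G * G, forall e, e \in E ->
   [/\ e = [set (uw e).1; (uw e).2]%SET, (uw e).1 != (uw e).2, (uw e).1 \in W, (uw e).2 \in W &
       arc' e 0 = pos (uw e).1 /\ arc' e 1 = pos (uw e).2].
  apply: (@fin_all_exists _ (fun=> (G * G)%type) (fun e p => e \in E ->
    [/\ e = [set p.1; p.2]%SET, p.1 != p.2, p.1 \in W, p.2 \in W &
        arc' e 0 = pos p.1 /\ arc' e 1 = pos p.2])) => e.
  have [eE|eE] := boolP (e \in E); last by exists (x0, x0).
  have [a ae ->] := arcE e eE; have [_ ai] := ac a.
  have : (pos @` [set x | x \in val a]) (arc a 0) by rewrite -aend; left.
  have : (pos @` [set x | x \in val a]) (arc a 1) by rewrite -aend; right.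
  rewrite ae => -[y /= ye yE] [x /= xe xE]; exists (x, y) => _ /=.
  have xy : x != y.
    apply/eqP => Exy; have : arc a 0 = arc a 1 by rewrite -xE -yE Exy.
    by move/(ai _ _ I0 I1)/eqP; rewrite eq_sym oner_eq0.
  have [b [c [bW cW bc Ee]]] := edgesP _ _ _ eE.
  split=> //.
  - rewrite Ee in xe ye *; case/set2P: xe xy => ->; case/set2P: ye => ->; rewrite ?eqxx // finset.setUC //.
  - by move: xe; rewrite Ee => /set2P[]->.
  - by move: ye; rewrite Ee => /set2P[]->.
exists pos, arc', (fun e => (uw e).1), (fun e => (uw e).2); split=> //.
- by move=> e eE; have [a _ ->] := arcE e eE; have [] := ac a.
- by move=> e eE; have [a _ ->] := arcE e eE; have [] := ac a.
- by move=> e s x eE s01; have [a _ ->] := arcE e eE; apply: av.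
- move=> e f s s' eE fE ef; have [a ae ->] := arcE e eE; have [b bf ->] := arcE f fE.
  by apply: acr => ab; apply: ef; rewrite -ae -bf ab.
Qed.

Section Pixels.
Variables (pos : G -> R * R) (arc : {set G} -> R -> R * R) (u w : {set G} -> G).
Hypothesis dr : drawing pos arc u w.

Lemma arc_meet e f s s' : e \in E -> f \in E -> s \in `[0, 1] -> s' \in `[0, 1] ->
  arc e s = arc f s' ->
  e = f /\ s = s' \/
  e <> f /\ exists x, (s = 0 /\ x = u e \/ s = 1 /\ x = w e) /\ (s' = 0 /\ x = u f \/ s' = 1 /\ x = w f).
Proof.
move=> eE fE s01 s01' Ess.
have [ef|/eqP ef] := eqVneq e f.
  by left; split=> //; rewrite -ef in Ess; apply: (arc_inj dr eE).
right; split=> //.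
have endp g r : g \in E -> r \in `[0, 1] ->
    (r \in `]0, 1[) \/ exists x, arc g r = pos x /\ (r = 0 /\ x = u g \/ r = 1 /\ x = w g).
  move=> gE; rewrite !in_itv /= => /andP[r0 r1].
  have [_ _ _ _ [g0 g1]] := arc_ends dr gE.
  have [->|r0'] := eqVneq r 0; first by right; exists (u g); split=> //; left.
  have [->|r1'] := eqVneq r 1; first by right; exists (w g); split=> //; right.
  by left; rewrite !lt_neqAle r0 r1 r1' eq_sym r0'.
case: (endp e s eE s01) => [si|[x [xE xs]]].
  case: (endp f s' fE s01') => [si'|[y [yE _]]].
    by case: (arc_cross dr eE fE ef si si').
  by case: (arc_vertex dr (x := y) eE si); rewrite Ess.
case: (endp f s' fE s01') => [si'|[y [yE ys]]].
  by case: (arc_vertex dr (x := x) fE si'); rewrite -Ess.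
exists x; split=> //; suff -> : x = y by [].
by apply: (pos_inj dr); rewrite -xE -yE.
Qed.

Definition third (t : 'I_3) : interval R := `[t%:R / 3, t.+1%:R / 3].
Definition piece (k : {set G} * 'I_3) : set (R * R) := arc k.1 @` [set` third k.2].
(** The outer thirds of an arc go to the blobs of its ends, the middle third to no vertex. Pieces
    that must not interfere are then disjoint compact sets, hence at positive distance. *)
Definition attach (k : {set G} * 'I_3) x :=
  (k.2 == ord0) && (x == u k.1) || (k.2 == ord_max) && (x == w k.1).

Lemma third01 t s : s \in third t -> s \in `[0, 1].
Proof.
rewrite !in_itv /= => /andP[h1 h2]; apply/andP; split.
  by apply: le_trans h1; rewrite divr_ge0.
apply: le_trans h2 _; rewrite ler_pdivrMr // mul1r ler_nat; exact: ltn_ord.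
Qed.

Lemma third_end0 (t : 'I_3) : 0 \in third t -> t = ord0.
Proof.
rewrite in_itv /= => /andP[h _]; apply/val_inj/eqP => /=; rewrite -leqn0 -(ler_nat R).
by move: h; lra.
Qed.

Lemma third_end1 (t : 'I_3) : 1 \in third t -> t = ord_max.
Proof.
rewrite in_itv /= => /andP[_ h]; apply/val_inj/eqP => /=; rewrite eqn_leq -ltnS ltn_ord /=.
by rewrite -(ler_nat R); move: h; rewrite -natr1; lra.
Qed.

Let o1 : 'I_3 := Ordinal (isT : (1 < 3)%N).

Lemma third_mid_end : (0 \in third o1) = false /\ (1 \in third o1) = false.
Proof. by rewrite !in_itv /=; split; apply/negbTE/negP => /andP[]; lra. Qed.

Lemma third_disj s : s \in third ord0 -> s \in third ord_max -> False.
Proof. by rewrite !in_itv /= => /andP[_ h] /andP[h' _]; lra. Qed.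

(** Distinct arcs meet only at a common end, to which both pieces are then attached; on a single arc
    the two outer thirds are disjoint. *)
Lemma attach_disj k k' x y z : k.1 \in E -> k'.1 \in E -> attach k x -> attach k' y ->
  piece k z -> piece k' z -> x = y.
Proof.
case: k k' => [e t] [f t'] /= eE fE ax ay [s /= st sz] [s' /= st' sz'].
have [[Eef Ess]|[ef [v [h1 h2]]]] := arc_meet eE fE (third01 st) (third01 st') (etrans sz (esym sz')).
  rewrite -Eef -Ess in st' ay.
  case/orP: ax => /andP[/= /eqP tE /eqP->]; case/orP: ay => /andP[/= /eqP tE' /eqP->] //.
    by rewrite tE in st; rewrite tE' in st'; case: (third_disj st st').
  by rewrite tE in st; rewrite tE' in st'; case: (third_disj st' st).
have at_end g (r : R) (q : 'I_3) x' : r \in third q -> (r = 0 /\ v = u g \/ r = 1 /\ v = w g) ->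
    attach (g, q) x' -> x' = v.
  move=> rq [[r0 ->]|[r1 ->]].
    by rewrite r0 in rq; rewrite /attach /= (third_end0 rq) /= orbF => /eqP.
  by rewrite r1 in rq; rewrite /attach /= (third_end1 rq) /= => /eqP.
by rewrite (at_end e s t x st h1 ax) (at_end f s' t' y st' h2 ay).
Qed.

Lemma middle_disj e f z : e \in E -> f \in E -> piece (e, o1) z -> piece (f, o1) z -> e = f.
Proof.
move=> eE fE [s /= st sz] [s' /= st' sz'].
have [[]//|[ef [v [h1 _]]]] := arc_meet eE fE (third01 st) (third01 st') (etrans sz (esym sz')).
have [n0 n1] := third_mid_end.
by case: h1 => -[h _]; rewrite h ?n0 ?n1 in st.
Qed.

Lemma middle_attach_disj e k x z : e \in E -> k.1 \in E -> attach k x ->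
  piece (e, o1) z -> piece k z -> x \in e.
Proof.
case: k => [f t] /= eE fE ax [s /= st sz] [s' /= st' sz'].
have [n0 n1] := third_mid_end.
have [[Eef _]|[ef [v [h1 _]]]] := arc_meet eE fE (third01 st) (third01 st') (etrans sz (esym sz')); last first.
  by case: h1 => -[h _]; rewrite h ?n0 ?n1 in st.
have [Ee _ _ _ _] := arc_ends dr fE.
by rewrite Eef Ee; case/orP: ax => /andP[_ /eqP->]; rewrite !inE eqxx ?orbT.
Qed.

Section Scale.
Variables (N m : nat) (b d : R).
Hypothesis bounded : forall e s, e \in E -> s \in `[0, 1] -> `|(arc e s).1| <= b /\ `|(arc e s).2| <= b.
Hypothesis separated : forall k k', k.1 \in E -> k'.1 \in E ->
  (forall z, piece k z -> piece k' z -> False) ->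
  forall x y, piece k x -> piece k' y -> d <= `|x.1 - y.1| + `|x.2 - y.2|.
Hypothesis N_large : 8 < N%:R * d.
Hypothesis m_large : N%:R * (2 * b) + 1 < m%:R.
Hypothesis N0 : 0 < N%:R :> R.

Local Notation P := ('I_m.+1 * 'I_m.+1)%type.
Local Notation grestr := (restr (@gsrc m) (@gdst m)).

(** The shift brings all coordinates of the drawing to at least [1], so that pixels avoid the row
    and the column [0]. *)
Definition scale (z : R) : R := N%:R * (z + b) + 1.
Definition cell (x : R * R) : P := (inord (Num.truncn (scale x.1)), inord (Num.truncn (scale x.2))).
(* The tolerance 2 covers both the pixel of [x] and the pixels inserted to make
   diagonal moves between adjacent pixels axis-parallel. *)
Definition near_pixel (x : R * R) (q : P) : bool :=
  [&& `|scale x.1 - (q.1 : nat)%:R| < 2, `|scale x.2 - (q.2 : nat)%:R| < 2, (0 < q.1)%N & (0 < q.2)%N].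
Definition covered k (q : P) : bool := `[< exists2 x, piece k x & near_pixel x q >].

Lemma truncn_scale z : `|z| <= b ->
  [/\ (0 < Num.truncn (scale z))%N, (Num.truncn (scale z) < m.+1)%N,
      (Num.truncn (scale z))%:R <= scale z & scale z < (Num.truncn (scale z))%:R + 1].
Proof.
rewrite ler_norml => /andP[z1 z2].
have s1 : 1 <= scale z.
  have zb : 0 <= z + b by lra.
  by rewrite /scale lerDr mulr_ge0 // ltW.
have s2 : scale z <= m%:R.
  apply: le_trans (ltW m_large); rewrite /scale lerD2r ler_pM2l //; lra.
have s0 : 0 <= scale z by apply: le_trans s1.
have /andP[t1 t2] := truncn_itv s0.
split=> //; last by rewrite natr1.
  by rewrite truncn_ge_nat.
by rewrite ltnS -(ler_nat R) (le_trans t1).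
Qed.

Lemma near_cell x : `|x.1| <= b -> `|x.2| <= b -> near_pixel x (cell x).
Proof.
move=> /truncn_scale[p1 l1 t1 u1] /truncn_scale[p2 l2 t2 u2].
rewrite /near_pixel /cell /= !inordK // p1 p2 !andbT !ltr_norml.
by apply/andP; split; apply/andP; split; lra.
Qed.

(** Twice the tolerance in each of two coordinates gives the [8] of [N_large]. *)
Lemma near_close x y q : near_pixel x q -> near_pixel y q ->
  N%:R * (`|x.1 - y.1| + `|x.2 - y.2|) < 8.
Proof.
have one (z z' c : R) : `|scale z - c| < 2 -> `|scale z' - c| < 2 -> N%:R * `|z - z'| < 4.
  rewrite -(ger0_norm (ltW N0)) -normrM /scale !ltr_norml mulrBr => /andP[a1 a2] /andP[a3 a4].
  by apply/andP; split; lra.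
move=> /and4P[h1 h2 _ _] /and4P[h3 h4 _ _]; rewrite mulrDr.
have := one _ _ _ h1 h3; have := one _ _ _ h2 h4; lra.
Qed.

Lemma covered_disj k k' q : k.1 \in E -> k'.1 \in E ->
  (forall z, piece k z -> piece k' z -> False) -> covered k q -> covered k' q -> False.
Proof.
move=> kE kE' dis /asboolP[x kx xq] /asboolP[y ky yq].
have h1 := near_close xq yq; have h2 := separated kE kE' dis kx ky.
have : N%:R * d <= N%:R * (`|x.1 - y.1| + `|x.2 - y.2|) by rewrite ler_pM2l.
by move: h1 N_large; lra.
Qed.

Lemma darts_adj_h (a : nat) (r : 'I_m.+1) : (a < m)%N ->
  darts_adj (@gsrc m) (@gdst m) (inord a, r) (inord a.+1, r).
Proof.
move=> am; apply/existsP; exists (true, (inord a, r)); rewrite /gsrc /gdst /= eqxx /=.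
have am' : (a < m.+1)%N by apply: leqW.
apply/orP; left; rewrite xpair_eqE eqxx andbT -val_eqE /= !inordK // modn_small //.
Qed.

Lemma darts_adj_v (a : nat) (r : 'I_m.+1) : (a < m)%N ->
  darts_adj (@gsrc m) (@gdst m) (r, inord a) (r, inord a.+1).
Proof.
move=> am; apply/existsP; exists (false, (r, inord a)); rewrite /gsrc /gdst /= eqxx /=.
have am' : (a < m.+1)%N by apply: leqW.
apply/orP; left; rewrite xpair_eqE eqxx /= -val_eqE /= !inordK // modn_small //.
Qed.

Lemma connect_step (T : pred P) (f : nat -> P) (a a' : nat) :
  (forall c, (c < m)%N -> darts_adj (@gsrc m) (@gdst m) (f c) (f c.+1)) ->
  (a < m.+1)%N -> (a' < m.+1)%N -> (a <= a'.+1)%N -> (a' <= a.+1)%N -> T (f a) -> T (f a') ->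
  connect (grestr T) (f a) (f a').
Proof.
move=> fadj am am' aa' a'a Ta Ta'.
have csym : connect_sym (grestr T) by apply: sym_connect_sym; apply: restr_sym.
have one c : (c.+1 < m.+1)%N -> T (f c) -> T (f c.+1) -> connect (grestr T) (f c) (f c.+1).
  by move=> cm Tc Tc'; apply: connect1; rewrite /= Tc Tc'; apply: fadj.
have [Eaa|[Eaa|Eaa]] : a = a' \/ a' = a.+1 \/ a = a'.+1 by lia.
- by rewrite Eaa connect0.
- by rewrite Eaa in am' Ta' *; apply: one.
- by rewrite Eaa in am Ta *; rewrite csym; apply: one.
Qed.

(** The two cells differ by at most one in each coordinate. They are joined through the corner cell
    with the first coordinate of [cell y] and the second of [cell x]. *)
Lemma cell_connect (T : pred P) x y :
  `|x.1| <= b -> `|x.2| <= b -> `|y.1| <= b -> `|y.2| <= b ->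
  N%:R * `|x.1 - y.1| < 1 -> N%:R * `|x.2 - y.2| < 1 ->
  (forall q, near_pixel x q -> T q) -> connect (grestr T) (cell x) (cell y).
Proof.
move=> /truncn_scale[p1 l1 t1 u1] /truncn_scale[p2 l2 t2 u2].
move=> /truncn_scale[p1' l1' t1' u1'] /truncn_scale[p2' l2' t2' u2'].
have close z z' : N%:R * `|z - z'| < 1 -> -1 < scale z - scale z' < 1.
  rewrite -(ger0_norm (ltW N0)) -normrM /scale !ltr_norml mulrBr => /andP[a1 a2].
  by apply/andP; split; lra.
move=> /close/andP[c1 c2] /close/andP[c3 c4] TP.
have nearx (a c : nat) : (a < m.+1)%N -> (c < m.+1)%N -> (0 < a)%N -> (0 < c)%N ->
    -2 < scale x.1 - a%:R < 2 -> -2 < scale x.2 - c%:R < 2 -> T (inord a, inord c).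
  by move=> am cm a0 c0 h1 h2; apply: TP; rewrite /near_pixel /= !inordK // a0 c0 !andbT !ltr_norml h1.
have step (z z' : R) (a a' : nat) : a%:R <= z -> z < a%:R + 1 -> a'%:R <= z' -> z' < a'%:R + 1 ->
    -1 < z - z' -> (a' <= a.+1)%N.
  by move=> *; rewrite -ltnS -(ltr_nat R) -!natr1; lra.
have e1 := step _ _ _ _ t1 u1 t1' u1' c1.
have e2 := step _ _ _ _ t2 u2 t2' u2' c3.
have e1' : (Num.truncn (scale x.1) <= (Num.truncn (scale y.1)).+1)%N by apply: step t1' u1' t1 u1 _; lra.
have e2' : (Num.truncn (scale x.2) <= (Num.truncn (scale y.2)).+1)%N by apply: step t2' u2' t2 u2 _; lra.
rewrite /cell.
set a1 := Num.truncn (scale x.1) in p1 l1 t1 u1 e1 e1' *.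
set a2 := Num.truncn (scale x.2) in p2 l2 t2 u2 e2 e2' *.
set a1' := Num.truncn (scale y.1) in p1' l1' t1' u1' e1 e1' *.
set a2' := Num.truncn (scale y.2) in p2' l2' t2' u2' e2 e2' *.
have T1 : T (inord a1, inord a2) by apply: nearx => //; apply/andP; split; lra.
(* The corner cell need not contain a point of the arc, but it is within the tolerance of [x]. *)
have T2 : T (inord a1', inord a2) by apply: nearx => //; apply/andP; split; lra.
have T3 : T (inord a1', inord a2') by apply: nearx => //; apply/andP; split; lra.
apply: (@connect_trans _ _ (inord a1', inord a2)).
  by apply: (@connect_step T (fun c => (inord c, inord a2))) => // c; apply: darts_adj_h.
by apply: (@connect_step T (fun c => (inord a1', inord c))) => // c; apply: darts_adj_v.
Qed.

(** By continuity, points of the arc with close parameters have connected cells, so being connected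
    to the first cell is locally constant along the third. *)
Lemma piece_connect e t s s' : e \in E -> s \in third t -> s' \in third t ->
  connect (grestr (covered (e, t))) (cell (arc e s)) (cell (arc e s')).
Proof.
move=> eE.
have csym : connect_sym (grestr (covered (e, t))) by apply: sym_connect_sym; apply: restr_sym.
pose lo : R := t%:R / 3.
have lohi : lo <= t.+1%:R / 3 by rewrite ler_pM2r // ler_nat.
suff from r : r \in third t -> connect (grestr (covered (e, t))) (cell (arc e lo)) (cell (arc e r)).
  by move=> st st'; apply: connect_trans (from _ st'); rewrite csym; apply: from.
apply: (local_global (P := fun r => connect (grestr (covered (e, t))) (cell (arc e lo)) (cell (arc e r)))) lohi _ _ r.
  exact: connect0.
move=> r rt; have r01 := third01 rt.
have ac : {within [set` third t], continuous (arc e)}.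
  by apply: continuous_subspaceW (arc_cont dr eE) => z; apply: third01.
have [|eta eta0 heta] := arc_local (e := N%:R^-1) ac rt; first by rewrite invr_gt0.
exists eta => // r' r't rr'; have [h1 h2] := heta r' r't rr'.
have cc : connect (grestr (covered (e, t))) (cell (arc e r)) (cell (arc e r')).
  have [b1 b2] := bounded eE r01; have [b1' b2'] := bounded eE (third01 r't).
  apply: cell_connect => //.
  - by rewrite mulrC -ltr_pdivlMr // mul1r.
  - by rewrite mulrC -ltr_pdivlMr // mul1r.
  - by move=> q nq; apply/asboolP; exists (arc e r) => //; exists r.
split=> h; first exact: connect_trans cc.
by apply: connect_trans h _; rewrite csym.
Qed.

(** The blob of a vertex consists of the pixels near the outer thirds attached to it, the blob of an
    edge of those near its middle third. *)
Lemma drawing_faces : W != finset.set0 -> {in W, forall x, (0 < #|nbr (@adj G) W x|)%N} ->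
  exists (I : finType) (z : I -> {set {set G}}), face_family (@adj G) W z.
Proof.
move=> Wn0 Wdeg.
pose T x (q : P) := [exists k : {set G} * 'I_3, [&& k.1 \in E, attach k x & covered k q]].
pose c1 e := cell (arc e (1 / 3)); pose c2 e := cell (arc e (2 / 3)).
have in_third (t : 'I_3) (z : R) : t%:R / 3 <= z -> z <= t.+1%:R / 3 -> z \in third t.
  by move=> h1 h2; rewrite in_itv /= h1.
have T0 : (0 : R) \in third ord0 by apply: in_third => /=; lra.
have T1 : (1 : R) \in third ord_max by apply: in_third => /=; lra.
have T13 : (1 / 3 : R) \in third ord0 by apply: in_third => /=; lra.
have T13' : (1 / 3 : R) \in third o1 by apply: in_third => /=; lra.
have T23' : (2 / 3 : R) \in third o1 by apply: in_third => /=; lra.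
have T23 : (2 / 3 : R) \in third ord_max by apply: in_third => /=; lra.
have att0 e : attach (e, ord0) (u e) by rewrite /attach /= eqxx.
have att1 e : attach (e, ord_max) (w e) by rewrite /attach /= eqxx.
have cov_cell e t s : e \in E -> s \in third t -> covered (e, t) (cell (arc e s)).
  move=> eE st; have [b1 b2] := bounded eE (third01 st).
  by apply/asboolP; exists (arc e s); [exists s | apply: near_cell].
have covT e t x : e \in E -> attach (e, t) x -> subpred (covered (e, t)) (T x).
  by move=> eE ax q cq; apply/existsP; exists (e, t); rewrite /= eE ax.
have mono (A B : pred P) p q : subpred A B -> connect (grestr A) p q -> connect (grestr B) p q.
  move=> AB; apply: connect_sub => p' q' /and3P[Ap Aq pq]; apply: connect1.
  by rewrite /= !AB.
have cov_pos k (q : P) : covered k q -> (0 < q.1)%N && (0 < q.2)%N.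
  by move=> /asboolP[x _ /and4P[_ _ -> ->]].
apply: (@blob_faces m G (@adj G) (@adj_irr G) W T (fun e => covered (e, o1)) u w (fun x => cell (pos x)) c1 c2) => //.
- by move=> e eE; have [] := arc_ends dr eE.
- move=> x y q xW yW /existsP[k /and3P[kE kx kq]] /existsP[k' /and3P[kE' ky kq']].
  apply: contrapT => xy; apply: (covered_disj kE kE' _ kq kq') => z kz kz'.
  by apply: xy; apply: (attach_disj kE kE' kx ky kz kz').
- move=> e f q eE fE cq cq'; apply: contrapT => ef.
  apply: (covered_disj (k := (e, o1)) (k' := (f, o1)) eE fE _ cq cq') => z kz kz'.
  by apply: ef; apply: (middle_disj eE fE kz kz').
- move=> e x q eE xW cq /existsP[k /and3P[kE kx kq]].
  apply: contrapT => xe; apply: (covered_disj (k := (e, o1)) eE kE _ cq kq) => z kz kz'.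
  by apply: xe; apply: (middle_attach_disj eE kE kx kz kz').
(* The pixel of a vertex is covered only through an incident arc, so the degree must be positive. *)
- move=> x xW; have := Wdeg x xW; rewrite card_gt0 => /finset.set0Pn[y].
  rewrite inE => /andP[yW xy].
  have [e [eE xe]] : exists e, e \in E /\ x \in e.
    by exists [set x; y]%SET; split; [apply/edgesP; exists x, y | rewrite !inE eqxx].
  have [Ee _ _ _ [p0 p1]] := arc_ends dr eE.
  move: xe; rewrite {1}Ee => /set2P[Ex|Ex].
    by apply: (covT _ ord0 x eE); [rewrite Ex | rewrite Ex -p0; apply: cov_cell].
  by apply: (covT _ ord_max x eE); [rewrite Ex | rewrite Ex -p1; apply: cov_cell].
- move=> e eE; have [_ _ _ _ [<- _]] := arc_ends dr eE.
  by apply: mono (covT _ _ _ eE (att0 e)) _; apply: piece_connect.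
- move=> e eE; have [_ _ _ _ [_ <-]] := arc_ends dr eE.
  by apply: mono (covT _ _ _ eE (att1 e)) _; apply: piece_connect.
- by move=> e eE; apply: cov_cell.
- by move=> e eE; apply: piece_connect.
- by move=> x q xW /existsP[k /and3P[_ _ /cov_pos]].
- by move=> e q _ /cov_pos.
Qed.

End Scale.
End Pixels.

(** Compactness bounds the finitely many arcs by [b] and separates their disjoint pieces by [d];
    then [N] is chosen large for [d], and [m] large for [N] and [b]. *)
Lemma planar_faces : W != finset.set0 -> {in W, forall x, (0 < #|nbr (@adj G) W x|)%N} -> planar R G ->
  exists (I : finType) (z : I -> {set {set G}}), face_family (@adj G) W z.
Proof.
move=> Wn0 Wdeg plan; have [pos [arc [u [w dr]]]] := planar_drawing Wn0 plan.
have pc k : k.1 \in E -> compact (piece arc k).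
  move=> kE; apply: continuous_compact; last exact: segment_compact.
  by apply: continuous_subspaceW (arc_cont dr kE) => z; apply: third01.
have [b bP] : exists b, forall e, e \in E -> forall s, s \in `[0, 1] -> `|(arc e s).1| <= b /\ `|(arc e s).2| <= b.
  apply: fin_uniform_bound => [e|e b b' bb' h eE s s01]; last first.
    by have [h1 h2] := h eE s s01; split; apply: le_trans bb'.
  have [eE|eE] := boolP (e \in E); last by exists 0.
  have c01 : compact (arc e @` [set` `[0, 1]]).
    by apply: continuous_compact; [exact: (arc_cont dr eE) | exact: segment_compact].
  have [b bP] := compact_coord_bounded c01; exists b => _ s s01; apply: bP; by exists s.
have [d d0 dP] : exists2 d, 0 < d & forall kk : ({set G} * 'I_3) * ({set G} * 'I_3), kk.1.1 \in E -> kk.2.1 \in E ->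
    (forall z, piece arc kk.1 z -> piece arc kk.2 z -> False) ->
    forall x y, piece arc kk.1 x -> piece arc kk.2 y -> d <= `|x.1 - y.1| + `|x.2 - y.2|.
  apply: fin_uniform_pos => [kk|kk d d' d'0 d'd h k1 k2 dis x y kx ky]; last first.
    by apply: le_trans d'd _; apply: h.
  have [k1|k1] := boolP (kk.1.1 \in E); last by exists 1.
  have [k2|k2] := boolP (kk.2.1 \in E); last by exists 1.
  have [dis|ndis] := pselect (forall z, piece arc kk.1 z -> piece arc kk.2 z -> False); last by exists 1.
  have [d d0 h] := compact_sep (pc _ k1) (pc _ k2) dis.
  by exists d => // _ _ _; exact: h.
pose N := (Num.truncn (8 / d)).+1.
have N_large : 8 < N%:R * d.
  by rewrite -ltr_pdivrMr //; have /andP[] := truncn_itv (ltW (divr_gt0 (ltr0n R 8) d0)).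
have N0 : 0 < N%:R :> R by rewrite ltr0n.
pose m := (Num.truncn (`|N%:R * (2 * b) + 1|)).+1.
have m_large : N%:R * (2 * b) + 1 < m%:R.
  apply: le_lt_trans (ler_norm _) _.
  by have /andP[] := truncn_itv (normr_ge0 (N%:R * (2 * b) + 1)).
apply: (@drawing_faces pos arc u w dr N m b d) => //.
- by move=> e s eE s01; apply: bP.
- by move=> k k' kE kE'; apply: (dP (k, k')).
Qed.

End Drawing.

(** * The number of colours, and the conclusion *)

Lemma tau'_geom k d : (2 < d)%N -> (tau' (2 * k + 1) d = (d * geom d.-1 k.+1)%:R)%R.
Proof.
case: d => [|[|[|q]]] // _; rewrite /tau' /=.
have -> : ((2 * k + 1 + 1) %/ 2 = k.+1)%N by lia.
have q0 : (0 < q.+2)%N by [].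
have := congr1 (fun n => n%:R%R : rat) (geom_mul k.+1 q0).
rewrite natrB ?expn_gt0 // natrM natrX /= => gm.
have -> : (q.+3%:R - 2 = q.+1%:R :> rat)%R by rewrite -[q.+3]addn2 natrD addrK.
have -> : (q.+3%:R - 1 = q.+2%:R :> rat)%R by rewrite -[q.+3]addn1 natrD addrK.
rewrite -[X in (_ - X)%R]mulr1 -mulrBr -gm mulrCA mulKf ?pnatr_eq0 //.
by rewrite natrM.
Qed.

Theorem theorem4p1 (R : realType) (t : nat) (G : sgraph) (d : nat) :
  (3 <= t)%N -> odd t ->
  planar R G ->
  max_degree G = d -> (4 <= d)%N ->
  girth_at_least G (6 * (t ^ 2 + 2 * t - 1))%N ->
  ((dist_chromatic_index t G)%:R <= tau' t d)%R.
Proof.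
move=> t3 todd plan degd d4 girth.
pose k := (t./2)%N.
have tk : t = (2 * k + 1)%N by rewrite /k mul2n addn1 -[LHS]odd_double_half todd.
pose K := (d * geom d.-1 k.+1)%N.
have dq : d.-1.+1 = d by lia.
have deg (x : G) : (#|[set y | adj x y]%SET| <= d.-1.+1)%N.
  by rewrite dq -degd cardsE /max_degree (leq_bigmax x).
have [|||W Wn0 Wdeg|c cgood] := @good_exists G (@adj G) (@adj_sym G) (@adj_irr G) 'I_K k d.-1 _ deg _ _ _ finset.setT.
- by lia.
- by rewrite card_ord /K dq.
(* With [t = 2k + 1] the girth is at least [24k^2 + 48k + 12], which exceeds [40k + 40] as soon as
   [k >= 1]; this uses [t >= 3]. *)
- move=> c c3 uc; apply: leq_trans (girth c c3 uc); rewrite tk; nia.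
- have [|I [z zf]] := planar_faces Wn0 _ plan; first by move=> x /Wdeg/ltnW.
  exact: (faces_few_branch (@adj_sym G) (@adj_irr G) zf Wn0 Wdeg).
have colK : dist_edge_colourable t G K by rewrite tk; apply: good_colourable cgood.
rewrite tk tau'_geom -?tk; last by lia.
rewrite ler_nat /dist_chromatic_index; case: ex_minnP => n _; exact.
Qed.
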